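(* Let $(\Sigma,\mathrm{ar})$ be a mixed binding signature. Then: (1) The nominal set $(T_\Sigma^\infty)_{\mathrm{fs}}$ is the nominal metric completion of $T_\Sigma$ (for the Arnold–Nivat metric $d$), and it is the terminal coalgebra $\nu Y.\mu X.T_\Sigma(X,Y)$ in $\mathbf{Nom}$. (2) The nominal set $(T_\Sigma/{\approx_\alpha})^\infty_{\mathrm{fs}}$ is the nominal metric completion of $T_\Sigma/{\approx_\alpha}$ (for $d_\alpha$), and it is the terminal coalgebra $\nu Y.\mu X.T^\alpha_\Sigma(X,Y)$ in $\mathbf{Nom}$. (3) In $\mathbf{Set}$ one has $(T_\Sigma/{\approx_\alpha})^\infty_{\mathrm{fs}}=(T_\Sigma^\infty)_{\mathrm{ffv}}/{\approx_\alpha}$, and the following diagram commutes: the top row is $T_\Sigma\to(T_\Sigma^\infty)_{\mathrm{fs}}\hookrightarrow(T_\Sigma^\infty)_{\mathrm{ffv}}\hookrightarrow T_\Sigma^\infty$ (the first arrow being the nominal metric completion, and the composite being the metric completion $T_\Sigma\rightarrowtail T_\Sigma^\infty$); the bottom row is $T_\Sigma/{\approx_\alpha}\to(T_\Sigma/{\approx_\alpha})^\infty_{\mathrm{fs}}=(T_\Sigma^\infty)_{\mathrm{ffv}}/{\approx_\alpha}\hookrightarrow(T_\Sigma/{\approx_\alpha})^\infty$ (the first arrow the nominal metric completion, the composite the metric completion); the vertical arrows $T_\Sigma\twoheadrightarrow T_\Sigma/{\approx_\alpha}$, $(T_\Sigma^\infty)_{\mathrm{fs}}\to(T_\Sigma/{\approx_\alpha})^\infty_{\mathrm{fs}}$,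 $(T_\Sigma^\infty)_{\mathrm{ffv}}\twoheadrightarrow(T_\Sigma^\infty)_{\mathrm{ffv}}/{\approx_\alpha}$ and $T_\Sigma^\infty\to(T_\Sigma/{\approx_\alpha})^\infty$ are the canonical quotient maps; moreover the rightmost square, with corners $(T_\Sigma^\infty)_{\mathrm{ffv}}$, $T_\Sigma^\infty$, $(T_\Sigma^\infty)_{\mathrm{ffv}}/{\approx_\alpha}$, $(T_\Sigma/{\approx_\alpha})^\infty$, is a pullback.
   Context: Fix a set $\mathcal{V}$ of variables; $\mathrm{Perm}(\mathcal{V})$ is the group of permutations generated by transpositions $(x\,x')$. A nominal set is a set with a $\mathrm{Perm}(\mathcal{V})$-action in which each element $a$ has a finite support (least finite $S\subseteq\mathcal{V}$ such that permutations fixing $S$ pointwise fix $a$); $\mathbf{Nom}$ is the category of nominal sets and equivariant maps. For a set $S$ with a $\mathrm{Perm}(\mathcal{V})$-action, $S_{\mathrm{fs}}$ is the nominal set of its finitely supported elements. The abstraction functor $[\mathcal{V}]A=(\mathcal{V}\times A)/\sim$, with $(x,a)\sim(x',a')$ iff some $y\notin\mathrm{supp}(a)\cup\mathrm{supp}(a')\cup\{x,x'\}$ satisfies $(x\,y)\cdot a=(x'\,y)\cdot a'$, action $\sigma\cdot\langle x\rangle a=\langle\sigma(x)\rangle(\sigma\cdot a)$. A mixed binding signature (MBS) is $(\Sigma,\mathrm{ar})$ with $\Sigma$ an at most countable set of constructors and $\mathrm{ar}:\Sigma\to(\mathbb{N}\times\{0,1\})^*$; for $\mathrm{ar}(c)=((n_1,b_1),\dots,(n_k,b_k))$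 argument $i$ binds $n_i$ variables and is inductive ($b_i=0$) or coinductive ($b_i=1$). Term functor (on $\mathbf{Set}$ or $\mathbf{Nom}$): $T_\Sigma(X,Y)=\mathcal{V}+\coprod_c\prod_{i=1}^k\mathcal{V}^{n_i}\times\pi_{b_i}(X,Y)$ with $\pi_0(X,Y)=X$, $\pi_1(X,Y)=Y$; quotient term functor on $\mathbf{Nom}$: $T^\alpha_\Sigma(X,Y)=\mathcal{V}+\coprod_c\prod_{i=1}^k[\mathcal{V}]^{n_i}\pi_{b_i}(X,Y)$. $\mu$ and $\nu$ denote initial algebras and terminal coalgebras. Raw finite terms $T_\Sigma=\mu Z.T_\Sigma(Z,Z)$: finite trees of variables and nodes $c(\bar x_1.t_1,\dots,\bar x_k.t_k)$, $\bar x_i\in\mathcal{V}^{n_i}$. Raw mixed terms $T_\Sigma^\infty=\nu Y.\mu X.T_\Sigma(X,Y)$ (in $\mathbf{Set}$): possibly infinite such trees where every infinite branch passes through infinitely many coinductive positions. Permutations act (inductively on finite, coinductively on mixed terms) by $\sigma\cdot x=\sigma(x)$, $\sigma\cdot c(\bar x_1.t_1,\dots)=c(\sigma(\bar x_1).\sigma\cdot t_1,\dots)$; the support of a mixed term, when finite, is the set of variables occurring in it. $(T_\Sigma^\infty)_{\mathrm{ffv}}$ is the set of mixed terms with finitely many free variables. $\alpha$-equivalence on finite terms (also over $\Sigma\cup\{*\}$, $*$ a new constant): $x\approx_\alpha x$, $*\approx_\alpha *$, and $c(\bar x_1.t_1,\dots)\approx_\alpha c(\bar y_1.u_1,\dots)$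 whenever $(\bar x_i\,\bar z_i)\cdot t_i\approx_\alpha(\bar y_i\,\bar z_i)\cdot u_i$ for fresh $\bar z_i$, for all $i$. Truncation: $[t]_0=*$, $[x]_{n+1}=x$, $[c(\bar x_1.t_1,\dots,\bar x_k.t_k)]_{n+1}=c(\bar x_1.[t_1]_{n+1-b_1},\dots,\bar x_k.[t_k]_{n+1-b_k})$. Mixed terms $t,u$ are $\alpha$-equivalent iff $[t]_n\approx_\alpha[u]_n$ for all $n$. Arnold–Nivat metric $d(t,u)=\inf\{2^{-n}:[t]_n=[u]_n\}$; on $T_\Sigma/{\approx_\alpha}$, $d_\alpha(t,u)=\inf\{2^{-n}:[t]_n\approx_\alpha[u]_n\}$, with Cauchy completion $(T_\Sigma/{\approx_\alpha})^\infty$ (carrying the induced permutation action). The nominal metric completion of a nominal set with an equivariant metric is obtained by adding the limits of all finitely supported Cauchy sequences (sequences whose elements' supports are all contained in a common finite set). *)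

(* Defs.v *)
From HB Require Import structures.
From mathcomp Require Import all_boot all_order all_algebra.
From mathcomp Require Import all_classical all_reals all_analysis.

Set Implicit Arguments.
Unset Strict Implicit.
Unset Printing Implicit Defensive.

Import Order.TTheory GRing.Theory Num.Theory numFieldNormedType.Exports.

Local Open Scope classical_set_scope.

Section Perm.
Variable V : choiceType.

Definition swap (x y : V) : V -> V :=
  fun z => if z == x then y else if z == y then x else z.

(* swaps [:: (x1, z1); ..; (xn, zn)] = (x1 z1) \o .. \o (xn zn) *)
Definition swaps (s : seq (V * V)) : V -> V :=
  foldr (fun p f => swap p.1 p.2 \o f) id s.

Record perm := Perm {
  perm_fun :> V -> V;
  perm_gen : exists s, perm_fun = swaps s }.

Definition pswaps (s : seq (V * V)) : perm := Perm (ex_intro _ s erefl).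

Definition pswap (x y : V) : perm := pswaps [:: (x, y)].

Definition perm_id : perm := pswaps [::].

Lemma swaps_cat s1 s2 : swaps (s1 ++ s2) = swaps s1 \o swaps s2.
Proof. by elim: s1 => //= p s1 ->. Qed.

Fact perm_comp_gen (s t : perm) : exists l, s \o t = swaps l.
Proof.
case: s t => [f [l1 fE]] [g [l2 gE]].
by exists (l1 ++ l2); rewrite swaps_cat /= fE gE.
Qed.

Definition perm_comp (s t : perm) : perm := Perm (perm_comp_gen s t).

Lemma perm_eq_fun (s t : perm) : s =1 t -> s = t.
Proof.
case: s t => [f pf] [g pg] /= /funext efg; subst g.
by rewrite (Prop_irrelevance pf pg).
Qed.

Lemma swapK x y : involutive (swap x y).
Proof.
move=> z; rewrite /swap; case: (eqVneq z x) => [->|zx].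
  by case: (eqVneq y x) => [//|_]; rewrite eqxx.
case: (eqVneq z y) => [->|zy]; first by rewrite eqxx.
by rewrite (negbTE zx) (negbTE zy).
Qed.

Lemma perm_inv (s : perm) :
  exists t, perm_comp s t = perm_id /\ perm_comp t s = perm_id.
Proof.
case: s => f [l fE]; exists (pswaps (rev l)).
have swapsK l' : cancel (swaps l') (swaps (rev l')).
  elim: l' => [//|p l' ih] z.
  by rewrite rev_cons -cats1 swaps_cat /= swapK ih.
split; apply: perm_eq_fun => z /=; rewrite fE /=; last exact: swapsK.
by have := swapsK (rev l) z; rewrite revK.
Qed.

Lemma perm_inj (s : perm) : injective s.
Proof.
have [t [_ ts]] := perm_inv s.
move=> x y e; have := congr1 t e.
by rewrite -[t (s x)]/(perm_comp t s x) -[t (s y)]/(perm_comp t s y) ts.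
Qed.

Lemma perm_swap (s : perm) x y z : s (swap x y z) = swap (s x) (s y) (s z).
Proof.
rewrite /swap !(inj_eq (@perm_inj s)).
by case: (z == x) => //; case: (z == y).
Qed.

Record permSet := PermSet {
  carrier :> Type;
  act : perm -> carrier -> carrier;
  act1 : forall a, act perm_id a = a;
  actM : forall s t a, act (perm_comp s t) a = act s (act t a) }.

Definition equivariant (A B : permSet) (f : A -> B) : Prop :=
  forall s a, f (act s a) = act s (f a).

Definition supports (A : permSet) (S : seq V) (a : A) : Prop :=
  forall s : perm, {in S, forall x, s x = x} -> act s a = a.

Definition fin_supp (A : permSet) (a : A) : Prop := exists S, supports S a.

(* The intersection of all finite supporting sets; it is the least one when
   V is infinite and a is finitely supported, see [supp_least]. *)
Definition supp (A : permSet) (a : A) : set V :=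
  [set x | forall S, supports S a -> x \in S].

Record nomSet := NomSet {
  nom_permSet :> permSet;
  nom_fin_supp : forall a : nom_permSet, fin_supp a }.

End Perm.

Arguments act {V p}.
Arguments perm_id {V}.

Section PermSetTheory.
Variable V : choiceType.
Implicit Types A B : permSet V.

Lemma act_inv A (s : perm V) :
  exists t, cancel (act s : A -> A) (act t) /\ cancel (act t : A -> A) (act s).
Proof.
have [t [st ts]] := perm_inv s; exists t; split=> a.
  by rewrite -actM ts act1.
by rewrite -actM st act1.
Qed.

Lemma act_inj A (s : perm V) : injective (act s : A -> A).
Proof. by have [t [/can_inj]] := act_inv A s. Qed.

Lemma supports_act A S (a : A) (s : perm V) :
  supports S a -> supports (map s S) (act s a).
Proof.
move=> Sa t tS; have [r [sr rs]] := perm_inv s.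
have cE : perm_comp t s = perm_comp s (perm_comp r (perm_comp t s)).
  apply: perm_eq_fun => x /=.
  by rewrite -[s (r _)]/(perm_comp s r _) sr.
rewrite -actM cE actM Sa // => x xS /=.
by rewrite tS ?map_f // -[r (s x)]/(perm_comp r s x) rs.
Qed.

Lemma fin_supp_act A (a : A) (s : perm V) : fin_supp a -> fin_supp (act s a).
Proof. by case=> S Sa; exists (map s S); exact: supports_act. Qed.

Lemma supports_sub A S S' (a : A) :
  {subset S <= S'} -> supports S a -> supports S' a.
Proof. by move=> SS' Sa s sS'; apply: Sa => x /SS' /sS'. Qed.

Lemma supports_equivariant A B (f : A -> B) S a :
  equivariant f -> supports S a -> supports S (f a).
Proof. by move=> fe Sa s sS; rewrite -fe Sa. Qed.

Lemma supp_act A (a : A) (s : perm V) x : supp a x -> supp (act s a) (s x).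
Proof.
move=> ax S /supports_act; have [t [st ts]] := perm_inv s => /(_ t).
rewrite -actM ts act1 => /ax /mapP[y yS ->].
by rewrite -[s (t y)]/(perm_comp s t y) st.
Qed.

Lemma supp_actE A (a : A) (s : perm V) x : supp (act s a) (s x) <-> supp a x.
Proof.
split; last exact: supp_act.
have [t [st ts]] := perm_inv s => /(@supp_act _ _ t).
by rewrite -actM ts act1 -[t (s x)]/(perm_comp t s x) ts.
Qed.

End PermSetTheory.

Section Constructions.
Variable V : choiceType.

Definition fs_type (A : permSet V) := {a : A | fin_supp a}.

Definition fs_act (A : permSet V) (s : perm V) (a : fs_type A) : fs_type A :=
  exist _ (act s (sval a)) (fin_supp_act s (svalP a)).

Lemma fs_eq (A : permSet V) (a b : fs_type A) : sval a = sval b -> a = b.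
Proof.
case: a b => [a ha] [b hb] /= ab; subst b.
by rewrite (Prop_irrelevance ha hb).
Qed.

Definition fs_permSet (A : permSet V) : permSet V.
Proof.
apply: (@PermSet _ (fs_type A) (@fs_act A)) => [a|s t a]; apply: fs_eq => /=.
  exact: act1.
exact: actM.
Defined.

Definition fs (A : permSet V) : nomSet V.
Proof.
apply: (@NomSet _ (fs_permSet A)) => -[a [S Sa]].
by exists S => s /Sa sa; apply: fs_eq.
Defined.

Definition tuple_permSet (n : nat) : permSet V.
Proof.
apply: (@PermSet _ (n.-tuple V) (fun s t => map_tuple s t)) => [a|s t a].
  by apply: val_inj; rewrite /= map_id.
by apply: val_inj; rewrite /= map_comp.
Defined.

Definition tuple_nom (n : nat) : nomSet V.
Proof.
apply: (@NomSet _ (tuple_permSet n)) => t; exists t => s st.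
by apply: val_inj => /=; rewrite -[RHS]map_id; apply/eq_in_map.
Defined.

Definition atom_permSet : permSet V.
Proof. by apply: (@PermSet _ V (fun s x => s x)). Defined.

Definition atom_nom : nomSet V.
Proof.
apply: (@NomSet _ atom_permSet) => x; exists [:: x] => s; apply.
exact: mem_head.
Defined.

Definition prod_permSet (A B : permSet V) : permSet V.
Proof.
apply: (@PermSet _ (A * B)%type (fun s ab => (act s ab.1, act s ab.2))).
  by case=> a b /=; rewrite !act1.
by move=> s t [a b] /=; rewrite !actM.
Defined.

Definition prod_nom (A B : nomSet V) : nomSet V.
Proof.
apply: (@NomSet _ (prod_permSet A B)) => -[a b].
have [S Sa] := nom_fin_supp a; have [S' Sb] := nom_fin_supp b.
exists (S ++ S') => s sS /=; congr (_, _).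
  by apply: Sa => x xS; rewrite sS // mem_cat xS.
by apply: Sb => x xS; rewrite sS // mem_cat xS orbT.
Defined.

(* A/R, as the set of the equivalence classes [set b | R a b]. *)
Record quot (A : Type) (R : A -> A -> Prop) := Quot {
  qset : set A;
  qset_ex : exists a, qset = [set b | R a b] }.

Definition cls (A : Type) (R : A -> A -> Prop) (a : A) : quot R :=
  Quot (ex_intro _ a erefl).

Definition qrepr (A : Type) (R : A -> A -> Prop) (q : quot R) : A :=
  projT1 (cid (qset_ex q)).

Lemma qreprK (A : Type) (R : A -> A -> Prop) : cancel (@qrepr A R) (@cls A R).
Proof.
case=> P P_ex; rewrite /qrepr /=; case: cid => a /= e; subst P.
by congr Quot; apply: Prop_irrelevance.
Qed.

Lemma quot_eq (A : Type) (R : A -> A -> Prop) (p q : quot R) :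
  qset p = qset q -> p = q.
Proof.
case: p q => [P hP] [Q hQ] /= e; subst Q.
by congr Quot; apply: Prop_irrelevance.
Qed.

Definition equivariant_rel (A : permSet V) (R : A -> A -> Prop) : Prop :=
  forall s a b, R a b -> R (act s a) (act s b).

Section QuotPermSet.
Variables (A : permSet V) (R : A -> A -> Prop).
Hypothesis R_equivariant : equivariant_rel R.

Lemma image_class s a :
  act s @` [set b | R a b] = [set b | R (act s a) b].
Proof.
apply/seteqP; split=> [_ [b Rab <-]|b Rab] /=; first exact: R_equivariant.
have [t [st ts]] := act_inv A s; exists (act t b); last exact: ts.
by rewrite -[a]st; exact: R_equivariant.
Qed.

Fact quot_act_ex s (q : quot R) :
  exists a, act s @` qset q = [set b | R a b].
Proof.
by have [a ->] := qset_ex q; exists (act s a); exact: image_class.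
Qed.

Definition quot_act s (q : quot R) : quot R := Quot (quot_act_ex s q).

Definition quot_permSet : permSet V.
Proof.
apply: (@PermSet _ (quot R) quot_act) => [q|s t q]; apply: quot_eq => /=.
  rewrite -[RHS]image_id; congr image; apply/funext; exact: act1.
rewrite image_comp; congr image; apply/funext => a; exact: actM.
Defined.

Lemma act_cls s a : act s (cls R a : quot_permSet) = cls R (act s a).
Proof. by apply: quot_eq; exact: image_class. Qed.

Lemma quot_fin_supp :
  (forall a : A, fin_supp a) -> forall q : quot_permSet, fin_supp q.
Proof.
move=> fsA q; rewrite -(qreprK q); have [S Sa] := fsA (qrepr q).
by exists S => s sS; rewrite act_cls Sa.
Qed.

End QuotPermSet.

Definition quot_nom (A : nomSet V) (R : A -> A -> Prop)
  (hR : equivariant_rel R) : nomSet V :=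
  NomSet (@quot_fin_supp A R hR (@nom_fin_supp _ A)).

Definition abs_rel (A : nomSet V) (p q : prod_nom atom_nom A) : Prop :=
  exists y : V, [/\ ~ supp p.2 y, ~ supp q.2 y, y <> p.1, y <> q.1
    & act (pswap p.1 y) p.2 = act (pswap q.1 y) q.2].

Lemma act_swap (A : permSet V) (s : perm V) x y (a : A) :
  act s (act (pswap x y) a) = act (pswap (s x) (s y)) (act s a).
Proof.
rewrite -!actM; congr act.
by apply: perm_eq_fun => z /=; exact: perm_swap.
Qed.

Lemma abs_rel_equivariant (A : nomSet V) : equivariant_rel (@abs_rel A).
Proof.
move=> s [x a] [x' a'] [y [/= ya ya' yx yx' e]]; exists (s y); split=> /=.
- by move/supp_actE.
- by move/supp_actE.
- by move/perm_inj.
- by move/perm_inj.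
- by rewrite -!act_swap e.
Qed.

Definition abs (A : nomSet V) : nomSet V := quot_nom (@abs_rel_equivariant A).

Definition abs_intro (A : nomSet V) (x : V) (a : A) : abs A :=
  cls (@abs_rel A) (x, a).

(* <x>a |-> <x>(h a); well defined for equivariant h, see [abs_mapE]. *)
Definition abs_map (A B : nomSet V) (h : A -> B) (p : abs A) : abs B :=
  abs_intro (qrepr p).1 (h (qrepr p).2).

Fixpoint absn (n : nat) (A : nomSet V) : nomSet V :=
  if n is m.+1 then abs (absn m A) else A.

(* <x1>..<xn>a *)
Fixpoint absn_intro (n : nat) (A : nomSet V) : n.-tuple V -> A -> absn n A :=
  match n return n.-tuple V -> A -> absn n A with
  | 0 => fun _ a => a
  | m.+1 => fun xs a => abs_intro (thead xs) (absn_intro (behead_tuple xs) a)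
  end.

Fixpoint absn_map (n : nat) (A B : nomSet V) (h : A -> B) :
    absn n A -> absn n B :=
  match n return absn n A -> absn n B with
  | 0 => h
  | m.+1 => abs_map (absn_map (n := m) h)
  end.

End Constructions.

Arguments cls {A} R a.
Arguments absn_intro {V n A}.
Arguments absn_map {V} n {A B}.
Arguments abs_intro {V A}.

Section Infinite.
Variable V : choiceType.
Hypothesis V_infinite : infinite_set [set: V].

Lemma fresh_for (S : seq V) : exists x, x \notin S.
Proof.
apply: contrapT => hS; apply: V_infinite; apply: sub_finite_set (finite_seq S).
by move=> x _ /=; apply/negPn/negP => xS; apply: hS; exists x.
Qed.

Lemma pswap_fix (A : permSet V) S (a : A) x y :
  supports S a -> x \notin S -> y \notin S -> act (pswap x y) a = a.
Proof.
move=> Sa xS yS; apply: Sa => z zS /=; rewrite /swap.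
have [zx|_] := eqVneq z x; first by rewrite -zx zS in xS.
by have [zy|_] := eqVneq z y; first by rewrite -zy zS in yS.
Qed.

Lemma supp_pswap (A : permSet V) (a : A) x y :
  ~ supp a x -> ~ supp a y -> act (pswap x y) a = a.
Proof.
move=> /existsNP[S /not_implyP[Sa /negP xS]].
move=> /existsNP[S' /not_implyP[Sa' /negP yS]].
have [z] := fresh_for (x :: y :: S ++ S').
rewrite !inE mem_cat !negb_or => /and4P[zx zy zS zS'].
have [<-|xy] := eqVneq x y.
  rewrite -[RHS]act1; congr act; apply: perm_eq_fun => w /=.
  by rewrite /swap; have [->|wx] := eqVneq w x.
have -> : pswap x y =
    perm_comp (pswap x z) (perm_comp (pswap y z) (pswap x z)).
  have E : (((z == x) = false) * ((x == z) = false) * ((z == y) = false) *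
            ((y == z) = false) * ((x == y) = false) * ((y == x) = false))%type.
    by rewrite ![_ == z]eq_sym ![y == x]eq_sym !(negbTE zx, negbTE zy, negbTE xy).
  apply: perm_eq_fun => w /=; rewrite /swap.
  have [wx|wx] := eqVneq w x; first by rewrite ?wx ?(E, eqxx).
  have [wy|wy] := eqVneq w y; first by rewrite ?wy ?(E, eqxx).
  have [wz|wz] := eqVneq w z; first by rewrite ?wz ?(E, eqxx).
  by rewrite !(negbTE wx, negbTE wy, negbTE wz).
by rewrite !actM (pswap_fix Sa) // (pswap_fix Sa') // (pswap_fix Sa).
Qed.

Lemma perm_moved (s : perm V) : exists L : seq V, forall x, s x != x -> x \in L.
Proof.
case: s => f [l fE] /=; subst f; elim: l => [|[y z] l [L hL]] /=.
  by exists [::] => x; rewrite eqxx.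
exists (y :: z :: L) => x; rewrite !inE; apply: contraNT.
rewrite !negb_or => /and3P[xy xz xL].
have -> : swaps l x = x by apply/eqP/negPn/negP => /hL; exact/negP.
by rewrite /swap (negbTE xy) (negbTE xz).
Qed.

Lemma supp_fix (A : permSet V) (a : A) (s : perm V) :
  (forall x, supp a x -> s x = x) -> act s a = a.
Proof.
have [L hL] := perm_moved s; elim: L s hL => [|x L ih] s hL sa.
  rewrite -[RHS]act1; congr act; apply: perm_eq_fun => x /=.
  by apply/eqP/negPn/negP => /hL.
have [sx|sx] := eqVneq (s x) x.
  apply: ih sa => y ys; have := hL y ys; rewrite inE => /orP[/eqP yx|//].
  by move: ys; rewrite yx sx eqxx.
pose s' := perm_comp (pswap x (s x)) s.
have s'y y : y != x -> s y = y -> s' y = y.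
  move=> yx sy /=; rewrite sy /swap (negbTE yx); case: eqVneq => // ysx.
  by move: yx; rewrite -(inj_eq (@perm_inj _ s)) sy ysx eqxx.
have ax : ~ supp a x by move=> /sa /eqP; exact/negP.
have asx : ~ supp a (s x).
  by move=> /sa /perm_inj /eqP; exact/negP.
have sE : s = perm_comp (pswap x (s x)) s'.
  by apply: perm_eq_fun => y /=; rewrite swapK.
rewrite sE actM ih ?supp_pswap //.
- move=> y ys'; have yx : y != x.
    by apply: contraNneq ys' => -> /=; rewrite /swap (negbTE sx) eqxx.
  have : s y != y by apply: contraNneq ys' => /(s'y _ yx) ->.
  by move=> /hL; rewrite inE (negbTE yx).
- move=> y ay; apply: s'y; last exact: sa.
  by apply: contra_notN ax => /eqP <-.
Qed.

(* The support of a finitely supported element is its least finite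
   supporting set. *)
Lemma supp_least (A : permSet V) (a : A) :
  fin_supp a -> exists S, supports S a /\ supp a = [set` S].
Proof.
case=> S Sa; exists [seq x <- S | `[<supp a x>]].
have memE x : supp a x -> x \in [seq x <- S | `[<supp a x>]].
  by move=> ax; rewrite mem_filter; apply/andP; split; [exact/asboolP | exact: ax].
split; first by move=> s hs; apply: supp_fix => x /memE /hs.
apply/seteqP; split=> x /=; first exact: memE.
by rewrite mem_filter => /andP[/asboolP].
Qed.

Lemma fresh_supp (A B : nomSet V) (a : A) (b : B) (S : seq V) :
  exists z, [/\ ~ supp a z, ~ supp b z & z \notin S].
Proof.
have [Sa [_ aE]] := supp_least (nom_fin_supp a).
have [Sb [_ bE]] := supp_least (nom_fin_supp b).
have [z] := fresh_for (Sa ++ Sb ++ S); rewrite !mem_cat !negb_or.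
by move=> /and3P[za zb zS]; exists z; split=> //; rewrite ?aE ?bE; exact/negP.
Qed.

Lemma abs_rel_any (A : nomSet V) (p q : prod_nom (atom_nom V) A) z :
  abs_rel p q -> ~ supp p.2 z -> ~ supp q.2 z -> z <> p.1 -> z <> q.1 ->
  act (pswap p.1 z) p.2 = act (pswap q.1 z) q.2.
Proof.
case: p q => [x a] [x' a'] [y [/= ya ya' yx yx' e]] za za' zx zx'.
have key w b : y <> w -> z <> w -> ~ supp b y -> ~ supp b z ->
    act (pswap w z) b = act (pswap y z) (act (pswap w y) b) :> A.
  move=> yw zw yb zb; rewrite act_swap (supp_pswap yb zb) /=.
  congr act; congr pswap; rewrite /swap.
    by case: eqVneq => [wy|_]; [case: yw | case: eqVneq => [wz|//]; case: zw].
  by rewrite eqxx.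
by rewrite (key x a) // (key x' a') // e.
Qed.

Lemma abs_rel_refl (A : nomSet V) (p : prod_nom (atom_nom V) A) : abs_rel p p.
Proof.
have [z [zp _]] := fresh_supp p.2 p.2 [:: p.1]; rewrite inE => /eqP zx.
by exists z; split.
Qed.

Lemma abs_rel_sym (A : nomSet V) (p q : prod_nom (atom_nom V) A) :
  abs_rel p q -> abs_rel q p.
Proof. by case=> y [? ? ? ? ?]; exists y; split. Qed.

Lemma abs_rel_trans (A : nomSet V) (p q r : prod_nom (atom_nom V) A) :
  abs_rel p q -> abs_rel q r -> abs_rel p r.
Proof.
move=> pq qr; have [z [[zp zq] zr]] : exists z, (~ supp p.2 z /\ ~ supp q.2 z) /\
    [/\ ~ supp r.2 z, z <> p.1, z <> q.1 & z <> r.1].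
  have [S [_ pE]] := supp_least (nom_fin_supp p.2).
  have [z [zq zr]] := fresh_supp q.2 r.2 (p.1 :: q.1 :: r.1 :: S).
  rewrite !inE !negb_or => /and4P[/eqP zp /eqP zq' /eqP zr' zS].
  by exists z; do ?split=> //; rewrite pE; exact/negP.
case: zr => zr1 zp1 zq1 zr2; exists z; split=> //.
by rewrite (abs_rel_any pq) // (abs_rel_any qr).
Qed.

Lemma abs_introP (A : nomSet V) (x y : V) (a b : A) :
  abs_intro x a = abs_intro y b <-> abs_rel (x, a) (y, b).
Proof.
split=> [/(congr1 (@qset _ _)) /= e|ab].
  suff : [set c | abs_rel (x, a) c] (y, b) by [].
  by rewrite e; exact: abs_rel_refl.
apply: quot_eq; apply/seteqP; split=> c /=.
  exact: (abs_rel_trans (abs_rel_sym ab)).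
exact: (abs_rel_trans ab).
Qed.

Lemma abs_mapE (A B : nomSet V) (h : A -> B) (x : V) (a : A) :
  equivariant h -> abs_map h (abs_intro x a) = abs_intro x (h a).
Proof.
move=> he; rewrite /abs_map; set p := qrepr _.
have : abs_intro p.1 p.2 = abs_intro x a.
  by rewrite /abs_intro -surjective_pairing /p qreprK.
have hsupp (b : A) y : ~ supp b y -> ~ supp (h b) y.
  by move=> nb hb; apply: nb => S /(supports_equivariant he); exact: hb.
move=> /abs_introP[y [/= ya ya' yx yx' e]]; apply/abs_introP.
by exists y; split=> //=; rewrite ?hsupp // -?he ?e //; apply: hsupp.
Qed.

End Infinite.

(* In an arity, (n, b) is an argument binding n variables; it is coinductive
   if b, and inductive otherwise. *)
Record signature := Signature {
  constr : countType;
  arity : constr -> seq (nat * bool) }.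

Definition argty (S : signature) (c : constr S) := 'I_(size (arity c)).

Definition nbind (S : signature) (c : constr S) (k : nat) : nat :=
  (nth (0%N, false) (arity c) k).1.

Definition coind (S : signature) (c : constr S) (k : nat) : bool :=
  (nth (0%N, false) (arity c) k).2.

(* S extended with a constant * *)
Definition star (S : signature) : signature :=
  @Signature (option (constr S)) (fun o => if o is Some c then arity c else [::]).

(* pi_b *)
Definition sel (O : Type) (b : bool) (X Y : O) : O := if b then Y else X.

Section Sel.
Variables (O : Type) (car : O -> Type).

Definition sel_map (b : bool) (X X' Y Y' : O)
    (f : car X -> car X') (g : car Y -> car Y') :
    car (sel b X Y) -> car (sel b X' Y') :=
  match b return car (sel b X Y) -> car (sel b X' Y') with
  | true => g
  | false => f
  end.

Definition insel (b : bool) (X : O) : car X -> car (sel b X X) :=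
  match b return car X -> car (sel b X X) with true => id | false => id end.

Definition unsel (b : bool) (X : O) : car (sel b X X) -> car X :=
  match b return car (sel b X X) -> car X with true => id | false => id end.

End Sel.

Arguments sel_map {O} car b {X X' Y Y'}.
Arguments insel {O} car b {X}.
Arguments unsel {O} car b {X}.

Section Layer.
Variables (V : choiceType) (S : signature).

(* V + \coprod_c \prod_i P c i *)
Inductive layer (P : forall c : constr S, argty c -> Type) : Type :=
| LVar (x : V)
| LNode (c : constr S) (a : forall i : argty c, P c i).

Arguments LVar {P} x.
Arguments LNode {P} c a.

Definition layer_map (P Q : forall c : constr S, argty c -> Type)
    (h : forall c i, P c i -> Q c i) (l : layer P) : layer Q :=
  match l with
  | LVar x => LVar x
  | LNode c a => LNode c (fun i => h c i (a i))
  end.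

Definition layer_permSet (P : forall c : constr S, argty c -> permSet V) :
  permSet V.
Proof.
pose lact (s : perm V) (l : layer P) : layer P := match l with
  | LVar x => LVar (s x)
  | LNode c a => LNode c (fun i => act s (a i)) end.
apply: (@PermSet _ (layer P) lact) => [[x|c a]|s t [x|c a]] //=.
  by congr LNode; apply: functional_extensionality_dep => i; rewrite act1.
by congr LNode; apply: functional_extensionality_dep => i; rewrite actM.
Defined.

Lemma finite_supports (n : nat) (A : 'I_n -> permSet V) (a : forall i, A i) :
  (forall i, fin_supp (a i)) -> exists S, forall i, supports S (a i).
Proof.
move=> /choice[f fa]; exists (flatten (codom f)) => i.
apply: supports_sub (fa i) => x xf.
by apply/flattenP; exists (f i); rewrite ?codom_f.
Qed.

Definition layer_nom (P : forall c : constr S, argty c -> nomSet V) : nomSet V.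
Proof.
apply: (@NomSet _ (layer_permSet P)) => -[x|c a].
  by exists [:: x] => s /= sx; rewrite sx ?mem_head.
have [T Ta] := finite_supports (fun i => nom_fin_supp (a i)).
exists T => s sT /=; congr LNode.
by apply: functional_extensionality_dep => i; exact: Ta.
Defined.

(* T_S(X, Y), on sets *)
Definition rawT_set (X Y : Type) : Type :=
  layer (fun c i => ((nbind c i).-tuple V * sel (coind c i) X Y)%type).

Definition rawT_set_map (X X' Y Y' : Type) (f : X -> X') (g : Y -> Y') :
    rawT_set X Y -> rawT_set X' Y' :=
  layer_map (fun c i p => (p.1, sel_map id (coind c i) f g p.2)).

Definition underlying (A : nomSet V) : Type := A.

(* T_S(X, Y), on nominal sets *)
Definition rawT (X Y : nomSet V) : nomSet V :=
  layer_nom (fun c i =>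
    prod_nom (tuple_nom V (nbind c i)) (sel (coind c i) X Y)).

Definition rawT_map (X X' Y Y' : nomSet V) (f : X -> X') (g : Y -> Y') :
    rawT X Y -> rawT X' Y' :=
  layer_map (fun c i
      (p : prod_nom (tuple_nom V (nbind c i)) (sel (coind c i) X Y)) =>
    (p.1, sel_map underlying (coind c i) f g p.2)).

(* T^alpha_S(X, Y) *)
Definition alphaT (X Y : nomSet V) : nomSet V :=
  layer_nom (fun c i => absn (nbind c i) (sel (coind c i) X Y)).

Definition alphaT_map (X X' Y Y' : nomSet V) (f : X -> X') (g : Y -> Y') :
    alphaT X Y -> alphaT X' Y' :=
  layer_map (fun c i =>
    absn_map (nbind c i) (sel_map underlying (coind c i) f g)).

End Layer.

Arguments LVar {V S P} x.
Arguments LNode {V S P} c a.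
Arguments underlying {V} A.

(* A category of sets with structure: objects, underlying sets, and the maps
   that are morphisms. *)
Record category := Category {
  obj :> Type;
  car : obj -> Type;
  hom : forall A B : obj, (car A -> car B) -> Prop }.

Definition SetCat : category :=
  @Category Type id (fun _ _ _ => True).

Definition Nom (V : choiceType) : category :=
  @Category (nomSet V) (@underlying V) (fun A B f => equivariant f).

Section MuNu.
Variables (C : category) (F : C -> C -> C).
Variable Fmap : forall X X' Y Y' : C, (car X -> car X') -> (car Y -> car Y') ->
  car (F X Y) -> car (F X' Y').

Definition initial_algebra (Y M : C) (inM : car (F M Y) -> car M) : Prop :=
  hom inM /\
  forall (A : C) (a : car (F A Y) -> car A), hom a ->
    exists! h : car M -> car A, hom h /\ h \o inM = a \o Fmap h id.

(* The functor Y |-> mu X. F(X, Y), on objects; [is_mu_map] gives its action on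
   morphisms. *)
Record mu_functor := MuFunctor {
  mu : C -> C;
  mu_in : forall Y, car (F (mu Y) Y) -> car (mu Y);
  mu_initial : forall Y, initial_algebra (@mu_in Y) }.

Definition is_mu_map (m : mu_functor) (Y Y' : C) (f : car Y -> car Y')
    (g : car (mu m Y) -> car (mu m Y')) : Prop :=
  hom g /\ g \o @mu_in m Y = @mu_in m Y' \o Fmap g f.

Definition terminal_coalgebra (m : mu_functor) (Z : C)
    (out : car Z -> car (mu m Z)) : Prop :=
  hom out /\
  forall (A : C) (a : car A -> car (mu m A)), hom a ->
    exists! h : car A -> car Z, hom h /\
      exists2 g, is_mu_map h g & out \o h = g \o a.

(* Z is nu Y. mu X. F(X, Y). By Lambek's lemma its structure map
   Z -> mu X. F(X, Z) is invertible; con : F(Z, Z) -> Z determines it, as the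
   inverse of the fold of the F(-, Z)-algebra con. *)
Definition is_nu_mu (Z : C) (con : car (F Z Z) -> car Z) : Prop :=
  hom con /\
  exists (m : mu_functor) (out : car Z -> car (mu m Z)),
    terminal_coalgebra out /\
    exists fold : car (mu m Z) -> car Z,
      [/\ hom fold, fold \o @mu_in m Z = con \o Fmap fold id,
          cancel out fold & cancel fold out].

End MuNu.

Section FiniteTerms.
Variable V : choiceType.

Inductive fterm (S : signature) : Type :=
| FVar (x : V)
| FNode (c : constr S) (xs : forall i : argty c, (nbind c i).-tuple V)
    (ts : argty c -> fterm S).

Arguments FVar {S} x.
Arguments FNode {S} c xs ts.

Fixpoint fterm_act (S : signature) (s : perm V) (t : fterm S) : fterm S :=
  match t with
  | FVar x => FVar (s x)
  | FNode c xs ts =>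
      FNode c (fun i => map_tuple s (xs i)) (fun i => fterm_act s (ts i))
  end.

Fixpoint fvars (S : signature) (t : fterm S) : seq V :=
  match t with
  | FVar x => [:: x]
  | FNode c xs ts =>
      flatten [seq tval (xs i) ++ fvars (ts i) | i <- enum 'I_(size (arity c))]
  end.

Definition fterm_permSet (S : signature) : permSet V.
Proof.
apply: (@PermSet _ (fterm S) (@fterm_act S)).
  elim=> [x|c xs ts ih] //=; congr FNode.
    apply: functional_extensionality_dep => i.
    by apply: val_inj; rewrite /= map_id.
  by apply/funext => i; exact: ih.
move=> s t; elim=> [x|c xs ts ih] //=; congr FNode.
  apply: functional_extensionality_dep => i.
  by apply: val_inj; rewrite /= map_comp.
by apply/funext => i; exact: ih.
Defined.

Definition fterm_nom (S : signature) : nomSet V.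
Proof.
apply: (@NomSet _ (fterm_permSet S)) => t; exists (fvars t) => s.
elim: t => [x /(_ x)|c xs ts ih] st /=; first by rewrite st ?mem_head.
have sub i : {subset tval (xs i) ++ fvars (ts i) <= fvars (FNode c xs ts)}.
  move=> x xi; apply/flattenP; exists (tval (xs i) ++ fvars (ts i)) => //.
  by apply/mapP; exists i; rewrite ?mem_enum.
congr FNode.
  apply: functional_extensionality_dep => i; apply: val_inj => /=.
  rewrite -[RHS]map_id; apply/eq_in_map => x xi.
  by apply/st/(sub i); rewrite mem_cat xi.
apply/funext => i; apply: ih => x xi.
by apply/st/(sub i); rewrite mem_cat xi orbT.
Defined.

(* (xs zs) . t *)
Definition rename (S : signature) n (xs zs : n.-tuple V) (t : fterm S) :
  fterm S := act (p := fterm_permSet S) (pswaps (zip xs zs)) t.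

Inductive alpha (S : signature) : fterm S -> fterm S -> Prop :=
| alpha_var x : alpha (FVar x) (FVar x)
| alpha_node (c : constr S) (xs ys zs : forall i : argty c, (nbind c i).-tuple V)
    (ts us : argty c -> fterm S) :
    (forall i, uniq (zs i)) ->
    (forall i, {in zs i, forall z,
       [/\ z \notin tval (xs i), z \notin tval (ys i),
           z \notin fvars (ts i) & z \notin fvars (us i)]}) ->
    (forall i, alpha (rename (xs i) (zs i) (ts i)) (rename (ys i) (zs i) (us i))) ->
    alpha (FNode c xs ts) (FNode c ys us).

Definition fstar (S : signature) : fterm (star S) :=
  @FNode (star S) None (fun i => match notF (ltn_ord i) with end)
    (fun i => match notF (ltn_ord i) with end).

Fixpoint ftrunc (S : signature) (n : nat) (t : fterm S) : fterm (star S) :=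
  if n is 0%N then fstar S else
  match t with
  | FVar x => FVar x
  | FNode c xs ts =>
      @FNode (star S) (Some c) xs 
        (fun i : argty c => ftrunc (n - coind c i) (ts i))
  end.

End FiniteTerms.

Arguments FVar {V S} x.
Arguments FNode {V S} c xs ts.

Section MixedTerms.
Variables (V : choiceType) (S : signature).

Definition label_permSet : permSet V :=
  layer_permSet (fun (c : constr S) i => tuple_permSet V (nbind c i)).

Definition label : Type := label_permSet.

Definition nargs (l : label) : nat :=
  if l is LNode c _ then size (arity c) else 0%N.

Definition coind_arg (l : label) (k : nat) : bool :=
  if l is LNode c _ then coind c k else false.

(* Trees are given by the labels of their nodes, a node being designated by
   its path from the root. *)
Record mterm := MTerm {
  lab : seq nat -> option label;
  lab_root : lab [::];
  lab_child : forall p k,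
    isSome (lab (rcons p k)) = if lab p is Some l then (k < nargs l)%N else false;
  (* every infinite branch passes through infinitely many coinductive
     positions *)
  lab_mixed : forall b : nat -> nat, (forall n, lab (mkseq b n)) ->
    forall N, exists2 n, (N <= n)%N &
      if lab (mkseq b n) is Some l then coind_arg l (b n) else false }.

Lemma mterm_eq (t u : mterm) : lab t =1 lab u -> t = u.
Proof.
case: t u => [f r c m] [g r' c' m'] /= /funext e; subst g.
by congr MTerm; apply: Prop_irrelevance.
Qed.

Definition tvar_lab (x : V) (p : seq nat) : option label :=
  if p is [::] then Some (LVar x) else None.

Fact tvar_child x p k : isSome (tvar_lab x (rcons p k)) =
  if tvar_lab x p is Some l then (k < nargs l)%N else false.
Proof. by case: p. Qed.

Fact tvar_mixed x (b : nat -> nat) : (forall n, tvar_lab x (mkseq b n)) ->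
  forall N, exists2 n, (N <= n)%N &
    if tvar_lab x (mkseq b n) is Some l then coind_arg l (b n) else false.
Proof. by move=> /(_ 1%N). Qed.

Definition tvar (x : V) : mterm :=
  @MTerm (tvar_lab x) isT (tvar_child x) (@tvar_mixed x).

Section Node.
Variables (c : constr S) (xs : forall i : argty c, (nbind c i).-tuple V).
Variable ts : argty c -> mterm.

Definition tnode_lab (p : seq nat) : option label :=
  match p with
  | [::] => Some (LNode c xs)
  | k :: p' =>
      if insub k : option 'I_(size (arity c)) is Some i then lab (ts i) p'
      else None
  end.

Fact tnode_child p k : isSome (tnode_lab (rcons p k)) =
  if tnode_lab p is Some l then (k < nargs l)%N else false.
Proof.
case: p => [|j p] /=; last by case: insub => // i; exact: lab_child.
by case: insubP => [i -> _|/negbTE ->] //; exact: lab_root.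
Qed.

Fact tnode_mixed (b : nat -> nat) : (forall n, tnode_lab (mkseq b n)) ->
  forall N, exists2 n, (N <= n)%N &
    if tnode_lab (mkseq b n) is Some l then coind_arg l (b n) else false.
Proof.
have mkS n : mkseq b n.+1 = b 0%N :: mkseq (fun m => b m.+1) n.
  by rewrite /mkseq /= -[1%N]addn0 iotaDl -map_comp.
move=> hb N.
have : isSome (tnode_lab (mkseq b 1)) by exact: hb.
rewrite mkS /=; case E: insub => [i|//] _.
have hi n : isSome (lab (ts i) (mkseq (fun m => b m.+1) n)).
  by have := hb n.+1; rewrite mkS /= E.
have [n Nn hn] := lab_mixed hi N.
by exists n.+1; [exact: leqW | rewrite mkS /= E].
Qed.

Definition tnode : mterm :=
  @MTerm tnode_lab isT tnode_child tnode_mixed.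

End Node.

Arguments tnode c xs ts : clear implicits.

Section Child.
Variables (t : mterm) (k : nat) (hk : lab t [:: k]).

Fact child_child p j : isSome (lab t (k :: rcons p j)) =
  if lab t (k :: p) is Some l then (j < nargs l)%N else false.
Proof. by rewrite -rcons_cons lab_child. Qed.

Fact child_mixed (b : nat -> nat) : (forall n, lab t (k :: mkseq b n)) ->
  forall N, exists2 n, (N <= n)%N &
    if lab t (k :: mkseq b n) is Some l then coind_arg l (b n) else false.
Proof.
pose b' n := if n is m.+1 then b m else k.
have mkS n : mkseq b' n.+1 = k :: mkseq b n.
  by rewrite /mkseq /= -[1%N]addn0 iotaDl -map_comp.
move=> hb N; have hb' n : isSome (lab t (mkseq b' n)).
  by case: n => [|n]; [exact: lab_root | rewrite mkS].
have [[//|n] Nn hn] := lab_mixed hb' N.+1.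
by exists n => //; rewrite -mkS.
Qed.

Definition child : mterm :=
  @MTerm (fun p => lab t (k :: p)) hk child_child child_mixed.

End Child.

Lemma mterm_case (t : mterm) :
  (exists x, t = tvar x) \/ (exists c xs ts, t = tnode c xs ts).
Proof.
case E: (lab t [::]) => [[x|c xs]|]; last by have := lab_root t; rewrite E.
  left; exists x; apply: mterm_eq; case=> [//|k p] /=.
  suff : ~~ lab t (k :: p) by case: (lab t _).
  elim/last_ind: p => [|p j ih]; first by have := lab_child t [::] k => ->; rewrite E.
  by rewrite -rcons_cons lab_child; case: (lab t (k :: p)) ih.
right; exists c, xs.
have hi (i : argty c) : lab t [:: val i].
  by rewrite (lab_child t [::] i) E /= ltn_ord.
exists (fun i => child (hi i)); apply: mterm_eq; case=> [//|k p] /=.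
case: insubP => [i _ <- //|hk].
suff : ~~ lab t (k :: p) by case: (lab t _).
elim/last_ind: p => [|p j ih].
  by have := lab_child t [::] k => ->; rewrite E.
by rewrite -rcons_cons lab_child; case: (lab t (k :: p)) ih.
Qed.

Lemma tnode_inj c xs ts xs' ts' :
  tnode c xs ts = tnode c xs' ts' -> xs = xs' /\ ts = ts'.
Proof.
move=> /(congr1 lab) e; split.
  have /= [h] := congr1 (@^~ [::]) e; exact: existT_inj2 h.
apply/funext => i; apply: mterm_eq => p.
by have := congr1 (@^~ (val i :: p)) e; rewrite /= valK.
Qed.

Definition ind_child (u t : mterm) : Prop :=
  exists c xs ts (i : argty c), [/\ t = tnode c xs ts, u = ts i & ~~ coind c i].

Lemma ind_child_wf : well_founded ind_child.
Proof.
move=> t; apply: contrapT => nt.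
have step (u : {u | ~ Acc ind_child u}) :
    exists vk : {u | ~ Acc ind_child u} * nat,
      (forall p, lab (sval u) (vk.2 :: p) = lab (sval vk.1) p) /\
      ~~ (if lab (sval u) [::] is Some l then coind_arg l vk.2 else false).
  case: u => u nu /=; apply: contrapT => hu; apply: nu; constructor=> v vu.
  apply: contrapT => nv; case: vu => c [xs [ts [i [uE vE ci]]]].
  apply: hu; exists (exist _ v nv, val i); split=> [p|] /=; subst u v => //=.
  by rewrite valK.
have [f hf] := choice step.
pose s n := iter n (fun u => (f u).1) (exist _ t nt).
pose b n := (f (s n)).2.
have sE n p : lab t (mkseq b n ++ p) = lab (sval (s n)) p.
  elim: n p => [//|n ih] p.
  by rewrite mkseqS cat_rcons ih /= (hf (s n)).1.
have bE n : lab t (mkseq b n) = lab (sval (s n)) [::] by rewrite -sE cats0.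
have [|n _] := @lab_mixed t b _ 0%N.
  by move=> n; rewrite bE; exact: lab_root.
rewrite bE => hn; have := (hf (s n)).2; rewrite -/(b n).
by move: hn; case: (lab _ _) => [l ->|].
Qed.

Lemma mterm_act_child (s : perm V) (t : mterm) p k :
  isSome (omap (act (p := label_permSet) s) (lab t (rcons p k))) =
  if omap (act (p := label_permSet) s) (lab t p) is Some l
  then (k < nargs l)%N else false.
Proof.
have -> o : isSome (omap (act (p := label_permSet) s) o) = isSome o by case: o.
by rewrite lab_child; case: (lab t p) => [[]|].
Qed.

Lemma mterm_act_mixed (s : perm V) (t : mterm) (b : nat -> nat) :
  (forall n, omap (act (p := label_permSet) s) (lab t (mkseq b n))) ->
  forall N, exists2 n, (N <= n)%N &
    if omap (act (p := label_permSet) s) (lab t (mkseq b n)) is Some l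
    then coind_arg l (b n) else false.
Proof.
move=> hb N; have hb' n : isSome (lab t (mkseq b n)).
  by have := hb n; case: (lab t _).
have [n Nn hn] := lab_mixed hb' N; exists n => //.
by move: hn; case: (lab t _) => [[]|].
Qed.

Lemma mterm_act_root (s : perm V) (t : mterm) :
  omap (act (p := label_permSet) s) (lab t [::]).
Proof. by have := lab_root t; case: (lab t [::]). Qed.

Definition mterm_act (s : perm V) (t : mterm) : mterm :=
  @MTerm (fun p => omap (act (p := label_permSet) s) (lab t p))
    (mterm_act_root s t) (mterm_act_child s t) (@mterm_act_mixed s t).

Definition mterm_permSet : permSet V.
Proof.
apply: (@PermSet _ mterm mterm_act) => [t|s t u]; apply: mterm_eq => p /=.
  by case: (lab t p) => //= l; congr Some; exact: (act1 (p := label_permSet)).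
by case: (lab u p) => //= l; congr Some; exact: (actM (p := label_permSet)).
Defined.

Lemma mterm_act_tvar s x :
  act (p := mterm_permSet) s (tvar x) = tvar (s x).
Proof. by apply: mterm_eq => -[]. Qed.

Lemma mterm_act_tnode s (c : constr S)
    (xs : forall i : argty c, (nbind c i).-tuple V) (ts : argty c -> mterm) :
  act (p := mterm_permSet) s (tnode c xs ts) =
  tnode c (fun i => map_tuple s (xs i))
    (fun i => act (p := mterm_permSet) s (ts i)).
Proof. by apply: mterm_eq => -[//|k p] /=; case: insub. Qed.

Fixpoint emb (t : fterm V S) : mterm :=
  match t with
  | FVar x => tvar x
  | FNode c xs ts => tnode c xs (fun i => emb (ts i))
  end.

(* truncates n t w states that [t]_n = w. *)
Inductive truncates : nat -> mterm -> fterm V (star S) -> Prop :=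
| truncates0 t : truncates 0 t (fstar V S)
| truncates_var n x : truncates n.+1 (tvar x) (FVar x)
| truncates_node n (c : constr S) (xs : forall i : argty c, (nbind c i).-tuple V)
    (ts : argty c -> mterm) (us : argty c -> fterm V (star S)) :
    (forall i : argty c, truncates (n.+1 - coind c i) (ts i) (us i)) ->
    truncates n.+1 (tnode c xs ts) (@FNode V (star S) (Some c) xs us).

Lemma truncates_ex n t : exists w, truncates n t w.
Proof.
elim: n t => [|n ihn] t; first by exists (fstar V S); constructor.
elim/(well_founded_ind ind_child_wf): t => t iht.
have [[x tE]|[c [xs [ts tE]]]] := mterm_case t.
  by exists (FVar x); rewrite tE; constructor.
suff /choice[us h] (i : argty c) : exists w, truncates (n.+1 - coind c i) (ts i) w.
  exists (@FNode V (star S) (Some c) xs us); rewrite tE.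
  exact: (@truncates_node n c xs ts us h).
case E: (coind c i); first by rewrite subn1; exact: ihn.
by rewrite subn0; apply: iht; exists c, xs, ts, i; rewrite E.
Qed.

Lemma tnode_neq_tvar c xs ts x : tnode c xs ts <> tvar x.
Proof. by move=> e; have := congr1 (lab^~ [::]) e. Qed.

Lemma tvar_inj : injective tvar.
Proof. by move=> x y e; have /= [] := congr1 (lab^~ [::]) e. Qed.

Lemma tnode_inj1 c xs ts d ys us : tnode c xs ts = tnode d ys us -> c = d.
Proof. by move=> e; have /= [] := congr1 (lab^~ [::]) e. Qed.

Lemma truncates_inv n t w : truncates n t w ->
  match n with
  | 0 => w = fstar V S
  | m.+1 =>
    (forall x, t = tvar x -> w = FVar x) /\
    (forall (c : constr S) xs (ts : argty c -> mterm), t = tnode c xs ts ->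
      exists2 us : argty c -> fterm V (star S),
        w = @FNode V (star S) (Some c) xs us &
        forall i : argty c, truncates (m.+1 - coind c i) (ts i) (us i))
  end.
Proof.
case=> {n t w} [//|n x|n c xs ts us h]; split.
- by move=> y /tvar_inj ->.
- by move=> c xs ts /esym /tnode_neq_tvar.
- by move=> y /tnode_neq_tvar.
- move=> d ys vs e; have cd := tnode_inj1 e; subst d.
  by have [exs ets] := tnode_inj e; subst ys vs; exists us.
Qed.

Lemma truncates_fun n t w w' : truncates n t w -> truncates n t w' -> w = w'.
Proof.
move=> tw; elim: tw w' => {n t w} [t|n x|n c xs ts us _ ih] w' /truncates_inv.
- by [].
- by case=> /(_ x erefl).
- case=> _ /(_ c xs ts erefl) [us' -> h].
  by congr (@FNode V (star S) (Some c)); apply/funext => i; apply: ih; exact: h.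
Qed.

Definition mtrunc (n : nat) (t : mterm) : fterm V (star S) :=
  projT1 (cid (truncates_ex n t)).

Lemma mtruncP n t w : truncates n t w -> mtrunc n t = w.
Proof. by apply: truncates_fun; exact: (projT2 (cid (truncates_ex n t))). Qed.

Lemma mtrunc0 t : mtrunc 0 t = fstar V S.
Proof. by apply: mtruncP; constructor. Qed.

Lemma mtrunc_tvar n x : mtrunc n.+1 (tvar x) = FVar x.
Proof. by apply: mtruncP; constructor. Qed.

Lemma mtrunc_tnode n (c : constr S)
    (xs : forall i : argty c, (nbind c i).-tuple V) (ts : argty c -> mterm) :
  mtrunc n.+1 (tnode c xs ts) =
  @FNode V (star S) (Some c) xs (fun i : argty c => mtrunc (n.+1 - coind c i) (ts i)).
Proof.
apply: mtruncP; apply: (@truncates_node n c xs ts) => i.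
exact: (projT2 (cid (truncates_ex _ _))).
Qed.

Definition malpha (t u : mterm) : Prop :=
  forall n, alpha (mtrunc n t) (mtrunc n u).

Inductive free (x : V) : mterm -> Prop :=
| free_var : free x (tvar x)
| free_node (c : constr S) (xs : forall i : argty c, (nbind c i).-tuple V)
    (ts : argty c -> mterm) (i : argty c) :
    x \notin tval (xs i) -> free x (ts i) -> free x (tnode c xs ts).

(* (T_S^oo)_ffv *)
Definition ffv_term : Type :=
  {t : mterm | exists s : seq V, forall x, free x t -> x \in s}.

Definition ffv_alpha (t u : ffv_term) : Prop := malpha (sval t) (sval u).

End MixedTerms.

Arguments tvar {V} S x.
Arguments tnode {V S} c xs ts.

Section AlphaQuotient.
Variables (V : choiceType).

Lemma fvars_act (S : signature) (s : perm V) (t : fterm V S) :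
  fvars (fterm_act s t) = map s (fvars t).
Proof.
elim: t => [//|c xs ts ih] /=; rewrite map_flatten -map_comp; congr flatten.
by apply: eq_map => i /=; rewrite map_cat ih.
Qed.

Lemma rename_act (S : signature) (s : perm V) n (xs zs : n.-tuple V)
    (t : fterm V S) :
  fterm_act s (rename xs zs t) =
  rename (map_tuple s xs) (map_tuple s zs) (fterm_act s t).
Proof.
rewrite /rename -[LHS](actM (p := fterm_permSet V S)).
rewrite -[in RHS](actM (p := fterm_permSet V S)).
congr fterm_act; apply: perm_eq_fun => x /=.
rewrite -/(zip _ _); elim: (tval xs) (tval zs) => [|y ys ih] [|w ws] //=.
by rewrite perm_swap ih.
Qed.

Lemma alpha_equivariant (S : signature) :
  @equivariant_rel V (fterm_nom V S) (@alpha V S).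
Proof.
move=> s t u; elim=> {t u} [x|c xs ys zs ts us zu zf _ ih] /=.
  exact: alpha_var.
apply: (@alpha_node _ _ _ _ _ (fun i => map_tuple s (zs i))) => i.
- by rewrite map_inj_uniq; [exact: zu | exact: perm_inj].
- move=> _ /mapP[z zi ->]; have [] := zf i z zi.
  by rewrite !fvars_act !(mem_map (@perm_inj _ s)).
- by rewrite -!rename_act; exact: ih.
Qed.

(* T_S / alpha *)
Definition fterm_alpha (S : signature) : nomSet V :=
  quot_nom (@alpha_equivariant S).

Lemma ftrunc_act (S : signature) (s : perm V) n (t : fterm V S) :
  ftrunc n (fterm_act s t) = fterm_act s (ftrunc n t).
Proof.
have star_act : fterm_act s (fstar V S) = fstar V S.
  by congr (@FNode V (star S) None); apply: functional_extensionality_dep => -[].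
elim: t n => [x|c xs ts ih] [|n] //=.
by congr (@FNode V (star S) (Some c)); apply/funext => i; exact: ih.
Qed.

End AlphaQuotient.

Section Metric.
Local Open Scope ring_scope.
Variable R : realType.

Definition is_metric (A : Type) (d : A -> A -> R) : Prop :=
  [/\ forall a b, 0 <= d a b,
      forall a b, d a b = 0 <-> a = b,
      forall a b, d a b = d b a
    & forall a b c, d a c <= d a b + d b c].

Definition converges_to (A : Type) (d : A -> A -> R) (u : nat -> A) (a : A) :
  Prop := (fun n => d (u n) a) @ \oo --> (0 : R).

Definition cauchy_seq (A : Type) (d : A -> A -> R) (u : nat -> A) : Prop :=
  forall e : R, 0 < e ->
    exists N, forall m n, (N <= m)%N -> (N <= n)%N -> d (u m) (u n) < e.

Definition is_completion (A C : Type) (dA : A -> A -> R) (dC : C -> C -> R)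
    (i : A -> C) : Prop :=
  [/\ is_metric dA, is_metric dC,
      forall a b, dC (i a) (i b) = dA a b,
      forall u, cauchy_seq dC u -> exists c, converges_to dC u c
    & forall c, exists u, converges_to dC (i \o u) c].

Definition equivariant_dist (V : choiceType) (A : permSet V)
    (d : A -> A -> R) : Prop :=
  forall s a b, d (act s a) (act s b) = d a b.

Definition fs_seq (V : choiceType) (A : permSet V) (u : nat -> A) : Prop :=
  exists S : seq V, forall n, supp (u n) `<=` [set` S].

(* C is obtained from A by adding the limits of all finitely supported Cauchy
   sequences. *)
Definition is_nominal_completion (V : choiceType) (A C : nomSet V)
    (dA : A -> A -> R) (dC : C -> C -> R) (i : A -> C) : Prop :=
  [/\ is_metric dA /\ equivariant_dist dA,
      is_metric dC /\ equivariant_dist dC,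
      equivariant i /\ forall a b, dC (i a) (i b) = dA a b,
      forall u, fs_seq u -> cauchy_seq dA u ->
        exists c, converges_to dC (i \o u) c
    & forall c, exists u,
        [/\ fs_seq u, cauchy_seq dA u & converges_to dC (i \o u) c]].

Section Completion.
Variables (V : choiceType) (A : permSet V) (d : A -> A -> R).
Hypothesis d_equivariant : equivariant_dist d.

Lemma cauchy_seq_act (s : perm V) u :
  cauchy_seq d u -> cauchy_seq d (act s \o u).
Proof.
move=> hu e /hu[N hN]; exists N => m n Nm Nn.
by rewrite d_equivariant; exact: hN.
Qed.

Definition cauchy_permSet : permSet V.
Proof.
apply: (@PermSet _ {u : nat -> A | cauchy_seq d u}
  (fun s u => exist _ (act s \o sval u) (cauchy_seq_act s (svalP u)))).
- move=> [u hu]; apply: eq_exist => /=; apply/funext => n; exact: act1.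
- move=> s t [u hu]; apply: eq_exist => /=; apply/funext => n; exact: actM.
Defined.

Definition cauchy_rel (u v : cauchy_permSet) : Prop :=
  (fun n => d (sval u n) (sval v n)) @ \oo --> (0 : R).

Lemma cauchy_rel_equivariant : equivariant_rel cauchy_rel.
Proof.
move=> s u v; rewrite /cauchy_rel /=.
by under [in X in _ -> X]eq_fun do rewrite d_equivariant.
Qed.

Definition completion : permSet V := quot_permSet cauchy_rel_equivariant.

Definition completion_dist (p q : completion) : R :=
  lim ((fun n => d (sval (qrepr p) n) (sval (qrepr q) n)) @ \oo).

End Completion.

(* inf {2^-n : P n} *)
Definition trunc_dist (P : set nat) : R := inf [set 2 ^- n | n in P].

Section ArnoldNivat.
Variables (V : choiceType) (S : signature).

Definition fterm_dist (t u : fterm V S) : R :=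
  trunc_dist [set n | ftrunc n t = ftrunc n u].

Definition mterm_dist (t u : mterm V S) : R :=
  trunc_dist [set n | mtrunc n t = mtrunc n u].

Definition alpha_dist (p q : fterm_alpha V S) : R :=
  trunc_dist [set n | exists t u,
    [/\ qset p t, qset q u & alpha (ftrunc n t) (ftrunc n u)]].

Lemma alpha_dist_equivariant : equivariant_dist alpha_dist.
Proof.
move=> s p q; rewrite /alpha_dist; congr trunc_dist.
apply/seteqP; split=> n [t [u [pt qu tu]]] /=.
  case: pt qu tu => t' pt <- [u' qu <-] tu; exists t', u'; split=> //.
  have [r [sr rs]] := act_inv (fterm_nom V (star S)) s.
  have := @alpha_equivariant V (star S) r _ _ tu.
  by rewrite !ftrunc_act !sr.
exists (fterm_act s t), (fterm_act s u); split.
- by exists t.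
- by exists u.
- by rewrite !ftrunc_act; exact: (@alpha_equivariant V (star S)).
Qed.

(* (T_S / alpha)^oo *)
Definition alpha_completion : permSet V := completion alpha_dist_equivariant.

End ArnoldNivat.
End Metric.

Section MixedTerminal.
Variables (V : choiceType) (S : signature).

Definition mterm_con (l : rawT_set V S (mterm V S) (mterm V S)) : mterm V S :=
  match l with
  | LVar x => tvar S x
  | LNode c a => tnode c (fun i => (a i).1) (fun i => unsel id (coind c i) (a i).2)
  end.

(* mu X. T_S(X, Y) in Set *)
Inductive mixed (Y : Type) : Type :=
| MVar (x : V)
| MNode (c : constr S) (xs : forall i : argty c, (nbind c i).-tuple V)
    (f : forall i : argty c, coind c i = false -> mixed Y)
    (g : forall i : argty c, coind c i = true -> Y).

Arguments MVar {Y} x.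
Arguments MNode {Y} c xs f g.

Definition sel0 (b : bool) (X Y : Type) : sel b X Y -> b = false -> X :=
  match b return sel b X Y -> b = false -> X with
  | false => fun x _ => x
  | true => fun _ e => match notF (esym e) with end
  end.

Definition sel1 (b : bool) (X Y : Type) : sel b X Y -> b = true -> Y :=
  match b return sel b X Y -> b = true -> Y with
  | false => fun _ e => match notF e with end
  | true => fun y _ => y
  end.

Definition mksel (b : bool) (X Y : Type) :
    (b = false -> X) -> (b = true -> Y) -> sel b X Y :=
  match b return (b = false -> X) -> (b = true -> Y) -> sel b X Y with
  | false => fun f _ => f erefl
  | true => fun _ g => g erefl
  end.

Lemma sel0K b X Y (f : b = false -> X) (g : b = true -> Y) :
  sel0 (mksel f g) = f.
Proof.
by apply/funext => e; case: b f g e => // f g e; rewrite (Prop_irrelevance e erefl).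
Qed.

Lemma sel1K b X Y (f : b = false -> X) (g : b = true -> Y) :
  sel1 (mksel f g) = g.
Proof.
by apply/funext => e; case: b f g e => // f g e; rewrite (Prop_irrelevance e erefl).
Qed.

Lemma mkselK b X Y (x : sel b X Y) : mksel (sel0 x) (sel1 x) = x.
Proof. by case: b x. Qed.

Lemma unsel_mksel0 b X (f : b = false -> X) (g : b = true -> X) e :
  unsel id b (mksel f g) = f e.
Proof. by case: b f g e => // f g e; rewrite (Prop_irrelevance e erefl). Qed.

Lemma unsel_mksel1 b X (f : b = false -> X) (g : b = true -> X) e :
  unsel id b (mksel f g) = g e.
Proof. by case: b f g e => // f g e; rewrite (Prop_irrelevance e erefl). Qed.

Lemma mksel_map b X X' Y Y' (h : X -> X') (k : Y -> Y')
    (f : b = false -> X) (g : b = true -> Y) :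
  sel_map id b h k (mksel f g) = mksel (h \o f) (k \o g).
Proof. by case: b f g. Qed.

Definition mixed_in (Y : Type) (l : rawT_set V S (mixed Y) Y) : mixed Y :=
  match l with
  | LVar x => MVar x
  | LNode c a => MNode c (fun i => (a i).1)
      (fun i => sel0 (a i).2) (fun i => sel1 (a i).2)
  end.

Definition mixed_out (Y : Type) (m : mixed Y) : rawT_set V S (mixed Y) Y :=
  match m with
  | MVar x => LVar x
  | MNode c xs f g => LNode c (fun i => (xs i, mksel (f i) (g i)))
  end.

Lemma mixed_outK Y : cancel (@mixed_out Y) (@mixed_in Y).
Proof.
case=> [//|c xs f g] /=; congr MNode; apply: functional_extensionality_dep => i.
  exact: sel0K.
exact: sel1K.
Qed.

Fixpoint mixed_fold (Y A : Type) (a : rawT_set V S A Y -> A) (m : mixed Y) : A :=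
  match m with
  | MVar x => a (LVar x)
  | MNode c xs f g =>
      a (LNode c (fun i => (xs i, mksel (fun e => mixed_fold a (f i e)) (g i))))
  end.

Lemma mixed_fold_out Y A (a : rawT_set V S A Y -> A) m :
  mixed_fold a m = a (rawT_set_map (mixed_fold a) id (mixed_out m)).
Proof.
case: m => [//|c xs f g] /=; congr a; congr LNode.
by apply: functional_extensionality_dep => i; rewrite mksel_map.
Qed.

Lemma mixed_inK Y : cancel (@mixed_in Y) (@mixed_out Y).
Proof.
case=> [//|c a] /=; congr LNode; apply: functional_extensionality_dep => i.
by rewrite mkselK; case: (a i).
Qed.

Lemma mixed_fold_uniq Y A (a : rawT_set V S A Y -> A) (h : mixed Y -> A) :
  h \o @mixed_in Y = a \o rawT_set_map h id -> mixed_fold a = h.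
Proof.
move=> hE; apply/funext; elim=> [x|c xs f ih g].
  by have := congr1 (@^~ (LVar x)) hE.
rewrite -(mixed_outK (MNode c xs f g)) mixed_fold_out mixed_inK.
rewrite -[RHS]/((h \o @mixed_in Y) _) hE /=; congr a; congr LNode.
apply: functional_extensionality_dep => i; congr (_, _); rewrite !mksel_map.
by congr mksel; apply/funext => e /=; exact: ih.
Qed.

Lemma mixed_initial (Y : SetCat) :
  @initial_algebra SetCat (rawT_set V S) (@rawT_set_map V S) Y (mixed Y)
    (@mixed_in Y).
Proof.
split=> // A a _; exists (mixed_fold a); split; last first.
  by move=> h [_]; exact: mixed_fold_uniq.
by split=> //; apply/funext => l /=; rewrite mixed_fold_out mixed_inK.
Qed.

Definition mixed_functor :
    mu_functor (C := SetCat) (F := rawT_set V S) (@rawT_set_map V S) :=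
  @MuFunctor SetCat _ _ _ _ mixed_initial.

Definition mixed_map (Y Y' : Type) (h : Y -> Y') : mixed Y -> mixed Y' :=
  mixed_fold (@mixed_in Y' \o rawT_set_map id h).

Lemma is_mixed_map (Y Y' : SetCat) (h : Y -> Y') g :
  @is_mu_map SetCat _ _ mixed_functor Y Y' h g <-> g = mixed_map h.
Proof.
have mapE (l : rawT_set V S (mixed Y) Y) (k : mixed Y -> mixed Y') :
    rawT_set_map id h (rawT_set_map k id l) = rawT_set_map k h l.
  case: l => //= c a; congr LNode; apply: functional_extensionality_dep => i /=.
  by congr (_, _); case: (coind c i) (a i).2.
split=> [[_ gE]|->].
  apply/esym/mixed_fold_uniq; rewrite gE.
  by apply/funext => l /=; rewrite mapE.
split=> //; apply/funext => l /=.
by rewrite {1}/mixed_map mixed_fold_out mixed_inK /= mapE.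
Qed.

Lemma mixed_map_node Y Y' (h : Y -> Y') c xs f g :
  mixed_map h (MNode c xs f g) =
  MNode c xs (fun i e => mixed_map h (f i e)) (fun i e => h (g i e)).
Proof.
rewrite /mixed_map /=; congr MNode; apply: functional_extensionality_dep => i;
  by rewrite mksel_map /= ?sel0K ?sel1K.
Qed.

Notation mfold := (mixed_fold mterm_con).

Lemma mfold_node c xs f g : mfold (MNode c xs f g) =
  tnode c xs (fun i => unsel id (coind c i)
    (mksel (fun e => mfold (f i e)) (g i))).
Proof. by []. Qed.

Lemma mfold_inj : injective mfold.
Proof.
elim=> [x|c xs f ih g] [y|d ys f' g'].
- by move=> /tvar_inj ->.
- by move=> /esym /tnode_neq_tvar.
- by move=> /tnode_neq_tvar.
rewrite !mfold_node => e; have cd := tnode_inj1 e; subst d.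
have [-> ets] := tnode_inj e; congr MNode.
  apply: functional_extensionality_dep => i; apply/funext => ci; apply: ih.
  by have := congr1 (@^~ i) ets; rewrite !(unsel_mksel0 _ _ ci).
apply: functional_extensionality_dep => i; apply/funext => ci.
by have := congr1 (@^~ i) ets; rewrite !(unsel_mksel1 _ _ ci).
Qed.

Lemma mfold_surj t : exists m, mfold m = t.
Proof.
elim/(well_founded_ind (@ind_child_wf V S)): t => t ih.
have [[x ->]|[c [xs [ts tE]]]] := mterm_case t; first by exists (MVar x).
have /choice[f fE] (ie : {i : argty c | coind c i = false}) :
    exists m, mfold m = ts (sval ie).
  case: ie => i e /=.
  by apply: ih; exists c, xs, ts, i; rewrite e.
exists (MNode c xs (fun i e => f (exist _ i e)) (fun i _ => ts i)).
rewrite mfold_node tE; congr tnode; apply/funext => i.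
have [ci|ci] : coind c i = true \/ coind c i = false.
  by case: (coind c i); [left | right].
  by rewrite (unsel_mksel1 _ _ ci).
by rewrite (unsel_mksel0 _ _ ci) fE.
Qed.

Definition mterm_out (t : mterm V S) : mixed (mterm V S) :=
  projT1 (cid (mfold_surj t)).

Lemma mterm_outK : cancel mterm_out mfold.
Proof. by move=> t; exact: (projT2 (cid (mfold_surj t))). Qed.

Lemma mfoldK : cancel mfold mterm_out.
Proof. by move=> m; apply: mfold_inj; rewrite mterm_outK. Qed.

Section Unfold.
Variables (A : Type) (a : A -> mixed A).

Definition mixed_next (b : bool) : (b = false -> mixed A) -> (b = true -> A) -> mixed A :=
  match b with
  | false => fun f _ => f erefl
  | true => fun _ g => a (g erefl)
  end.

Fixpoint run (m : mixed A) (p : seq nat) {struct p} : option (label V S) :=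
  match p, m with
  | [::], MVar x => Some (LVar x)
  | [::], MNode c xs _ _ => Some (LNode c xs)
  | k :: p', MVar _ => None
  | k :: p', MNode c _ f g =>
      if insub k : option 'I_(size (arity c)) is Some i
      then run (mixed_next (f i) (g i)) p' else None
  end.

Lemma run_root m : run m [::].
Proof. by case: m. Qed.

Lemma run_child m p k : isSome (run m (rcons p k)) =
  if run m p is Some l then (k < nargs l)%N else false.
Proof.
elim: p m => [|j p ih] [x|c xs f g] //=.
  by case: insubP => [i -> _|/negbTE ->] //; exact: run_root.
by case: insub => [i|//]; exact: ih.
Qed.

Lemma run_coind m (b : nat -> nat) : (forall n, run m (mkseq b n)) ->
  exists n, if run m (mkseq b n) is Some l then coind_arg l (b n) else false.
Proof.
have mkS c n : mkseq c n.+1 = c 0%N :: mkseq (fun m => c m.+1) n.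
  by rewrite /mkseq /= -[1%N]addn0 iotaDl -map_comp.
elim: m b => [x|c xs f ih g] b hb; first by have := hb 1%N.
case ci: (coind c (b 0%N)); first by exists 0%N.
have := hb 1%N; rewrite mkS /=; case E: insub => [i|//] _.
have iE : val i = b 0%N by move: E; case: insubP => // j _ jE [<-].
have ci' : coind c i = false by rewrite /= iE.
have hn q : run (MNode c xs f g) (b 0%N :: q) = run (f i ci') q.
  rewrite /= E; move: (f i) (g i) (ci') => fi gi.
  by case: (coind c i) fi gi => // fi gi e; rewrite (Prop_irrelevance e erefl).
have [|n hnn] := ih i ci' (fun n => b n.+1).
  by move=> n; rewrite -hn -mkS.
by exists n.+1; rewrite mkS hn.
Qed.

Lemma run_tail m (q : seq nat) : run m q ->
  exists m', forall p, run m (q ++ p) = run m' p.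
Proof.
elim: q m => [|k q ih] m; first by exists m.
case: m => [//|c xs f g] /=; case: insub => [i|//]; exact: ih.
Qed.

Lemma run_mixed m (b : nat -> nat) : (forall n, run m (mkseq b n)) ->
  forall N, exists2 n, (N <= n)%N &
    if run m (mkseq b n) is Some l then coind_arg l (b n) else false.
Proof.
move=> hb N; have [m' m'E] := run_tail (hb N).
have mkE n : mkseq b N ++ mkseq (fun j => b (N + j)%N) n = mkseq b (N + n).
  rewrite /mkseq iotaD map_cat add0n; congr (_ ++ _).
  by rewrite -[N in RHS]addn0 iotaDl -map_comp.
have [|n hn] := @run_coind m' (fun n => b (N + n)%N).
  by move=> n; rewrite -m'E mkE.
by exists (N + n)%N; [exact: leq_addr | rewrite -mkE m'E].
Qed.

Definition unfold_mixed (m : mixed A) : mterm V S :=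
  @MTerm _ _ (run m) (run_root m) (run_child m) (@run_mixed m).

Definition mterm_unfold (x : A) : mterm V S := unfold_mixed (a x).

Lemma lab_mfold_run (h : A -> mterm V S) :
  (forall x, h x = mfold (mixed_map h (a x))) ->
  forall m, lab (mfold (mixed_map h m)) =1 run m.
Proof.
move=> hE m p; elim: p m => [|k p ih] [x|c xs f g] //.
rewrite mixed_map_node mfold_node /=; case: insub => [i|//].
move: (f i) (g i); case: (coind c i) => fi gi /=; last exact: ih.
by rewrite hE; exact: ih.
Qed.

Lemma unfold_mixedE m : unfold_mixed m = mfold (mixed_map mterm_unfold m).
Proof.
elim: m => [x|c xs f ih g]; first by apply: mterm_eq => -[].
rewrite mixed_map_node mfold_node; apply: mterm_eq => -[//|k p] /=.
case: insub => [i|//]; move: (ih i) => /=; move: (f i) (g i).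
by case: (coind c i) => fi gi /= ihi //; rewrite -ihi.
Qed.

End Unfold.

Lemma mterm_is_nu_mu :
  @is_nu_mu SetCat (rawT_set V S) (@rawT_set_map V S) (mterm V S) mterm_con.
Proof.
split=> //; exists mixed_functor, mterm_out; split; last first.
  exists mfold; split=> //; [|exact: mterm_outK|exact: mfoldK].
  by apply/funext => l /=; rewrite mixed_fold_out mixed_inK.
split=> // A a _; exists (mterm_unfold a); split.
  split=> //; exists (mixed_map (mterm_unfold a)); first exact/is_mixed_map.
  apply/funext => x /=; apply: mfold_inj; rewrite mterm_outK.
  exact: unfold_mixedE.
move=> h [_ [g /is_mixed_map gE outE]]; apply/funext => x.
have hE y : h y = mfold (mixed_map h (a y)).
  by rewrite -gE -[g (a y)]/((g \o a) y) -outE /= mterm_outK.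
apply: mterm_eq => p; rewrite hE.
by rewrite (lab_mfold_run hE).
Qed.

End MixedTerminal.

Definition is_pullback (P A B D : Type) (p1 : P -> A) (p2 : P -> B)
    (f : A -> D) (g : B -> D) : Prop :=
  f \o p1 = g \o p2 /\
  forall (Q : Type) (q1 : Q -> A) (q2 : Q -> B), f \o q1 = g \o q2 ->
    exists! u : Q -> P, p1 \o u = q1 /\ p2 \o u = q2.

Section Diagram.
Local Open Scope ring_scope.
Variables (R : realType) (V : choiceType) (S : signature).

(* (T_S^oo)_fs *)
Definition mterm_fs : nomSet V := fs (mterm_permSet V S).

Definition mterm_fs_dist (t u : mterm_fs) : R := mterm_dist R (sval t) (sval u).

(* (T_S / alpha)^oo_fs *)
Definition alpha_fs : nomSet V := fs (alpha_completion R V S).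

Definition alpha_fs_dist (p q : alpha_fs) : R :=
  completion_dist (sval p) (sval q).

(* (T_S^oo)_ffv / alpha *)
Definition ffv_quot : Type := quot (@ffv_alpha V S).

(* The canonical embedding is specified rather than defined because constant
   sequences are Cauchy only once d a a = 0 is known. *)
Definition is_completion_emb (j : fterm_alpha V S -> alpha_completion R V S) :
    Prop :=
  forall a, exists2 u : cauchy_permSet (@alpha_dist_equivariant R V S),
    sval u = (fun=> a) & j a = cls _ u.

(* q is the continuous extension of T_S -> T_S / alpha to the completions, and
   it identifies exactly the alpha-equivalent mixed terms. *)
Definition is_completed_quotient
    (j : fterm_alpha V S -> alpha_completion R V S)
    (q : mterm V S -> alpha_completion R V S) : Prop :=
  [/\ forall t, q (emb t) = j (cls _ t),
      forall t u, completion_dist (q t) (q u) <= mterm_dist R t u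
    & forall t u, q t = q u <-> malpha t u].

(* con : T_S(Z, Z) -> Z is given by the constructors of raw mixed terms, for
   Z = (T_S^oo)_fs. *)
Definition is_raw_con (con : rawT S mterm_fs mterm_fs -> mterm_fs) : Prop :=
  (forall x : V, sval (con (LVar x)) = tvar S x) /\
  (forall (c : constr S) (xs : forall i : argty c, (nbind c i).-tuple V)
      (ts : argty c -> mterm_fs),
    sval (con (LNode c (fun i => (xs i, insel underlying (coind c i) (ts i))))) =
    tnode c xs (fun i => sval (ts i))).

(* con : T^alpha_S(Z, Z) -> Z is given by the constructors on alpha-equivalence
   classes, for Z = (T_S / alpha)^oo_fs, the elements of which are the classes
   of mixed terms with finitely many free variables through e. *)
Definition is_alpha_con (e : ffv_quot -> alpha_fs)
    (con : alphaT S alpha_fs alpha_fs -> alpha_fs) : Prop :=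
  (forall (x : V) (t : ffv_term V S), sval t = tvar S x ->
    con (LVar x) = e (cls _ t)) /\
  (forall (c : constr S) (xs : forall i : argty c, (nbind c i).-tuple V)
      (ts : argty c -> ffv_term V S) (t : ffv_term V S),
    sval t = tnode c xs (fun i => sval (ts i)) ->
    con (LNode c (fun i => absn_intro (xs i)
      (insel underlying (coind c i) (e (cls _ (ts i)))))) = e (cls _ t)).

End Diagram.

(* Main.v *)
Require Import Defs.
From mathcomp Require Import all_boot all_order all_algebra.
From mathcomp Require Import all_classical all_reals all_analysis.

(* A mixed term is determined by its truncations, and so is a point of the
   completion of T_S / alpha by the alpha-classes of its truncations. These
   classes form an algebra with injective constructors on abstractions, which
   turns alpha-equivalence of nodes into equality in [V]^n, where bound names may
   be replaced by any fresh ones.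

   Terminality is the same argument for T_S and T^alpha_S. A coalgebra
   A -> mu X. F(X, A) in Nom is unfolded in Set, after choosing representatives of
   its values; the resulting mixed terms depend on the choices, but their
   truncations, up to alpha in the second case, do so equivariantly, and hence
   have a common finite support.

   Conversely, a finitely supported Cauchy sequence of alpha-classes has a mixed
   term as its limit: binders are chosen fresh for the common support of the
   sequence, level by level, and since only finitely many names are free in the
   sequence this never gets stuck. Without finite support it may, and this is why
   the quotient map T_S^oo -> (T_S / alpha)^oo need not be surjective. *)

Set Implicit Arguments.
Unset Strict Implicit.
Unset Printing Implicit Defensive.

Local Open Scope classical_set_scope.

(** * Nominal sets and name abstraction *)

Section Quotients.
Variables (A : Type) (R : A -> A -> Prop).
Hypothesis R_refl : forall a, R a a.
Hypothesis R_sym : forall a b, R a b -> R b a.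
Hypothesis R_trans : forall a b c, R a b -> R b c -> R a c.

Lemma clsE a b : cls R a = cls R b <-> R a b.
Proof.
split=> [/(congr1 (@qset _ _)) /= e|ab].
  suff : [set c | R a c] b by [].
  by rewrite e; exact: R_refl.
apply: quot_eq; apply/seteqP; split=> c /=; last exact: R_trans.
by apply: R_trans; exact: R_sym.
Qed.

Lemma qrepr_cls a : R a (qrepr (cls R a)).
Proof. by apply/clsE; rewrite qreprK. Qed.

End Quotients.

Section Renaming.
Variable V : choiceType.
Hypothesis V_infinite : infinite_set [set: V].
Implicit Types (A B : nomSet V) (s : perm V).

Lemma swapL (x y : V) : swap x y x = y.
Proof. by rewrite /swap eqxx. Qed.

Lemma swapR (x y : V) : swap x y y = x.
Proof. by have := swapK x y x; rewrite swapL. Qed.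

Lemma swap_neq (x y z : V) : z != x -> z != y -> swap x y z = z.
Proof. by rewrite /swap => /negbTE -> /negbTE ->. Qed.

Lemma supports_supp (A : permSet V) (T : seq V) (a : A) :
  (forall x, supp a x -> x \in T) -> supports T a.
Proof. by move=> aT s sT; apply: supp_fix => // x /aT /sT. Qed.

Lemma nom_supp_seq A (a : A) : exists T : seq V, forall x, supp a x <-> x \in T.
Proof.
have [T [_ aE]] := supp_least V_infinite (nom_fin_supp a).
by exists T => x; rewrite aE.
Qed.

Lemma swaps_notin (zs : seq (V * V)) x :
  x \notin unzip1 zs -> x \notin unzip2 zs -> swaps zs x = x.
Proof.
elim: zs => [//|[y z] zs ih] /=; rewrite !inE !negb_or.
move=> /andP[xy x1] /andP[xz x2].
by rewrite ih // /swap (negbTE xy) (negbTE xz).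
Qed.

Lemma pswaps_zip_fix n (xs zs : n.-tuple V) x :
  x \notin tval xs -> x \notin tval zs -> pswaps (zip xs zs) x = x.
Proof. by move=> ? ?; apply: swaps_notin; rewrite ?unzip1_zip ?unzip2_zip ?size_tuple. Qed.

Lemma pswaps_zip_map n (xs zs : n.-tuple V) : uniq xs -> uniq zs ->
  {in xs, forall x, x \notin tval zs} ->
  map_tuple (pswaps (zip xs zs)) xs = zs.
Proof.
move=> ux uz xz; apply: val_inj => /=.
have sz : size xs = size zs by rewrite !size_tuple.
have {}xz : forall x, x \in tval xs -> x \notin tval zs := xz.
elim: (tval xs) (tval zs) sz ux uz xz => [|x s ih] [|z t] //= [sz].
move=> /andP[xs' us] /andP[zt ut] xz.
have := xz x (mem_head _ _); rewrite inE negb_or => /andP[xnz xnt].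
congr (_ :: _).
  by rewrite swaps_notin ?unzip1_zip ?unzip2_zip ?sz // /swap eqxx.
have {}ih := ih t sz us ut _.
rewrite -{2}ih; last first.
  by move=> y ys; have := xz y (mem_behead (s := x :: s) ys); rewrite inE negb_or => /andP[].
apply/eq_in_map => y ys.
have yt : swaps (zip s t) y \in t.
  rewrite -[X in _ \in X]ih ?map_f // => w ws.
  by have := xz w (mem_behead (s := x :: s) ws); rewrite inE negb_or => /andP[].
rewrite -[LHS]/(swap x z (swaps (zip s t) y)).
by rewrite swap_neq //; [apply: contraNneq xnt => <- | apply: contraNneq zt => <-].
Qed.

Lemma act_pswaps (A : permSet V) (s : perm V) (l : seq (V * V)) (a : A) :
  act s (act (pswaps l) a) = act (pswaps [seq (s p.1, s p.2) | p <- l]) (act s a).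
Proof.
rewrite -!actM; congr act; apply: perm_eq_fun => x /=.
elim: l => [//|[y z] l ih] /=; by rewrite perm_swap ih.
Qed.

Lemma act_pswaps_zip (A : permSet V) s n (xs zs : n.-tuple V) (a : A) :
  act s (act (pswaps (zip xs zs)) a) =
  act (pswaps (zip (map_tuple s xs) (map_tuple s zs))) (act s a).
Proof.
rewrite act_pswaps; congr (act (pswaps _) _) => /=.
by elim: (tval xs) (tval zs) => [|x l ih] [|z l'] //=; rewrite ih.
Qed.

Lemma act_comp_pswaps_zip (A : permSet V) T n (xs zs ws : n.-tuple V) (a : A) :
  supports T a -> uniq zs -> uniq ws ->
  {in zs, forall z, z \notin tval xs /\ z \notin T} ->
  {in ws, forall z, [/\ z \notin tval xs, z \notin tval zs & z \notin T]} ->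
  act (pswaps (zip zs ws)) (act (pswaps (zip xs zs)) a) = act (pswaps (zip xs ws)) a.
Proof.
move=> Ta uz uw zf wf.
have nz x : x \in tval xs \/ x \in T -> x \notin tval zs.
  by move=> h; apply/negP => /zf[/negP ? /negP ?]; case: h.
have nw x : x \in tval xs \/ x \in T -> x \notin tval ws.
  by move=> h; apply/negP => /wf[/negP ? _ /negP ?]; case: h.
rewrite act_pswaps_zip pswaps_zip_map //; last first.
  by move=> z zz; apply/negP => /wf[_]; rewrite zz.
rewrite Ta; last by move=> x xT; apply: pswaps_zip_fix; [apply: nz | apply: nw]; right.
congr (act (pswaps (zip _ _)) _); rewrite -[RHS]map_id; apply/eq_in_map => x xx.
by apply: pswaps_zip_fix; [apply: nz | apply: nw]; left.
Qed.

Lemma fresh_tuple n (T : seq V) :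
  exists zs : n.-tuple V, uniq zs /\ {in zs, forall z, z \notin T}.
Proof.
elim: n T => [|n ih] T; first by exists [tuple].
have [z zT] := fresh_for V_infinite T; have [zs [uz zsT]] := ih (z :: T).
exists [tuple of z :: zs]; split.
  rewrite /= uz andbT; apply/negP => /zsT; by rewrite mem_head.
move=> w; rewrite inE => /orP[/eqP -> //|/zsT].
by rewrite inE negb_or => /andP[].
Qed.

Lemma supports_map_tuple n (xs : n.-tuple V) s :
  {in xs, forall x, s x = x} -> map_tuple s xs = xs.
Proof. by move=> h; apply: val_inj => /=; rewrite -[RHS]map_id; apply/eq_in_map. Qed.

Lemma act_abs_intro A s x (a : A) : act s (abs_intro x a) = abs_intro (s x) (act s a).
Proof. exact: (act_cls (@abs_rel_equivariant V A)). Qed.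

Lemma abs_intro_inj A x : injective (abs_intro x : A -> abs A).
Proof.
by move=> a b /(abs_introP V_infinite)[y [_ _ _ _ /= /act_inj]].
Qed.

Lemma abs_intro_surj A (p : abs A) : exists x a, p = abs_intro x a.
Proof. by exists (qrepr p).1, (qrepr p).2; rewrite /abs_intro -surjective_pairing qreprK. Qed.

Lemma abs_intro_rename A x z (a : A) :
  z <> x -> ~ supp a z -> abs_intro x a = abs_intro z (act (pswap x z) a).
Proof.
move=> zx za; apply/(abs_introP V_infinite).
have [y [ya yb]] := fresh_supp V_infinite a (act (pswap x z) a) [:: x; z].
rewrite !inE negb_or => /andP[yx yz].
exists y; split=> //=; [exact/eqP|exact/eqP|].
rewrite [RHS]act_swap (supp_pswap V_infinite za ya) /=; congr (act (pswap _ _) _).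
  by rewrite swap_neq // eq_sym //; exact/eqP.
by rewrite swapL.
Qed.

Lemma supp_abs_intro A x (a : A) y : supp (abs_intro x a) y <-> supp a y /\ y <> x.
Proof.
have [z [za zb zx]] := fresh_supp V_infinite a (abs_intro x a) [:: x; y].
move: zx; rewrite !inE negb_or => /andP[/eqP zx /eqP zy].
split=> [ay|[ay yx]].
  have [T aT] := nom_supp_seq a.
  have sT : supports (x :: T) (abs_intro x a).
    move=> s sT; rewrite act_abs_intro sT ?mem_head //; congr abs_intro.
    by apply: (supports_supp (T := T)) => [w /aT //|w wT]; rewrite sT // inE wT orbT.
  have nx : y <> x.
    move=> yx; subst y; move: ay; rewrite (abs_intro_rename zx za).
    have [T' bT] := nom_supp_seq (act (pswap x z) a).
    have sT' : supports (z :: T') (abs_intro z (act (pswap x z) a)).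
      move=> s sT'; rewrite act_abs_intro sT' ?mem_head //; congr abs_intro.
      by apply: (supports_supp (T := T')) => [w /bT //|w wT]; rewrite sT' // inE wT orbT.
    move=> /(_ _ sT'); rewrite inE => /orP[/eqP /esym //|/bT].
    rewrite -[X in supp _ X](swapR x z) => h; apply: za.
    exact/(supp_actE a (pswap x z)).
  split=> //; apply/aT; have := ay _ sT; by rewrite inE => /orP[/eqP //|].
apply: contrapT => ny.
have := supp_pswap V_infinite ny zb; rewrite act_abs_intro /=.
have -> : swap y z x = x by rewrite swap_neq // eq_sym; exact/eqP.
move=> /abs_intro_inj e; apply: za; rewrite -e.
by rewrite -[X in supp _ X](swapL y z); exact/(supp_actE a (pswap y z)).
Qed.

Lemma tuple_consE n (xs : n.+1.-tuple V) : 
  exists (x : V) (ys : n.-tuple V), xs = [tuple of x :: ys].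
Proof. by exists (thead xs), (behead_tuple xs); rewrite -tuple_eta. Qed.

Lemma absn_introS A n x (xs : n.-tuple V) (a : A) :
  absn_intro [tuple of x :: xs] a = abs_intro x (absn_intro xs a) :> absn n.+1 A.
Proof. by rewrite /=; congr (abs_intro _ (absn_intro _ _)); apply: val_inj. Qed.

Lemma act_absn_intro A s n (xs : n.-tuple V) (a : A) :
  act s (absn_intro xs a) = absn_intro (map_tuple s xs) (act s a).
Proof.
elim: n xs => [//|n ih] xs.
have [x [{}xs ->]] := tuple_consE xs; rewrite absn_introS.
apply: (etrans (act_abs_intro s x (absn_intro xs a))); rewrite ih -absn_introS.
suff -> : map_tuple s [tuple of x :: xs] = [tuple of s x :: map_tuple s xs] by [].
exact: val_inj.
Qed.

Lemma absn_intro_inj A n (xs : n.-tuple V) : injective (absn_intro xs : A -> absn n A).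
Proof.
elim: n xs => [xs a b //|n ih xs a b]; have [x [ys ->]] := tuple_consE xs.
by rewrite !absn_introS => /abs_intro_inj /ih.
Qed.

Lemma absn_intro_surj A n (p : absn n A) : exists xs a, p = absn_intro xs a.
Proof.
elim: n p => [|n ih] p; first by exists [tuple], p.
have [x [q ->]] := abs_intro_surj p; have [xs [a ->]] := ih q.
exists [tuple of x :: xs], a => /=; congr (abs_intro _ (absn_intro _ _)).
by apply: val_inj.
Qed.

Lemma supp_absn_intro A n (xs : n.-tuple V) (a : A) y :
  supp (absn_intro xs a) y <-> supp a y /\ y \notin tval xs.
Proof.
elim: n xs => [|n ih] xs; first by rewrite tuple0; split=> [|[]].
have [x [{}xs ->]] := tuple_consE xs; rewrite absn_introS supp_abs_intro ih inE negb_or.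
by split=> [[[? ->] /eqP ->]|[? /andP[/eqP ? ?]]].
Qed.

Lemma absn_intro_rename A T n (xs zs : n.-tuple V) (a : A) : supports T a -> uniq zs ->
  {in zs, forall z, z \notin tval xs /\ z \notin T} ->
  absn_intro xs a = absn_intro zs (act (pswaps (zip xs zs)) a).
Proof.
move=> Ta; elim: n xs zs => [|n ih] xs zs; first by rewrite [zs]tuple0 [xs]tuple0 /= act1.
have [x [{}xs ->]] := tuple_consE xs; have [z [{}zs ->]] := tuple_consE zs.
move=> /= /andP[zzs uz] zf.
have zf' : {in zs, forall w, w \notin tval xs /\ w \notin T}.
  move=> w wz; have [] := zf w; rewrite ?inE ?wz ?orbT // negb_or.
  by move=> /andP[].
have [] := zf z (mem_head _ _); rewrite inE negb_or => /andP[zx zxs] zT.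
rewrite -/(absn_intro [tuple of x :: xs] a) -/(absn_intro [tuple of z :: zs] _).
rewrite !absn_introS (@abs_intro_rename _ x z); [|exact/eqP|]; last first.
  by move=> /supp_absn_intro[/(_ T Ta)]; rewrite (negbTE zT).
rewrite (ih _ _ uz zf') act_absn_intro -actM; congr (abs_intro _ (absn_intro _ (act _ _))).
  rewrite supports_map_tuple // => w wz /=.
  have [] := zf w; first by rewrite inE wz orbT.
  rewrite inE negb_or => /andP[wx _] _.
  by rewrite swap_neq //; apply: contraNneq zzs => <-.
exact: perm_eq_fun.
Qed.

Lemma absn_intro_any A T n (xs ys zs : n.-tuple V) (a b : A) :
  supports T a -> supports T b -> uniq zs ->
  {in zs, forall z, [/\ z \notin tval xs, z \notin tval ys & z \notin T]} ->
  absn_intro xs a = absn_intro ys b <->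
  act (pswaps (zip xs zs)) a = act (pswaps (zip ys zs)) b.
Proof.
move=> Ta Tb uz zf; rewrite (@absn_intro_rename A T n xs zs) //; last by move=> z /zf[].
rewrite (@absn_intro_rename A T n ys zs) //; last by move=> z /zf[].
by split=> [/absn_intro_inj|->].
Qed.

Lemma absn_intro_fresh A n (xs zs : n.-tuple V) (a : A) : uniq zs ->
  {in zs, forall z, ~ supp (absn_intro xs a) z} ->
  exists s, absn_intro xs a = absn_intro zs (act s a).
Proof.
elim: n xs zs a => [|n ih] xs zs a.
  by exists perm_id; rewrite act1 [zs]tuple0 [xs]tuple0.
have [x [{}xs ->]] := tuple_consE xs; have [z [{}zs ->]] := tuple_consE zs.
rewrite [uniq _]/= => /andP[zzs uz] zf.
have [s [t [sE]]] : exists s, exists t, absn_intro [tuple of x :: xs] a =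
    abs_intro z (absn_intro t (act s a)) /\ size (tval t) = n.
  rewrite absn_introS; have [->|/eqP zx] := eqVneq z x.
    by exists perm_id, xs; rewrite act1 size_tuple.
  exists (pswap x z), (map_tuple (pswap x z) xs); rewrite -act_absn_intro size_tuple; split=> //.
  apply: abs_intro_rename => //; have := zf z (mem_head _ _).
  by rewrite absn_introS supp_abs_intro => h ?; apply: h.
move=> _; have [|s' s'E] := ih t zs (act s a) uz.
  move=> w wz wt; apply: (zf w); first by rewrite inE wz orbT.
  rewrite sE supp_abs_intro; split=> // wE.
  by rewrite -wE wz in zzs.
by exists (perm_comp s' s); rewrite sE s'E actM absn_introS.
Qed.


Lemma absn_mapE n A B (h : A -> B) (xs : n.-tuple V) (a : A) :
  equivariant h -> absn_map n h (absn_intro xs a) = absn_intro xs (h a).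
Proof.
move=> he; elim: n xs a => [//|n ih] xs a.
have ee : equivariant (absn_map n h).
  move=> s p; have [ys [b ->]] := absn_intro_surj p.
  by rewrite act_absn_intro !ih act_absn_intro he.
have [x [{}xs ->]] := tuple_consE xs; rewrite !absn_introS.
by apply: (etrans (abs_mapE V_infinite x (absn_intro xs a) ee)); rewrite ih.
Qed.

End Renaming.

(** * Alpha-equivalence of finite terms *)

Section Alpha.
Variables (V : choiceType) (S : signature).
Hypothesis V_infinite : infinite_set [set: V].
Implicit Types t u v : fterm V S.

Lemma FNode_inj1 (c d : constr S) xs ts ys us :
  @FNode V S c xs ts = @FNode V S d ys us -> c = d.
Proof. by case. Qed.

Lemma FNode_inj (c : constr S) xs ts ys us :
  @FNode V S c xs ts = @FNode V S c ys us -> xs = ys /\ ts = us.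
Proof. by case=> e1 e2; split; [exact: existT_inj2 e1 | exact: existT_inj2 e2]. Qed.

Lemma fvars_child (c : constr S) xs (ts : argty c -> fterm V S) i :
  {subset tval (xs i) ++ fvars (ts i) <= fvars (FNode c xs ts)}.
Proof.
move=> x xi; apply/flattenP; exists (tval (xs i) ++ fvars (ts i)) => //.
by apply/mapP; exists i; rewrite ?mem_enum.
Qed.

Lemma supports_fvars t : supports (A := fterm_nom V S) (fvars t) t.
Proof.
move=> s; elim: t => [x /(_ x)|c xs ts ih] st /=; first by rewrite st ?mem_head.
congr FNode; first apply: functional_extensionality_dep => i.
  apply: supports_map_tuple => x xi; apply/st/(@fvars_child c xs ts i).
  by rewrite mem_cat xi.
apply/funext => i; apply: ih => x xi; apply/st/(@fvars_child c xs ts i).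
by rewrite mem_cat xi orbT.
Qed.

Lemma alpha_inv_var x w : alpha (@FVar V S x) w -> w = FVar x.
Proof. by move e: (FVar x) => t tw; case: tw e. Qed.

Lemma alpha_inv_node (c : constr S) xs ts w : alpha (@FNode V S c xs ts) w ->
  exists ys us, w = FNode c ys us /\ exists zs : forall i : argty c, (nbind c i).-tuple V,
    [/\ forall i, uniq (zs i),
        forall i, {in zs i, forall z,
          [/\ z \notin tval (xs i), z \notin tval (ys i),
            z \notin fvars (ts i) & z \notin fvars (us i)]}
      & forall i, alpha (rename (xs i) (zs i) (ts i)) (rename (ys i) (zs i) (us i))].
Proof.
move e: (FNode c xs ts) => t tw; case: tw e => // d xs' ys zs ts' us uz zf h e.
have cd := FNode_inj1 e; subst d; have [? ?] := FNode_inj e; subst xs' ts'.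
by exists ys, us; split=> //; exists zs.
Qed.

Lemma alpha_any n (xs ys zs ws : n.-tuple V) t u : uniq zs -> uniq ws ->
  {in zs, forall z, [/\ z \notin tval xs, z \notin tval ys,
            z \notin fvars t & z \notin fvars u]} ->
  {in ws, forall z, [/\ z \notin tval xs, z \notin tval ys, z \notin tval zs,
            z \notin fvars t & z \notin fvars u]} ->
  rename xs ws t = fterm_act (pswaps (zip zs ws)) (rename xs zs t) /\
  rename ys ws u = fterm_act (pswaps (zip zs ws)) (rename ys zs u).
Proof.
move=> uz uw zf wf; split; apply/esym.
  apply: (act_comp_pswaps_zip (A := fterm_permSet V S) (@supports_fvars t)) => //.
    by move=> z /zf[].
  by move=> z /wf[].
apply: (act_comp_pswaps_zip (A := fterm_permSet V S) (@supports_fvars u)) => //.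
  by move=> z /zf[].
by move=> z /wf[].
Qed.

Lemma fresh_tuples (c : constr S) (T : argty c -> seq V) :
  exists zs : forall i : argty c, (nbind c i).-tuple V,
    forall i, uniq (zs i) /\ {in zs i, forall z, z \notin T i}.
Proof.
exists (fun i : argty c => projT1 (cid (fresh_tuple V_infinite (nbind c i) (T i)))) => i.
by case: cid.
Qed.

Lemma alpha_refl t : alpha t t.
Proof.
elim: t => [x|c xs ts ih]; first exact: alpha_var.
have [zs zsP] := fresh_tuples (fun i : argty c => tval (xs i) ++ fvars (ts i)).
apply: (@alpha_node V S c xs xs zs) => i; first by have [] := zsP i.
  by have [_ zf z /zf] := zsP i; rewrite mem_cat negb_or => /andP[].
exact: (alpha_equivariant _ (ih i)).
Qed.

Lemma alpha_sym t u : alpha t u -> alpha u t.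
Proof.
elim=> [x|c xs ys zs {}t {}u uz zf _ ih]; first exact: alpha_var.
by apply: (@alpha_node V S c ys xs zs) => // i z /zf[].
Qed.

Lemma alpha_trans t u v : alpha t u -> alpha u v -> alpha t v.
Proof.
move=> tu; elim: tu v => [//|c xs ys zs ts us uz zf _ ih] v.
move=> /alpha_inv_node[xs' [vs [-> [ws [uw wf uv]]]]].
have [zs' zs'P] := fresh_tuples (fun i : argty c => flatten
  [:: tval (xs i); tval (ys i); tval (xs' i); tval (zs i); tval (ws i);
      fvars (ts i); fvars (us i); fvars (vs i)]).
have zf' i : {in zs' i, forall z,
    [/\ z \notin tval (xs i), z \notin tval (ys i) & z \notin tval (xs' i)] /\
    [/\ z \notin tval (zs i), z \notin tval (ws i), z \notin fvars (ts i),
      z \notin fvars (us i) & z \notin fvars (vs i)]}.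
  move=> z; have [_ zf' /zf'] := zs'P i; rewrite /= !mem_cat !negb_or.
  by do 8!case/andP=> ?; split.
apply: (@alpha_node V S c xs xs' zs') => i; first by have [] := zs'P i.
  by move=> z /zf'[[? ? ?] [? ? ? ? ?]].
have uz' : uniq (zs' i) by have [] := zs'P i.
have [E1 E2] : rename (xs i) (zs' i) (ts i) =
      fterm_act (pswaps (zip (zs i) (zs' i))) (rename (xs i) (zs i) (ts i)) /\
    rename (ys i) (zs' i) (us i) =
      fterm_act (pswaps (zip (zs i) (zs' i))) (rename (ys i) (zs i) (us i)).
  by apply: alpha_any => // z /zf'[[? ? ?] [? ? ? ? ?]].
have [E3 E4] : rename (ys i) (zs' i) (us i) =
      fterm_act (pswaps (zip (ws i) (zs' i))) (rename (ys i) (ws i) (us i)) /\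
    rename (xs' i) (zs' i) (vs i) =
      fterm_act (pswaps (zip (ws i) (zs' i))) (rename (xs' i) (ws i) (vs i)).
  by apply: alpha_any => // z /zf'[[? ? ?] [? ? ? ? ?]].
have [r [rK Kr]] := act_inv (fterm_nom V S) (pswaps (zip (zs i) (zs' i))).
rewrite E1 -[rename (xs' i) _ _]Kr; apply: alpha_equivariant.
apply: ih; rewrite -[rename (ys i) _ _]rK; apply: (@alpha_equivariant V S r).
by rewrite -[act _ _]E2 E3 E4; apply: alpha_equivariant; exact: uv.
Qed.

Definition fcls t : fterm_alpha V S := cls (@alpha V S) t.

Lemma fclsE t u : fcls t = fcls u <-> alpha t u.
Proof. exact: (clsE alpha_refl alpha_sym alpha_trans). Qed.

Lemma fcls_surj (p : fterm_alpha V S) : exists t, p = fcls t.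
Proof. by exists (qrepr p); rewrite /fcls qreprK. Qed.

Lemma act_fcls s t : act s (fcls t) = fcls (fterm_act s t).
Proof. exact: (act_cls (@alpha_equivariant V S)). Qed.

Lemma supports_fcls T t : supports (A := fterm_nom V S) T t -> supports T (fcls t).
Proof. by move=> Tt s /Tt; rewrite act_fcls => /= ->. Qed.

Lemma alpha_nodeE (c : constr S) xs ys (ts us : argty c -> fterm V S) :
  alpha (FNode c xs ts) (FNode c ys us) <->
  forall i, absn_intro (xs i) (fcls (ts i)) = absn_intro (ys i) (fcls (us i)).
Proof.
have any (i : argty c) (zs : (nbind c i).-tuple V) : uniq zs ->
    {in zs, forall z,
       [/\ z \notin tval (xs i), z \notin tval (ys i),
           z \notin fvars (ts i) & z \notin fvars (us i)]} ->
    absn_intro (xs i) (fcls (ts i)) = absn_intro (ys i) (fcls (us i)) <->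
    alpha (rename (xs i) zs (ts i)) (rename (ys i) zs (us i)).
  move=> uz zf.
  rewrite (@absn_intro_any V V_infinite _ (fvars (ts i) ++ fvars (us i)) _ _ _ zs) //.
  - by rewrite !act_fcls fclsE.
  - by apply/supports_sub/supports_fcls/supports_fvars => x; rewrite mem_cat => ->.
  - by apply/supports_sub/supports_fcls/supports_fvars => x; rewrite mem_cat orbC => ->.
  - by move=> z /zf[? ? ? ?]; split=> //; rewrite mem_cat negb_or; apply/andP.
split=> [/alpha_inv_node[ys' [us' [/FNode_inj[? ?] [zs [uz zf h]]]]] i|h].
  by subst ys' us'; apply/(any i (zs i)).
have [zs zsP] := fresh_tuples (fun i : argty c => flatten
  [:: tval (xs i); tval (ys i); fvars (ts i); fvars (us i)]).
have zf i : {in zs i, forall z, [/\ z \notin tval (xs i), z \notin tval (ys i),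
           z \notin fvars (ts i) & z \notin fvars (us i)]}.
  move=> z; have [_ zf /zf] := zsP i; rewrite /= !mem_cat !negb_or.
  by do 4!case/andP=> ?; split.
have uz i : uniq (zs i) by have [] := zsP i.
by apply: (@alpha_node V S c xs ys zs) => // i; apply/any.
Qed.

Lemma supp_fcls_node (c : constr S) xs (ts : argty c -> fterm V S) y :
  supp (fcls (FNode c xs ts)) y <-> exists i, supp (fcls (ts i)) y /\ y \notin tval (xs i).
Proof.
have actE s : act s (fcls (FNode c xs ts)) = fcls (FNode c xs ts) <->
    forall i, act s (absn_intro (xs i) (fcls (ts i))) = absn_intro (xs i) (fcls (ts i)).
  rewrite act_fcls fclsE alpha_nodeE; split=> h i; have := h i.
    by rewrite act_absn_intro act_fcls.
  by rewrite act_absn_intro act_fcls.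
split=> [ay|[i /(supp_absn_intro V_infinite) iy] T Ta]; last first.
  by apply: iy => s /Ta /actE.
have /choice[T aT] (i : argty c) := nom_supp_seq V_infinite (absn_intro (xs i) (fcls (ts i))).
have /flattenP[_ /codomP[i ->] iy] : y \in flatten (codom T).
  apply: ay => s sT; apply/actE => i.
  apply: (supports_supp V_infinite (T := T i)) => [x /aT //|x xT].
  by apply/sT/flattenP; exists (T i); rewrite ?codom_f.
by exists i; apply/(supp_absn_intro V_infinite)/aT.
Qed.

Lemma supp_fcls_var x y : supp (fcls (FVar x)) y <-> y = x.
Proof.
split=> [h|-> T hT].
  have : supports [:: x] (fcls (FVar x)).
    by move=> s sx; rewrite act_fcls /= sx ?mem_head.
  by move=> /h; rewrite inE => /eqP.
apply: contrapT => /negP xT; have [z] := fresh_for V_infinite (x :: T).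
rewrite inE negb_or => /andP[zx zT].
have : act (pswap x z) (fcls (FVar x)) = fcls (FVar x).
  apply: hT => w wT /=; rewrite swap_neq //.
    by apply: contraNneq xT => <-.
  by apply: contraNneq zT => <-.
rewrite act_fcls => /fclsE /alpha_inv_var /= [].
by rewrite swapL => e; rewrite e eqxx in zx.
Qed.

End Alpha.

(** * Initial algebras of binding functors *)

(* What V^n x A and [V]^n A have in common. The elements of an n-ary binder are
   written [bintro xs a]; [bintro_transfer] abstracts from choosing the same
   fresh names in place of [xs] and [ys] for all the bodies at once. *)
Record binder (V : choiceType) := Binder {
  bnd : nat -> nomSet V -> nomSet V;
  bintro : forall n (A : nomSet V), n.-tuple V -> A -> bnd n A;
  bmap : forall n (A B : nomSet V), (A -> B) -> bnd n A -> bnd n B;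
  act_bintro : forall n (A : nomSet V) s (xs : n.-tuple V) (a : A),
    act s (bintro xs a) = bintro (map_tuple s xs) (act s a);
  bintro_surj : forall n (A : nomSet V) (p : bnd n A),
    exists xs a, p = bintro xs a;
  bintro_inj : forall n (A : nomSet V) (xs : n.-tuple V), injective (@bintro n A xs);
  bmapE : forall n (A B : nomSet V) (h : A -> B) (xs : n.-tuple V) (a : A),
    equivariant h -> bmap h (bintro xs a) = bintro xs (h a);
  bintro_transfer : forall n (A B : nomSet V) (I : Type) (i0 : I)
      (xs ys : n.-tuple V) (T : seq V) (a b : I -> A) (a' b' : B),
    (forall i, supports T (a i)) -> (forall i, supports T (b i)) ->
    (forall s, (forall i, act s (a i) = b i) -> act s a' = b') ->
    (forall i, bintro xs (a i) = bintro ys (b i)) ->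
    bintro xs a' = bintro ys b' }.

Arguments bintro {V} _ {n A}.
Arguments bmap {V} _ n {A B}.

Section Instances.
Variable V : choiceType.

Definition raw_binder : binder V.
Proof.
apply: (@Binder V (fun n A => prod_nom (tuple_nom V n) A) (fun n A xs a => (xs, a))
  (fun n A B h p => (p.1, h p.2))) => //.
- by move=> n A [xs a]; exists xs, a.
- by move=> n A xs a b [].
move=> n A B I i0 xs ys T a b a' b' _ _ h e.
have -> : xs = ys by have [] := e i0.
by rewrite -(h perm_id) ?act1 // => i; rewrite act1; have [] := e i.
Defined.

Hypothesis V_infinite : infinite_set [set: V].

Definition abs_binder : binder V.
Proof.
apply: (@Binder V (fun n A => absn n A) (fun n A xs a => absn_intro xs a)
  (fun n A B h p => absn_map n h p)).
- by move=> n A s xs a; exact: act_absn_intro.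
- by move=> n A p; exact: absn_intro_surj.
- by move=> n A xs; exact: absn_intro_inj.
- by move=> n A B h xs a; exact: absn_mapE.
move=> n A B I i0 xs ys T a b a' b' Ta Tb h e.
have [Ta' a'T] := nom_fin_supp a'; have [Tb' b'T] := nom_fin_supp b'.
have [zs [uz zf]] := fresh_tuple V_infinite n
  (flatten [:: tval xs; tval ys; T; Ta'; Tb']).
have {}zf : {in zs, forall z, [/\ z \notin tval xs, z \notin tval ys, z \notin T,
    z \notin Ta' & z \notin Tb']}.
  by move=> z /zf; rewrite /= !mem_cat !negb_or; do 5!case/andP=> ?; split.
apply/(absn_intro_any V_infinite (T := Ta' ++ Tb') (zs := zs)) => //.
- by apply: supports_sub a'T => x; rewrite mem_cat => ->.
- by apply: supports_sub b'T => x; rewrite mem_cat orbC => ->.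
- by move=> z /zf[? ? ? ? ?]; split=> //; rewrite mem_cat negb_or; apply/andP.
have [u [uK Ku]] := perm_inv (pswaps (zip ys zs)).
have actu (C : nomSet V) (c : C) : act (pswaps (zip ys zs)) (act u c) = c.
  by rewrite -actM uK act1.
rewrite -(h (perm_comp u (pswaps (zip xs zs)))) ?actM ?actu // => i.
rewrite actM; apply: (@act_inj _ _ (pswaps (zip ys zs))); rewrite actu.
apply/(absn_intro_any V_infinite (T := T)) => //.
by move=> z /zf[].
Defined.

End Instances.

Section NomSel.
Variable V : choiceType.
Implicit Types X Y : nomSet V.

Definition nsel (b : bool) X Y :
    (b = false -> X) -> (b = true -> Y) -> sel b X Y :=
  match b return (b = false -> X) -> (b = true -> Y) -> sel b X Y with
  | false => fun f _ => f erefl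
  | true => fun _ g => g erefl
  end.

Definition pick_if (T : Type) (b : bool) : (b = false -> T) -> (b = true -> T) -> T :=
  match b return (b = false -> T) -> (b = true -> T) -> T with
  | false => fun f _ => f erefl
  | true => fun _ g => g erefl
  end.

Lemma nsel_surj b X Y (y : sel b X Y) : exists f g, y = nsel f g.
Proof.
case: b y => y; first by exists (fun e => match notF (esym e) with end), (fun=> y).
by exists (fun=> y), (fun e => match notF e with end).
Qed.

Lemma sel_map_nsel b X X' Y Y' (h : X -> X') (k : Y -> Y')
    (f : b = false -> X) (g : b = true -> Y) :
  sel_map (@underlying V) b h k (nsel f g) = nsel (h \o f) (k \o g).
Proof. by case: b f g. Qed.

Lemma act_nsel b X Y s (f : b = false -> X) (g : b = true -> Y) :
  act s (nsel f g) = nsel (act s \o f) (act s \o g).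
Proof. by case: b f g. Qed.

Lemma equivariant_sel_map b X X' Y Y' (h : X -> X') (k : Y -> Y') :
  equivariant h -> equivariant k ->
  equivariant (sel_map (@underlying V) b h k : sel b X Y -> sel b X' Y').
Proof. by case: b. Qed.

Lemma nsel_inj b X Y (f f' : b = false -> X) (g g' : b = true -> Y) :
  nsel f g = nsel f' g' -> f = f' /\ g = g'.
Proof.
by case: b f f' g g' => f f' g g' /= e; split; apply/funext => e' //;
  rewrite (Prop_irrelevance e' erefl).
Qed.

Lemma unsel_nsel b X (f : b = false -> X) (g : b = true -> X) :
  unsel (@underlying V) b (nsel f g) = pick_if f g.
Proof. by case: b f g. Qed.

Lemma unsel_mksel T b (f : b = false -> T) (g : b = true -> T) :
  unsel id b (mksel f g) = pick_if f g.
Proof. by case: b f g. Qed.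

Lemma equivariant_unsel b X : equivariant (unsel (@underlying V) b : sel b X X -> X).
Proof. by case: b. Qed.

Lemma pick_ifP (T T' : Type) (R : T -> T' -> Prop) (b : bool) (f : b = false -> T) g
    (f' : b = false -> T') g' :
  (forall e, R (f e) (f' e)) -> (forall e, R (g e) (g' e)) ->
  R (pick_if f g) (pick_if f' g').
Proof. by case: b f g f' g' => f g f' g' h h'; [exact: h' | exact: h]. Qed.

End NomSel.

Section Initial.
Variables (V : choiceType) (S : signature) (G : binder V).
Implicit Types X Y : nomSet V.

Definition bT X Y : nomSet V :=
  layer_nom (fun (c : constr S) i => bnd G (nbind c i) (sel (coind c i) X Y)).

Definition bT_map X X' Y Y' (h : X -> X') (k : Y -> Y') : bT X Y -> bT X' Y' :=
  layer_map (fun c i =>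
    bmap G (nbind c i) (sel_map (@underlying V) (coind c i) h k)).

Definition bnode X Y (c : constr S) (xs : forall i : argty c, (nbind c i).-tuple V)
    (f : forall i : argty c, coind c i = false -> X)
    (g : forall i : argty c, coind c i = true -> Y) : bT X Y :=
  LNode c (fun i => bintro G (xs i) (nsel (f i) (g i))).

Lemma LNode_inj (P : forall c : constr S, argty c -> Type) c (a b : forall i, P c i) :
  LNode c a = LNode c b :> layer V P -> a = b.
Proof. by case=> e; exact: existT_inj2 e. Qed.

Lemma bT_case X Y (l : bT X Y) :
  (exists x, l = LVar x) \/ exists c xs f g, l = @bnode X Y c xs f g.
Proof.
case: l => [x|c l]; [by left; exists x | right; exists c].
have h i := projT2 (cid (bintro_surj (l i))).
have h' i := projT2 (cid (h i)).
have k i := projT2 (cid (nsel_surj (projT1 (cid (h i))))).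
have k' i := projT2 (cid (k i)).
exists (fun i => projT1 (cid (bintro_surj (l i)))).
exists (fun i => projT1 (cid (nsel_surj (projT1 (cid (h i)))))).
exists (fun i => projT1 (cid (k i))).
congr LNode; apply: functional_extensionality_dep => i.
exact: (etrans (h' i) (congr1 _ (k' i))).
Qed.

Lemma bT_map_node X X' Y Y' (h : X -> X') (k : Y -> Y') c xs f g :
  equivariant h -> equivariant k ->
  bT_map h k (@bnode X Y c xs f g) =
  bnode xs (fun i e => h (f i e)) (fun i e => k (g i e)).
Proof.
move=> he ke; congr LNode; apply: functional_extensionality_dep => i.
by rewrite bmapE ?sel_map_nsel //; exact: equivariant_sel_map.
Qed.

Lemma act_bnode s X Y c xs f g : act s (@bnode X Y c xs f g) =
  bnode (fun i => map_tuple s (xs i)) (fun i e => act s (f i e)) (fun i e => act s (g i e)).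
Proof.
congr LNode; apply: functional_extensionality_dep => i.
by rewrite act_bintro act_nsel.
Qed.

Lemma equivariant_bT_map X X' Y Y' (h : X -> X') (k : Y -> Y') :
  equivariant h -> equivariant k -> equivariant (bT_map h k).
Proof.
move=> he ke s l; have [[x ->]|[c [xs [f [g ->]]]]] := bT_case l; first by [].
rewrite act_bnode !bT_map_node // act_bnode; congr LNode.
apply: functional_extensionality_dep => i; congr (bintro _ _ (nsel _ _)).
  by apply/funext => e; rewrite he.
by apply/funext => e; rewrite ke.
Qed.

Lemma bT_map_comp X X' X2 Y Y' Y2 (h : X -> X') (k : Y -> Y') (h' : X' -> X2) (k' : Y' -> Y2) l :
  equivariant h -> equivariant k -> equivariant h' -> equivariant k' ->
  bT_map h' k' (bT_map h k l) = bT_map (fun x => h' (h x)) (fun y => k' (k y)) l.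
Proof.
move=> he ke he' ke'; have [[x ->]|[c [xs [f [g ->]]]]] := bT_case l; first by [].
rewrite !bT_map_node // => s x; first by rewrite he he'.
by rewrite ke ke'.
Qed.

Lemma bT_map_id X Y (l : bT X Y) : bT_map id id l = l.
Proof.
by have [[x ->]|[c [xs [f [g ->]]]]] := bT_case l; last rewrite bT_map_node.
Qed.

Section Algebra.
Variable Y : nomSet V.

Fixpoint mixed_act (s : perm V) (m : mixed V S Y) : mixed V S Y :=
  match m with
  | MVar x => MVar S Y (s x)
  | MNode c xs f g => MNode (fun i => map_tuple s (xs i))
      (fun i e => mixed_act s (f i e)) (fun i e => act s (g i e))
  end.

Definition mixed_permSet : permSet V.
Proof.
apply: (@PermSet V (mixed V S Y) mixed_act) => [|s t]; elim=> //= c xs f ih g;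
  congr MNode; apply: functional_extensionality_dep => i.
- by apply: val_inj; rewrite /= map_id.
- by apply/funext => e; exact: ih.
- by apply/funext => e; exact: act1.
- by apply: val_inj; rewrite /= map_comp.
- by apply/funext => e; exact: ih.
- by apply/funext => e; exact: actM.
Defined.

Definition mixed_nom : nomSet V.
Proof.
apply: (@NomSet V mixed_permSet) => /=; elim=> [x|c xs f ih g].
  by exists [:: x] => s /= sx; rewrite sx ?mem_head.
have /choice[T hT] (i : argty c) : exists T, [/\ {subset tval (xs i) <= T},
    forall e, supports (A := mixed_permSet) T (f i e) & forall e, supports T (g i e)].
  have [T fT] : exists T, forall e, supports (A := mixed_permSet) T (f i e).
    have [E|E] : coind c i = true \/ coind c i = false by case: (coind c i); [left|right].
      by exists [::] => e; have := etrans (esym E) e.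
    have [T hT] := ih i E; exists T => e.
    by rewrite (Prop_irrelevance e E).
  have [T' gT] : exists T', forall e, supports T' (g i e).
    have [E|E] : coind c i = true \/ coind c i = false by case: (coind c i); [left|right].
      have [T' hT] := nom_fin_supp (g i E); exists T' => e.
      by rewrite (Prop_irrelevance e E).
    by exists [::] => e; have := etrans (esym E) e.
  exists (tval (xs i) ++ T ++ T'); split=> [x xi|e|e].
  - by rewrite mem_cat xi.
  - by apply: supports_sub (fT e) => x xT; rewrite !mem_cat xT orbT.
  - by apply: supports_sub (gT e) => x xT; rewrite !mem_cat xT !orbT.
exists (flatten (codom T)) => s sT /=.
have {}sT i : {in T i, forall x, s x = x}.
  by move=> x xT; apply/sT/flattenP; exists (T i); rewrite ?codom_f.
congr MNode; apply: functional_extensionality_dep => i; have [xT fT gT] := hT i.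
- by apply: supports_map_tuple => x /xT; exact: sT.
- by apply/funext => e; apply: (fT e); exact: sT.
- by apply/funext => e; apply: (gT e); exact: sT.
Defined.

Fixpoint bfold (A : nomSet V) (a : bT A Y -> A) (m : mixed V S Y) : A :=
  match m with
  | MVar x => a (LVar x)
  | MNode c xs f g => a (bnode xs (fun i e => bfold a (f i e)) g)
  end.

Lemma bfold_equivariant (A : nomSet V) (a : bT A Y -> A) :
  equivariant a -> equivariant (bfold a : mixed_nom -> A).
Proof.
move=> ae s; elim=> [x|c xs f ih g] /=; first by rewrite -ae.
rewrite -ae act_bnode; congr (a (bnode _ _ _)).
by apply: functional_extensionality_dep => i; apply/funext => e; exact: ih.
Qed.

(* An impredicative presentation of the initial algebra: trees are identified
   when no algebra can tell them apart. *)
Definition mixed_eq (m m' : mixed_nom) : Prop :=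
  forall (A : nomSet V) (a : bT A Y -> A), equivariant a -> bfold a m = bfold a m'.

Lemma mixed_eq_equivariant : equivariant_rel mixed_eq.
Proof. by move=> s m m' mm' A a ae; rewrite !bfold_equivariant // mm'. Qed.

Definition mu_bT : nomSet V := quot_nom mixed_eq_equivariant.

Definition mcls (m : mixed V S Y) : mu_bT := cls mixed_eq m.

Lemma mclsE m m' : mcls m = mcls m' <-> mixed_eq m m'.
Proof.
apply: clsE => [m1 A a ae //|m1 m2 h A a ae|m1 m2 m3 h h' A a ae].
  by rewrite h.
by rewrite h // h'.
Qed.

Lemma mcls_surj (p : mu_bT) : exists m, p = mcls m.
Proof. by exists (qrepr p); rewrite /mcls qreprK. Qed.

Lemma act_mcls s m : act s (mcls m) = mcls (mixed_act s m).
Proof. exact: (act_cls mixed_eq_equivariant). Qed.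

Definition mu_fold (A : nomSet V) (a : bT A Y -> A) (p : mu_bT) : A :=
  bfold a (qrepr p).

Lemma mu_foldE (A : nomSet V) (a : bT A Y -> A) m :
  equivariant a -> mu_fold a (mcls m) = bfold a m.
Proof. by move=> ae; apply: (iffLR (mclsE _ m)) => //; rewrite /mcls qreprK. Qed.

Lemma equivariant_mu_fold (A : nomSet V) (a : bT A Y -> A) :
  equivariant a -> equivariant (mu_fold a).
Proof.
move=> ae s p; have [m ->] := mcls_surj p.
by rewrite act_mcls !mu_foldE //; exact: bfold_equivariant.
Qed.

Lemma equivariant_id (A : permSet V) : equivariant (id : A -> A).
Proof. by []. Qed.
Hint Resolve equivariant_id : core.

Lemma mu_con_ex (l : bT mu_bT Y) : exists p : mu_bT,
  forall (A : nomSet V) (a : bT A Y -> A), equivariant a ->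
    mu_fold a p = a (bT_map (mu_fold a) id l).
Proof.
have [[x ->]|[c [xs [f [g ->]]]]] := bT_case l.
  by exists (mcls (MVar S Y x)) => A a ae; rewrite mu_foldE.
exists (mcls (MNode xs (fun i e => qrepr (f i e)) g)) => A a ae.
by rewrite mu_foldE // bT_map_node //; exact: equivariant_mu_fold.
Qed.

Definition mu_con (l : bT mu_bT Y) : mu_bT := projT1 (cid (mu_con_ex l)).

Lemma mu_fold_con (A : nomSet V) (a : bT A Y -> A) l : equivariant a ->
  mu_fold a (mu_con l) = a (bT_map (mu_fold a) id l).
Proof. by rewrite /mu_con; case: cid => p /= h; exact: h. Qed.

Lemma mu_ext (p q : mu_bT) :
  (forall (A : nomSet V) (a : bT A Y -> A), equivariant a -> mu_fold a p = mu_fold a q) ->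
  p = q.
Proof.
have [m ->] := mcls_surj p; have [m' ->] := mcls_surj q => h.
by apply/mclsE => A a ae; rewrite -!mu_foldE // h.
Qed.

Lemma mu_con_var x : mu_con (LVar x) = mcls (MVar S Y x).
Proof. by apply: mu_ext => A a ae; rewrite mu_fold_con // mu_foldE. Qed.

Lemma mu_con_node c xs f g :
  mu_con (@bnode mu_bT Y c xs (fun i e => mcls (f i e)) g) = mcls (MNode xs f g).
Proof.
apply: mu_ext => A a ae; rewrite mu_fold_con // mu_foldE // bT_map_node //; last first.
  exact: equivariant_mu_fold.
congr (a (bnode _ _ _)); apply: functional_extensionality_dep => i.
by apply/funext => e; rewrite mu_foldE.
Qed.

Lemma equivariant_mu_con : equivariant mu_con.
Proof.
move=> s l; apply: mu_ext => A a ae; rewrite equivariant_mu_fold // !mu_fold_con //.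
by rewrite equivariant_bT_map //; exact: equivariant_mu_fold.
Qed.

Lemma mu_fold_uniq (A : nomSet V) (a : bT A Y -> A) (h : mu_bT -> A) :
  equivariant a -> equivariant h ->
  (forall l, h (mu_con l) = a (bT_map h id l)) -> h = mu_fold a.
Proof.
move=> ae he hE; apply/funext => p; have [m ->] := mcls_surj p.
rewrite mu_foldE //; elim: m => [x|c xs f ih g]; first by rewrite -mu_con_var hE.
rewrite -mu_con_node hE bT_map_node //=.
congr (a (bnode _ _ _)); apply: functional_extensionality_dep => i.
by apply/funext => e; exact: ih.
Qed.

Lemma mu_bT_initial : @initial_algebra (Nom V) bT bT_map Y mu_bT mu_con.
Proof.
split=> [|A a ae]; first exact: equivariant_mu_con.
exists (mu_fold a); split; last first.
  move=> h [he hE]; apply/esym/mu_fold_uniq => // l.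
  by rewrite -[LHS]/((h \o mu_con) l) hE.
split; first exact: equivariant_mu_fold.
by apply/funext => l; exact: mu_fold_con.
Qed.

(* Lambek's lemma: the fold of [bT_map mu_con id] is a left inverse. *)
Lemma mu_con_inj : injective mu_con.
Proof.
pose a : bT (bT mu_bT Y) Y -> bT mu_bT Y := bT_map mu_con id.
have ae : equivariant a by apply: equivariant_bT_map => //; exact: equivariant_mu_con.
have fe := equivariant_mu_fold ae.
apply: (can_inj (g := mu_fold a)) => l; rewrite mu_fold_con // /a bT_map_comp //; last first.
  exact: equivariant_mu_con.
rewrite -[RHS]bT_map_id; congr (bT_map _ _ l); apply/funext => p.
have e1 : id = mu_fold mu_con.
  by apply: mu_fold_uniq equivariant_mu_con _ _ => // l'; rewrite bT_map_id.
have e2 : (fun p => mu_con (mu_fold a p)) = mu_fold mu_con.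
  apply: mu_fold_uniq equivariant_mu_con _ _ => [s q|l'].
    by rewrite fe equivariant_mu_con.
  by rewrite mu_fold_con // /a bT_map_comp //; exact: equivariant_mu_con.
by rewrite -[LHS]/((fun p => mu_con (mu_fold a p)) p) e2 -e1.
Qed.

End Algebra.

Definition bT_mu : mu_functor (C := Nom V) (F := bT) bT_map :=
  @MuFunctor (Nom V) bT bT_map mu_bT mu_con mu_bT_initial.

End Initial.

#[global] Hint Resolve equivariant_id : core.

(** * Terminal coalgebras from truncation levels *)

Section LayerInversion.
Variables (V : choiceType) (S : signature) (P : forall c : constr S, argty c -> Type).

Lemma LVar_inj (x y : V) : LVar x = LVar y :> layer V P -> x = y.
Proof. by case. Qed.

Lemma LNode_neq_LVar c a (x : V) : LNode c a <> LVar x :> layer V P.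
Proof. by []. Qed.

Lemma LNode_inj1 c d a b : LNode c a = LNode d b :> layer V P -> c = d.
Proof. by case. Qed.

End LayerInversion.

Lemma pick_ifW (T T' : Type) (R : nat -> T -> T' -> Prop) n (b : bool)
    (f : b = false -> T) (g : b = true -> T) (f' : b = false -> T') (g' : b = true -> T') :
  (forall e, R n.+1 (f e) (f' e)) -> (forall e, R n (g e) (g' e)) ->
  R (n.+1 - b)%N (pick_if f g) (pick_if f' g').
Proof.
case: b f g f' g' => f g f' g' h h'; first by rewrite subn1; exact: h'.
by rewrite subn0; exact: h.
Qed.

Lemma pick_if_cst (T : Type) (b : bool) (x : T) :
  pick_if (fun _ : b = false => x) (fun _ : b = true => x) = x.
Proof. by case: b. Qed.

Lemma insel_nsel (V : choiceType) b (X : nomSet V) (x : X) :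
  insel (@underlying V) b x = nsel (fun=> x) (fun=> x).
Proof. by case: b. Qed.

Lemma unsel_inj (V : choiceType) b (X : nomSet V) :
  injective (unsel (@underlying V) b : sel b X X -> X).
Proof. by case: b. Qed.

Lemma bintro_transfer1 (V : choiceType) (G : binder V) n (A B : nomSet V)
    (xs ys : n.-tuple V) (a b : A) (a' b' : B) :
  (forall s, act s a = b -> act s a' = b') ->
  bintro G xs a = bintro G ys b -> bintro G xs a' = bintro G ys b'.
Proof.
move=> h e; have [T aT] := nom_fin_supp a; have [T' bT'] := nom_fin_supp b.
apply: (@bintro_transfer _ G n A B unit tt xs ys (T ++ T') (fun=> a) (fun=> b)) => //.
- by move=> _; apply: supports_sub aT => x; rewrite mem_cat => ->.
- by move=> _; apply: supports_sub bT' => x; rewrite mem_cat orbC => ->.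
by move=> s /(_ tt); exact: h.
Qed.

Section Levels.
Variables (V : choiceType) (S : signature) (G : binder V) (Q : nomSet V).

(* [tau n t] is the truncation of t at level n, taken up to alpha-equivalence in
   the case of [abs_binder]. The terminal coalgebra Z then consists of the mixed
   terms whose truncations have a common finite support, modulo [tau], and
   [zeta n] is the map that [tau n] induces on Z. *)
Definition bQ : nomSet V :=
  layer_nom (fun (c : constr S) i => bnd G (nbind c i) Q).

Variables (conQ : bQ -> Q) (tau : nat -> mterm V S -> Q).
Hypothesis conQ_inj : injective conQ.
Hypothesis conQ_equivariant : equivariant conQ.
Hypothesis tau_act : forall n s t,
  tau n (act (p := mterm_permSet V S) s t) = act s (tau n t).
Hypothesis tau0 : forall t u, tau 0 t = tau 0 u.
Hypothesis tau_var : forall n x, tau n.+1 (tvar S x) = conQ (LVar x).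
Hypothesis tau_node : forall n c xs ts, tau n.+1 (tnode c xs ts) =
  conQ (LNode c (fun i => bintro G (xs i) (tau (n.+1 - coind c i) (ts i)))).

Lemma tau_var_inj n m x y : tau n.+1 (tvar S x) = tau m.+1 (tvar S y) -> x = y.
Proof. by rewrite !tau_var => /conQ_inj /LVar_inj. Qed.

Lemma tau_node_neq_var n m c xs ts y : tau n.+1 (tnode c xs ts) <> tau m.+1 (tvar S y).
Proof. by rewrite tau_var tau_node => /conQ_inj /LNode_neq_LVar. Qed.

Lemma tau_node_inj1 n m c xs ts d ys us :
  tau n.+1 (tnode c xs ts) = tau m.+1 (tnode d ys us) -> c = d.
Proof. by rewrite !tau_node => /conQ_inj /LNode_inj1. Qed.

Lemma tau_node_inj n m c xs ts ys us :
  tau n.+1 (tnode c xs ts) = tau m.+1 (tnode c ys us) ->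
  forall i : argty c, bintro G (xs i) (tau (n.+1 - coind c i) (ts i)) =
    bintro G (ys i) (tau (m.+1 - coind c i) (us i)).
Proof.
by rewrite !tau_node => /conQ_inj /LNode_inj e i; exact: (congr1 (@^~ i) e).
Qed.

Lemma tau_down n t u : tau n.+1 t = tau n.+1 u -> tau n t = tau n u.
Proof.
rewrite -[t](@act1 _ (mterm_permSet V S)); move: (perm_id) => s.
elim: n t s u => [|n ihn] t; first by move=> s u _; exact: tau0.
elim/(well_founded_ind (@ind_child_wf V S)): t => t iht s u.
have [[x ->]|[c [xs [ts tE]]]] := mterm_case t;
  have [[y ->]|[d [ys [us ->]]]] := mterm_case u.
- by rewrite mterm_act_tvar => /tau_var_inj ->; rewrite !tau_var.
- by rewrite mterm_act_tvar => /esym /tau_node_neq_var.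
- by rewrite tE mterm_act_tnode => /tau_node_neq_var.
rewrite tE mterm_act_tnode => e; have cd := tau_node_inj1 e; subst d.
rewrite !tau_node; congr (conQ (LNode _ _)); apply: functional_extensionality_dep => i.
apply: bintro_transfer1 (tau_node_inj e i) => r; rewrite -!tau_act -!actM.
have [ci|ci] : coind c i = true \/ coind c i = false by case: (coind c i); [left | right].
  by rewrite ci !subn1; exact: ihn.
by rewrite ci !subn0; apply: iht; exists c, xs, ts, i; rewrite ci.
Qed.

Lemma supports_tau_child T n c xs ts (i : argty c) :
  supports T (tau n.+1 (tnode c xs ts)) ->
  supports (tval (xs i) ++ T) (tau (n.+1 - coind c i) (ts i)).
Proof.
move=> hT s sT; have xE : map_tuple s (xs i) = xs i.
  by apply: supports_map_tuple => x xi; apply: sT; rewrite mem_cat xi.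
have : act s (tau n.+1 (tnode c xs ts)) = tau n.+1 (tnode c xs ts).
  by apply: hT => x xT; apply: sT; rewrite mem_cat xT orbT.
rewrite -tau_act mterm_act_tnode => /tau_node_inj /(_ i).
by rewrite xE tau_act => /bintro_inj.
Qed.

Variables (Z : nomSet V) (zeta : nat -> Z -> Q).
Hypothesis zeta_act : forall n s z, zeta n (act s z) = act s (zeta n z).
Hypothesis zeta_sep : forall z z', (forall n, zeta n z = zeta n z') -> z = z'.
Hypothesis zeta_tau : forall z, exists t, forall n, zeta n z = tau n t.
Hypothesis tau_zeta : forall t T, (forall n, supports T (tau n t)) ->
  exists z, forall n, zeta n z = tau n t.

Notation bT := (bT S G).

Definition con_level n (l : bT Z Z) : Q := conQ (match l with
  | LVar x => LVar x
  | LNode c l => LNode c (fun i => bmap G (nbind c i)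
      (fun z => zeta (n.+1 - coind c i) (unsel (@underlying V) (coind c i) z)) (l i))
  end).

Lemma con_level_node n c xs f g : con_level n (@bnode V S G Z Z c xs f g) =
  conQ (LNode c (fun i =>
    bintro G (xs i) (zeta (n.+1 - coind c i) (pick_if (f i) (g i))))).
Proof.
congr (conQ (LNode _ _)); apply: functional_extensionality_dep => i.
rewrite bmapE ?unsel_nsel // => s z; rewrite -zeta_act; congr (zeta _ _).
exact: equivariant_unsel.
Qed.

Lemma con_level_tau n c xs f g ts :
  (forall (i : argty c) k, zeta k (pick_if (f i) (g i)) = tau k (ts i)) ->
  con_level n (@bnode V S G Z Z c xs f g) = tau n.+1 (tnode c xs ts).
Proof.
move=> h; rewrite con_level_node tau_node; congr (conQ (LNode _ _)).
by apply: functional_extensionality_dep => i; rewrite h.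
Qed.

Lemma equivariant_con_level n : equivariant (con_level n).
Proof.
move=> s l; have [[x ->]|[c [xs [f [g ->]]]]] := bT_case l.
  by rewrite -conQ_equivariant.
rewrite act_bnode !con_level_node -conQ_equivariant; congr (conQ (LNode _ _)).
apply: functional_extensionality_dep => i.
rewrite act_bintro -zeta_act; congr (bintro _ _ (zeta _ _)).
by apply: (pick_ifP (R := fun z z' => z = act s z')).
Qed.

Lemma supports_tau_node c xs ts (T : argty c -> seq V) :
  (forall i n, supports (T i) (tau n (ts i))) ->
  exists T', forall n, supports T' (tau n (tnode c xs ts)).
Proof.
move=> hT; exists (flatten (codom (fun i => tval (xs i) ++ T i))) => -[|n] s sT.
  by rewrite -tau_act; exact: tau0.
have {}sT i : {in tval (xs i) ++ T i, forall x, s x = x}.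
  by move=> x xT; apply/sT/flattenP; exists (tval (xs i) ++ T i); rewrite ?codom_f.
rewrite -tau_act mterm_act_tnode !tau_node; congr (conQ (LNode _ _)).
apply: functional_extensionality_dep => i; rewrite tau_act hT; last first.
  by move=> x xT; apply: (sT i); rewrite mem_cat xT orbT.
by rewrite supports_map_tuple // => x xT; apply: (sT i); rewrite mem_cat xT.
Qed.

Lemma level_con_ex l : exists z, forall n, zeta n.+1 z = con_level n l.
Proof.
have [[x ->]|[c [xs [f [g ->]]]]] := bT_case l.
  have [|z zE] := @tau_zeta (tvar S x) [:: x].
    by move=> n s sx; rewrite -tau_act mterm_act_tvar sx ?mem_head.
  by exists z => n; rewrite zE tau_var.
have /choice[ts tsE] (i : argty c) := zeta_tau (pick_if (f i) (g i)).
have /choice[T hT] (i : argty c) := nom_fin_supp (pick_if (f i) (g i)).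
have [|T' hT'] := @supports_tau_node c xs ts T.
  by move=> i n s sT; rewrite -tsE -zeta_act hT.
have [z zE] := tau_zeta hT'.
by exists z => n; rewrite zE (con_level_tau _ _ tsE).
Qed.

Definition level_con (l : bT Z Z) : Z := projT1 (cid (level_con_ex l)).

Lemma zeta0 z z' : zeta 0 z = zeta 0 z'.
Proof. by have [t ->] := zeta_tau z; have [u ->] := zeta_tau z'; exact: tau0. Qed.

Lemma zeta_level_con n l : zeta n.+1 (level_con l) = con_level n l.
Proof. by rewrite /level_con; case: cid => z /= ->. Qed.

Lemma level_con_eq z l : (forall n, zeta n.+1 z = con_level n l) -> level_con l = z.
Proof.
by move=> h; apply: zeta_sep => -[|n]; [exact: zeta0 | rewrite zeta_level_con h].
Qed.

Lemma equivariant_level_con : equivariant level_con.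
Proof.
move=> s l; apply: level_con_eq => n.
by rewrite zeta_act zeta_level_con equivariant_con_level.
Qed.

Lemma zeta_level_con_var n x : zeta n (level_con (LVar x)) = tau n (tvar S x).
Proof.
case: n => [|n]; last by rewrite zeta_level_con tau_var.
by have [t ->] := zeta_tau (level_con (LVar x)); exact: tau0.
Qed.

Lemma zeta_level_con_node n c xs f g ts :
  (forall (i : argty c) k, zeta k (pick_if (f i) (g i)) = tau k (ts i)) ->
  zeta n (level_con (@bnode V S G Z Z c xs f g)) = tau n (tnode c xs ts).
Proof.
move=> h; case: n => [|n]; last by rewrite zeta_level_con (con_level_tau _ _ h).
by have [t ->] := zeta_tau (level_con (@bnode V S G Z Z c xs f g)); exact: tau0.
Qed.

Lemma level_con_inj : injective level_con.
Proof.
move=> l l' e; have {e} : forall n, con_level n l = con_level n l'.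
  by move=> n; rewrite -!zeta_level_con e.
have [[x ->]|[c [xs [f [g ->]]]]] := bT_case l;
  have [[x' ->]|[c' [xs' [f' [g' ->]]]]] := bT_case l' => e.
- by have /conQ_inj/LVar_inj -> := e 0%N.
- by have := e 0%N; rewrite con_level_node => /conQ_inj /esym /LNode_neq_LVar.
- by have := e 0%N; rewrite con_level_node => /conQ_inj /LNode_neq_LVar.
have : c = c' by have := e 0%N; rewrite !con_level_node => /conQ_inj /LNode_inj1.
move=> cc; subst c'; congr LNode; apply: functional_extensionality_dep => i.
have [T hT] := nom_fin_supp (pick_if (f i) (g i)).
have [T' hT'] := nom_fin_supp (pick_if (f' i) (g' i)).
apply: (@bintro_transfer _ G _ Q _ nat 0%N _ _ (T ++ T')
  (fun n => zeta (n.+1 - coind c i) (pick_if (f i) (g i)))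
  (fun n => zeta (n.+1 - coind c i) (pick_if (f' i) (g' i)))).
- by move=> n s sT; rewrite -zeta_act hT // => x xT; apply: sT; rewrite mem_cat xT.
- by move=> n s sT; rewrite -zeta_act hT' // => x xT; apply: sT; rewrite mem_cat xT orbT.
- move=> s h; apply: (@unsel_inj V (coind c i)).
  rewrite equivariant_unsel !unsel_nsel; apply: zeta_sep => -[|n]; first exact: zeta0.
  by rewrite zeta_act; have := h (n + coind c i)%N; rewrite -addSn addnK.
by move=> n; have := e n; rewrite !con_level_node => /conQ_inj /LNode_inj /(congr1 (@^~ i)).
Qed.

Section Unfolding.
Variables (A : Type) (h : A -> mterm V S).

Definition mgraft (m : mixed V S A) : mterm V S :=
  mixed_fold (@mterm_con V S) (mixed_map h m).

Lemma mgraft_node c xs f g : mgraft (@MNode V S A c xs f g) =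
  tnode c xs (fun i => pick_if (fun e => mgraft (f i e)) (fun e => h (g i e))).
Proof.
rewrite /mgraft mixed_map_node /=; congr tnode; apply/funext => i.
exact: unsel_mksel.
Qed.

End Unfolding.

Notation mcl := (mcls G).

Lemma bnode_inj1 X Y c xs f g d ys f' g' :
  @bnode V S G X Y c xs f g = @bnode V S G X Y d ys f' g' -> c = d.
Proof. exact: LNode_inj1. Qed.

Lemma bnode_inj X Y c xs f g ys f' g' :
  @bnode V S G X Y c xs f g = @bnode V S G X Y c ys f' g' ->
  forall i, bintro G (xs i) (nsel (f i) (g i)) = bintro G (ys i) (nsel (f' i) (g' i)).
Proof. by move=> /LNode_inj e i; exact: (congr1 (@^~ i) e). Qed.

Lemma mcls_var_inj (Y : nomSet V) x y : mcl (MVar S Y x) = mcl (MVar S Y y) -> x = y.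
Proof. by rewrite -!mu_con_var => /mu_con_inj /LVar_inj. Qed.

Lemma mcls_node_neq_var (Y : nomSet V) c xs f g y :
  mcl (@MNode V S Y c xs f g) <> mcl (MVar S Y y).
Proof. by rewrite -mu_con_var -mu_con_node => /mu_con_inj /LNode_neq_LVar. Qed.

Lemma mcls_node_inj1 (Y : nomSet V) c xs f g d ys f' g' :
  mcl (@MNode V S Y c xs f g) = mcl (@MNode V S Y d ys f' g') -> c = d.
Proof. by rewrite -!mu_con_node => /mu_con_inj /LNode_inj1. Qed.

Lemma mcls_node_inj (Y : nomSet V) c xs f g ys f' g' :
  mcl (@MNode V S Y c xs f g) = mcl (@MNode V S Y c ys f' g') ->
  forall i, bintro G (xs i) (nsel (fun e => mcl (f i e)) (g i)) =
     bintro G (ys i) (nsel (fun e => mcl (f' i e)) (g' i)).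
Proof. by rewrite -!mu_con_node => /mu_con_inj /bnode_inj. Qed.

Notation fold := (mu_fold level_con).

Lemma level_fold_inj : injective fold.
Proof.
move=> p q; have [m ->] := mcls_surj p; have [m' ->] := mcls_surj q.
rewrite !mu_foldE; try exact: equivariant_level_con.
rewrite -[m](@act1 _ (mixed_permSet S Z)); move: (perm_id) => s.
elim: m s m' => [x|c xs f ih g] s [y|d ys f' g'] /= /level_con_inj.
- by move=> /LVar_inj ->.
- by move=> /esym /LNode_neq_LVar.
- by move=> /LNode_neq_LVar.
move=> e; have cd := bnode_inj1 e; subst d.
rewrite -!mu_con_node; congr (mu_con _); congr (LNode _ _).
apply: functional_extensionality_dep => i.
apply: bintro_transfer1 (bnode_inj e i) => r; rewrite !act_nsel => /nsel_inj[ef eg].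
congr nsel => //; apply/funext => e'.
apply: (etrans (act_mcls G r _)); rewrite -[mixed_act r _](@actM _ (mixed_permSet S Z) r s).
apply: ih; rewrite (actM (p := mixed_permSet S Z)).
rewrite -[LHS]/(bfold level_con (act (p := mixed_nom S Z) r (mixed_act s (f i e')))).
rewrite (bfold_equivariant equivariant_level_con).
exact: (congr1 (@^~ e') ef).
Qed.

Lemma tau_zeta_child z c xs ts : (forall n, zeta n z = tau n (tnode c xs ts)) ->
  forall i, exists y, forall n, zeta n y = tau n (ts i).
Proof.
move=> zE i; have [T zT] := nom_fin_supp z.
apply: (@tau_zeta _ (tval (xs i) ++ T)) => -[|n].
  by move=> s _; rewrite -tau_act; exact: tau0.
have := @supports_tau_child T (n + coind c i)%N c xs ts i.
rewrite -addSn addnK; apply.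
by move=> s sT; rewrite -zE -zeta_act zT.
Qed.

Lemma level_fold_surj z : exists p, fold p = z.
Proof.
suff [m mz] : exists m, bfold level_con m = z.
  by exists (mcls G m); rewrite mu_foldE //; exact: equivariant_level_con.
have [t tz] := zeta_tau z.
elim/(well_founded_ind (@ind_child_wf V S)): t z tz => t ih z tz.
have [[x tE]|[c [xs [ts tE]]]] := mterm_case t; rewrite tE in tz.
  by exists (MVar S Z x); apply: level_con_eq => n; rewrite tz tau_var.
have /choice[zs zsE] := tau_zeta_child tz.
have /choice[ms msE] (ie : {i : argty c | coind c i = false}) :
    exists m, bfold level_con m = zs (sval ie).
  case: ie => i ci /=; apply: ih (zsE i).
  by exists c, xs, ts, i; rewrite ci.
exists (MNode xs (fun i e => ms (exist _ i e)) (fun i _ => zs i)).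
apply: level_con_eq => n.
rewrite tz; apply/esym/con_level_tau => i k; rewrite -zsE; congr zeta.
transitivity (pick_if (fun _ : coind c i = false => zs i) (fun _ : coind c i = true => zs i)).
  by apply: (pick_ifP (R := eq)) => // e; exact: msE.
exact: pick_if_cst.
Qed.

Definition level_out z : mu_bT S G Z := projT1 (cid (level_fold_surj z)).

Lemma level_outK : cancel level_out fold.
Proof. by move=> z; rewrite /level_out; case: cid. Qed.

Lemma level_foldK : cancel fold level_out.
Proof. by move=> p; apply: level_fold_inj; rewrite level_outK. Qed.

Lemma equivariant_level_fold : equivariant fold.
Proof. exact: equivariant_mu_fold equivariant_level_con. Qed.

Lemma equivariant_level_out : equivariant level_out.
Proof. by move=> s z; apply: level_fold_inj; rewrite equivariant_level_fold !level_outK. Qed.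

Lemma level_fold_mu_con l : fold (mu_con l) = level_con (bT_map fold id l).
Proof. exact: mu_fold_con equivariant_level_con. Qed.

Section Terminal.
Variables (A : nomSet V) (a : A -> mu_bT S G A).
Hypothesis a_equivariant : equivariant a.

Let r (x : A) : mixed V S A := qrepr (a x).
Let h0 : A -> mterm V S := mterm_unfold r.

Lemma mcls_r x : mcl (r x) = a x.
Proof. by rewrite /mcls qreprK. Qed.

Lemma h0E x : h0 x = mgraft h0 (r x).
Proof. exact: unfold_mixedE. Qed.

(* The chosen representatives [r x] are not equivariant in [x], but their
   unfoldings are so up to the identifications made by the levels. *)
Lemma tau_mgraft n m s m' : mcl (mixed_act s m) = mcl m' ->
  act s (tau n (mgraft h0 m)) = tau n (mgraft h0 m').
Proof.
elim: n m s m' => [|n ihn] m; first by move=> *; rewrite -tau_act; exact: tau0.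
elim: m => [x|c xs f ih g] s [y|d ys f' g'] e.
- by rewrite -(mcls_var_inj e) /mgraft /= !tau_var -conQ_equivariant.
- by case: (mcls_node_neq_var (esym e)).
- by case: (mcls_node_neq_var e).
have cd := mcls_node_inj1 e; subst d.
rewrite !mgraft_node !tau_node -conQ_equivariant; congr (conQ _).
congr LNode; apply: functional_extensionality_dep => i.
rewrite act_bintro; apply: bintro_transfer1 (mcls_node_inj e i) => u.
rewrite act_nsel => /nsel_inj[ef eg]; rewrite -actM.
apply: (pick_ifW (R := fun k t t' => act (perm_comp u s) (tau k t) = tau k t')) => e'.
  apply: ih; rewrite [mixed_act _ _](@actM _ (mixed_permSet S A) u s).
  exact: (etrans (esym (act_mcls G u _)) (congr1 (@^~ e') ef)).
rewrite !h0E; apply: ihn; rewrite -act_mcls !mcls_r -a_equivariant actM.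
by congr a; exact: (congr1 (@^~ e') eg).
Qed.

Lemma anamorphism_ex x : exists z, forall n, zeta n z = tau n (h0 x).
Proof.
have [T xT] := nom_fin_supp x; apply: (@tau_zeta _ T) => n s sT.
by rewrite h0E; apply: tau_mgraft; rewrite -act_mcls mcls_r -a_equivariant xT.
Qed.

Definition anamorphism x : Z := projT1 (cid (anamorphism_ex x)).

Lemma zeta_anamorphism n x : zeta n (anamorphism x) = tau n (h0 x).
Proof. by rewrite /anamorphism; case: cid => z /= ->. Qed.

Lemma equivariant_anamorphism : equivariant anamorphism.
Proof.
move=> s x; apply: zeta_sep => n; rewrite zeta_act !zeta_anamorphism !h0E.
by apply/esym/tau_mgraft; rewrite -act_mcls !mcls_r -a_equivariant.
Qed.

Lemma zeta_fold_mu_map n (h : A -> Z) (g : mu_bT S G A -> mu_bT S G Z) :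
  equivariant h -> equivariant g ->
  (forall l, g (mu_con l) = mu_con (bT_map g h l)) ->
  (forall k x, (k < n)%N -> zeta k (h x) = tau k (h0 x)) ->
  forall m, zeta n (fold (g (mcl m))) = tau n (mgraft h0 m).
Proof.
move=> he ge gE hE m; case: n hE => [|n] hE.
  have [t ->] := zeta_tau (fold (g (mcl m))); exact: tau0.
elim: m => [x|c xs f ih g'].
  by rewrite -mu_con_var gE level_fold_mu_con zeta_level_con /mgraft /= tau_var.
rewrite -mu_con_node gE bT_map_node // level_fold_mu_con bT_map_node //; last first.
  exact: equivariant_level_fold.
rewrite zeta_level_con con_level_node mgraft_node tau_node; congr (conQ (LNode _ _)).
apply: functional_extensionality_dep => i; congr bintro.
apply: (pick_ifW (R := fun k z t => zeta k z = tau k t)) => e; first exact: ih.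
exact: hE.
Qed.

Lemma anamorphism_uniq h (g : mu_bT S G A -> mu_bT S G Z) :
  equivariant h -> equivariant g ->
  (forall l, g (mu_con l) = mu_con (bT_map g h l)) ->
  (forall x, level_out (h x) = g (a x)) -> h = anamorphism.
Proof.
move=> he ge gE hE; apply/funext => x; apply: zeta_sep => n.
rewrite zeta_anamorphism; elim/ltn_ind: n x => n ih x.
rewrite -[h x]level_outK hE -mcls_r h0E; apply: zeta_fold_mu_map => // k y kn.
exact: ih.
Qed.

Lemma anamorphism_map : exists g : mu_bT S G A -> mu_bT S G Z,
  [/\ equivariant g, forall l, g (mu_con l) = mu_con (bT_map g anamorphism l)
    & forall x, level_out (anamorphism x) = g (a x)].
Proof.
have ae := equivariant_anamorphism.
pose b (l : bT (mu_bT S G Z) A) := mu_con (bT_map id anamorphism l).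
have be : equivariant b.
  by move=> s l; rewrite /b equivariant_bT_map //; exact: equivariant_mu_con.
have ge := equivariant_mu_fold be.
have gE l : mu_fold b (mu_con l) = mu_con (bT_map (mu_fold b) anamorphism l).
  by rewrite mu_fold_con // /b bT_map_comp.
exists (mu_fold b); split=> // x.
apply: level_fold_inj; rewrite level_outK; apply: zeta_sep => n.
rewrite zeta_anamorphism h0E -mcls_r; apply/esym/zeta_fold_mu_map => // k y _.
exact: zeta_anamorphism.
Qed.

End Terminal.

Theorem level_con_is_nu_mu : @is_nu_mu (Nom V) bT (@bT_map V S G) Z level_con.
Proof.
split; first exact: equivariant_level_con.
exists (bT_mu S G), level_out; split; last first.
  exists fold; split; [exact: equivariant_level_fold | | exact: level_outK | exact: level_foldK].
  by apply/funext => l; exact: level_fold_mu_con.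
split=> [|A a ae]; first exact: equivariant_level_out.
have [g [ge gE outg]] := anamorphism_map ae.
exists (anamorphism ae); split.
  split; first exact: equivariant_anamorphism.
  exists g; last by apply/funext => x; exact: outg.
  by split=> //; apply/funext => l; exact: gE.
move=> h [he [g' [ge' gE'] outE]]; apply/esym.
apply: (@anamorphism_uniq _ _ ae h g') => // [l|x].
  exact: (congr1 (@^~ l) gE').
exact: (congr1 (@^~ x) outE).
Qed.

Theorem nu_mu_ex : exists2 f : bT Z Z -> Z,
  (forall n x, zeta n (f (LVar x)) = tau n (tvar S x)) /\
  (forall n (c : constr S) (xs : forall i : argty c, (nbind c i).-tuple V)
      (zs : argty c -> Z) (ts : argty c -> mterm V S),
    (forall i k, zeta k (zs i) = tau k (ts i)) ->
    zeta n (f (LNode c (fun i => bintro G (xs i)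
      (insel (@underlying V) (coind c i) (zs i))))) = tau n (tnode c xs ts)) &
  @is_nu_mu (Nom V) bT (@bT_map V S G) Z f.
Proof.
exists level_con; last exact: level_con_is_nu_mu.
split=> [|n c xs zs ts zE]; first exact: zeta_level_con_var.
rewrite -(@zeta_level_con_node n c xs (fun i _ => zs i) (fun i _ => zs i)); last first.
  by move=> i k; rewrite pick_if_cst.
congr (zeta _ (level_con (LNode _ _))); apply: functional_extensionality_dep => i.
by rewrite insel_nsel.
Qed.

End Levels.

(** * Truncation metrics and completions *)

Section TruncDist.
Import Order.TTheory GRing.Theory Num.Theory numFieldNormedType.Exports.
Local Open Scope ring_scope.
Variable R : realType.
Implicit Types (P : set nat).

Definition down_set P : Prop := forall n, P n.+1 -> P n.

Lemma down_set_le P m n : down_set P -> (m <= n)%N -> P n -> P m.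
Proof. by move=> dP /subnK <-; elim: (n - m)%N => [//|k ih] /dP. Qed.

Let E P : set R := [set 2 ^- n | n in P].

Lemma exp2N_gt0 n : 0 < 2 ^- n :> R.
Proof. by rewrite invr_gt0 exprn_gt0. Qed.

Lemma exp2N_le m n : (m <= n)%N -> 2 ^- n <= 2 ^- m :> R.
Proof. by move=> mn; rewrite lef_pV2 ?posrE ?exprn_gt0 // ler_eXn2l // ltr1n. Qed.

Lemma exp2N_small (e : R) : 0 < e -> exists n, 2 ^- n < e.
Proof.
move=> e0; exists (Num.bound e^-1); rewrite invf_plt ?posrE ?exprn_gt0 //.
exact: upper_nthrootP.
Qed.

Lemma trunc_dist_lb P : lbound (E P) 0.
Proof. by move=> _ [n _ <-]; exact: ltW (exp2N_gt0 n). Qed.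

Lemma trunc_dist_ge0 P : P 0%N -> 0 <= trunc_dist R P.
Proof. by move=> P0; apply: lb_le_inf; [exists (2 ^- 0), 0%N | exact: trunc_dist_lb]. Qed.

Lemma trunc_dist_ub P n : P n -> trunc_dist R P <= 2 ^- n.
Proof. by move=> Pn; apply: ge_inf; [exists 0; exact: trunc_dist_lb | exists n]. Qed.

Lemma trunc_dist_leP P n : P 0%N -> down_set P -> trunc_dist R P <= 2 ^- n <-> P n.
Proof.
move=> P0 dP; split; last exact: trunc_dist_ub.
apply: contraPP => nP; case: n nP => [//|n nP]; apply/negP; rewrite -ltNge.
apply: (@lt_le_trans _ _ (2 ^- n)).
  by rewrite ltf_pV2 ?posrE ?exprn_gt0 // ltr_eXn2l // ltr1n.
apply: lb_le_inf; first by exists (2 ^- 0), 0%N.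
move=> _ [m Pm <-]; apply: exp2N_le; rewrite leqNgt; apply/negP => nm; apply: nP.
exact: down_set_le Pm.
Qed.

Lemma trunc_dist_sub P P' : P 0%N -> P `<=` P' -> trunc_dist R P' <= trunc_dist R P.
Proof.
move=> P0 PP'; apply: lb_le_inf; first by exists (2 ^- 0), 0%N.
by move=> _ [n Pn <-]; apply: trunc_dist_ub; exact: PP'.
Qed.

Lemma le_exp2N_eq0 (x : R) : 0 <= x -> (forall n, x <= 2 ^- n) -> x = 0.
Proof.
move=> x0 h; apply/eqP; rewrite eq_le x0 andbT leNgt; apply/negP => /exp2N_small[n].
by rewrite ltNge h.
Qed.

Lemma trunc_dist_eq0 P : P 0%N -> down_set P -> trunc_dist R P = 0 <-> forall n, P n.
Proof.
move=> P0 dP; split=> [e n|h].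
  by apply/trunc_dist_leP => //; rewrite e ltW // exp2N_gt0.
by apply: le_exp2N_eq0; [exact: trunc_dist_ge0 | move=> n; exact: trunc_dist_ub].
Qed.

Lemma cvg0_exp2N (f : nat -> R) : (forall n, 0 <= f n) ->
  f @ \oo --> (0 : R) <-> forall n, exists N, forall m, (N <= m)%N -> f m <= 2 ^- n.
Proof.
move=> f0; split=> [/cvgr0Pnorm_le h n|h].
  have [N _ hN] := h _ (exp2N_gt0 n); exists N => m /hN.
  by rewrite ger0_norm.
apply/cvgr0Pnorm_le => e /exp2N_small[n ne]; have [N hN] := h n.
exists N => // m /= /hN fm; rewrite ger0_norm //.
exact: le_trans fm (ltW ne).
Qed.

Lemma trunc_dist_near P P' n : P 0%N -> P' 0%N -> down_set P -> down_set P' ->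
  (forall k, (k <= n)%N -> P k <-> P' k) ->
  `|trunc_dist R P - trunc_dist R P'| <= 2 ^- n.
Proof.
move=> P0 P0' dP dP' h; have [Pn|nPn] := pselect (P n).
  have Pn' : P' n by apply/h.
  have := trunc_dist_ub Pn; have := trunc_dist_ub Pn'.
  have := trunc_dist_ge0 P0; have := trunc_dist_ge0 P0'.
  by move=> ? ? ? ?; rewrite ler_distl lerBlDr !ler_wpDl.
have -> : P = P'.
  apply/seteqP; split=> k Pk.
    have [kn|/ltnW nk] := leqP k n; first exact/h.
    by case: nPn; exact: down_set_le Pk.
  have [kn|/ltnW nk] := leqP k n; first exact/h.
  by case: nPn; apply/h => //; exact: down_set_le Pk.
by rewrite subrr normr0 ltW // exp2N_gt0.
Qed.

End TruncDist.

Section Levels.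
Import Order.TTheory GRing.Theory Num.Theory numFieldNormedType.Exports.
Local Open Scope ring_scope.
Variable R : realType.

(* All the metrics involved arise from maps [tau n], the truncations at level n,
   by [d a b = inf {2^-n : tau n a = tau n b}]. *)
Definition agree (A Q : Type) (tau : nat -> A -> Q) (a b : A) : set nat :=
  [set n | tau n a = tau n b].

Record is_level (A Q : Type) (tau : nat -> A -> Q) (d : A -> A -> R) : Prop := {
  level0 : forall a b, tau 0%N a = tau 0%N b;
  level_down : forall n a b, tau n.+1 a = tau n.+1 b -> tau n a = tau n b;
  level_dist : forall a b, d a b = trunc_dist R (agree tau a b) }.

Definition level_separated (A Q : Type) (tau : nat -> A -> Q) : Prop :=
  forall a b, (forall n, tau n a = tau n b) -> a = b.

Section OneSpace.
Variables (A Q : Type) (tau : nat -> A -> Q) (d : A -> A -> R).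
Hypothesis L : is_level tau d.

Lemma down_agree a b : down_set (agree tau a b).
Proof. by move=> n; exact: level_down L _ _ _. Qed.

Lemma level_le m n a b : (m <= n)%N -> tau n a = tau n b -> tau m a = tau m b.
Proof. exact: (down_set_le (@down_agree a b)). Qed.

Lemma dist_le n a b : d a b <= 2 ^- n <-> tau n a = tau n b.
Proof. by rewrite (level_dist L) trunc_dist_leP //; [exact: level0 L _ _ | exact: down_agree]. Qed.

Lemma dist_ge0 a b : 0 <= d a b.
Proof. by rewrite (level_dist L); apply: trunc_dist_ge0; exact: level0 L _ _. Qed.

Lemma dist_eq0 a b : d a b = 0 <-> forall n, tau n a = tau n b.
Proof. by rewrite (level_dist L) trunc_dist_eq0 //; [exact: level0 L _ _ | exact: down_agree]. Qed.

Lemma dist_sym a b : d a b = d b a.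
Proof.
rewrite !(level_dist L); congr trunc_dist.
by apply/seteqP; split=> n; rewrite /agree /= => ->.
Qed.

Lemma dist_triangle a b c : d a c <= d a b + d b c.
Proof.
have key P P' : down_set P -> down_set P' -> P `<=` P' \/ P' `<=` P.
  move=> dP dP'; have [|/existsNP[n /not_implyP[Pn nPn']]] := pselect (P `<=` P'); first by left.
  right=> k Pk; have [kn|/ltnW nk] := leqP k n; first exact: down_set_le Pn.
  by case: nPn'; exact: down_set_le Pk.
have dab := @dist_ge0 a b; have dbc := @dist_ge0 b c.
have [ab|bc] := key _ _ (@down_agree a b) (@down_agree b c).
  apply: (@le_trans _ _ (d a b)); last by rewrite lerDl.
  rewrite !(level_dist L); apply: trunc_dist_sub => [|n abn]; first exact: level0 L _ _.
  by rewrite /agree /= abn; exact: ab.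
apply: (@le_trans _ _ (d b c)); last by rewrite lerDr.
rewrite !(level_dist L); apply: trunc_dist_sub => [|n bcn]; first exact: level0 L _ _.
by rewrite /agree /= -bcn; exact: bc.
Qed.

Lemma level_is_metric : level_separated tau -> is_metric d.
Proof.
move=> sep; split; [exact: dist_ge0 | | exact: dist_sym | exact: dist_triangle].
by move=> a b; rewrite dist_eq0; split=> [/sep|->].
Qed.

Lemma cauchy_seqE u : cauchy_seq d u <->
  forall n, exists N, forall m m', (N <= m)%N -> (N <= m')%N -> tau n (u m) = tau n (u m').
Proof.
split=> h.
  move=> n; have [N hN] := h _ (exp2N_gt0 R n); exists N => m m' Nm Nm'.
  by apply/dist_le/ltW/hN.
move=> e /exp2N_small[n ne]; have [N hN] := h n; exists N => m m' Nm Nm'.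
by apply: le_lt_trans ne; apply/dist_le/hN.
Qed.

Lemma cvg_distE u v : (fun n => d (u n) (v n)) @ \oo --> (0 : R) <->
  forall n, exists N, forall m, (N <= m)%N -> tau n (u m) = tau n (v m).
Proof.
rewrite cvg0_exp2N; last by move=> n; exact: dist_ge0.
by split=> h n; have [N hN] := h n; exists N => m /hN /dist_le.
Qed.

Lemma convergesE u a : converges_to d u a <->
  forall n, exists N, forall m, (N <= m)%N -> tau n (u m) = tau n a.
Proof. exact: (cvg_distE u (fun=> a)). Qed.

(* A Cauchy sequence has the same limit as a subsequence whose n-th term is
   already right up to level n. *)
Lemma cauchy_tower u : cauchy_seq d u -> exists w : nat -> nat,
  (forall n m, (w n <= m)%N -> tau n (u m) = tau n (u (w n))) /\
  forall n, tau n (u (w n)) = tau n (u (w n.+1)).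
Proof.
move=> /cauchy_seqE /choice[w wE]; exists w.
split=> [n m wm|n]; first exact: wE.
rewrite (wE n _ (maxn (w n) (w n.+1))) ?leq_maxl //.
by apply: (level_down L); apply: wE; rewrite ?leq_maxr.
Qed.

Lemma tower_cauchy u : (forall n, tau n (u n) = tau n (u n.+1)) -> cauchy_seq d u /\
  forall n m, (n <= m)%N -> tau n (u m) = tau n (u n).
Proof.
move=> uE; have h n m : (n <= m)%N -> tau n (u m) = tau n (u n).
  move=> /subnK <-; elim: (m - n)%N => [//|k <-]; apply/esym; rewrite addSn.
  by apply: level_le (uE _); exact: leq_addl.
split=> //; apply/cauchy_seqE => n; exists n => m m' nm nm'.
by rewrite h // h.
Qed.

End OneSpace.

Section TwoSpaces.
Variables (A C Q : Type) (tauA : nat -> A -> Q) (dA : A -> A -> R).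
Variables (tauC : nat -> C -> Q) (dC : C -> C -> R) (i : A -> C).
Hypotheses (LA : is_level tauA dA) (LC : is_level tauC dC).
Hypotheses (sepA : level_separated tauA) (sepC : level_separated tauC).
Hypothesis tau_i : forall n a, tauC n (i a) = tauA n a.

Lemma level_isometry a b : dC (i a) (i b) = dA a b.
Proof.
rewrite (level_dist LA) (level_dist LC); congr trunc_dist.
by apply/seteqP; split=> n; rewrite /agree /= !tau_i.
Qed.

Lemma level_completion :
  (forall c n, exists a, tauA n a = tauC n c) ->
  (forall w, (forall n, tauA n (w n) = tauA n (w n.+1)) ->
    exists c, forall n, tauC n c = tauA n (w n)) ->
  is_completion dA dC i.
Proof.
move=> dense complete; split.
- exact: level_is_metric LA sepA.
- exact: level_is_metric LC sepC.
- exact: level_isometry.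
- move=> u /(cauchy_tower LC)[w [wE wS]].
  have /choice[a aE] n := dense (u (w n)) n.
  have [n|c cE] := complete a.
    by rewrite aE wS -tau_i; apply/esym/(level_down LC); rewrite tau_i aE.
  exists c; apply/(convergesE LC) => n; exists (w n) => m /wE ->.
  by rewrite cE aE.
- move=> c; have /choice[a aE] := dense c.
  exists a; apply/(convergesE LC) => n; exists n => m nm.
  by apply: (level_le LC nm); rewrite /= tau_i aE.
Qed.

End TwoSpaces.

Section NominalCompletion.
Variable V : choiceType.
Hypothesis V_infinite : infinite_set [set: V].
Variables (A C Q : nomSet V) (tauA : nat -> A -> Q) (dA : A -> A -> R).
Variables (tauC : nat -> C -> Q) (dC : C -> C -> R) (i : A -> C).
Hypotheses (LA : is_level tauA dA) (LC : is_level tauC dC).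
Hypotheses (sepA : level_separated tauA) (sepC : level_separated tauC).
Hypothesis tauA_act : forall n s a, tauA n (act s a) = act s (tauA n a).
Hypothesis tauC_act : forall n s c, tauC n (act s c) = act s (tauC n c).
Hypothesis tau_i : forall n a, tauC n (i a) = tauA n a.

Lemma level_equivariant (B : nomSet V) (tau : nat -> B -> Q) (d : B -> B -> R) :
  is_level tau d -> (forall n s a, tau n (act s a) = act s (tau n a)) ->
  equivariant_dist d.
Proof.
move=> L tau_act s a b; rewrite !(level_dist L); congr trunc_dist.
by apply/seteqP; split=> n; rewrite /agree /= !tau_act; [exact: act_inj | move=> ->].
Qed.

Lemma level_nominal_completion :
  (forall c, exists S : seq V, forall n, exists2 a,
    tauA n a = tauC n c & forall x, supp a x -> x \in S) ->
  (forall w (S : seq V), (forall n, tauA n (w n) = tauA n (w n.+1)) ->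
    (forall n, supports S (w n)) -> exists c, forall n, tauC n c = tauA n (w n)) ->
  is_nominal_completion dA dC i.
Proof.
move=> dense complete; split.
- by split; [exact: level_is_metric LA sepA | exact: level_equivariant LA _].
- by split; [exact: level_is_metric LC sepC | exact: level_equivariant LC _].
- split; last exact: level_isometry LA LC tau_i.
  by move=> s a; apply: sepC => n; rewrite tauC_act !tau_i tauA_act.
- move=> u [S uS] /(cauchy_tower LA)[w [wE wS]].
  have [|c cE] := complete (fun n => u (w n)) S wS.
    by move=> n; apply: supports_supp => // x /uS.
  exists c; apply/(convergesE LC) => n; exists (w n) => m /wE.
  by rewrite cE /= tau_i.
move=> c; have [S hS] := dense c.
have /choice[u uP] n : exists a, tauA n a = tauC n c /\
    forall x, supp a x -> x \in S.
  by have [a aE aS] := hS n; exists a.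
have uE n : tauA n (u n) = tauC n c by case: (uP n).
have [n|uc uT] := tower_cauchy LA (u := u).
  rewrite uE -tau_i; apply/esym/(level_down LC).
  by rewrite tau_i uE.
exists u; split=> //; first by exists S => n x; case: (uP n) => _; exact.
by apply/(convergesE LC) => n; exists n => m /uT; rewrite /= tau_i uE.
Qed.

End NominalCompletion.

Section MetricCompletion.
Variables (V : choiceType) (A Q : permSet V) (tau : nat -> A -> Q) (d : A -> A -> R).
Hypothesis d_equivariant : equivariant_dist d.
Hypothesis L : is_level tau d.
Hypothesis tau_act : forall n s a, tau n (act s a) = act s (tau n a).

Notation cauchy := (cauchy_permSet d_equivariant).
Notation compl := (completion d_equivariant).

Lemma level_lim_ex n (u : cauchy) :
  exists q, exists N, forall m, (N <= m)%N -> tau n (sval u m) = q.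
Proof.
have [N hN] := iffLR (cauchy_seqE L _) (svalP u) n.
by exists (tau n (sval u N)), N => m Nm; exact: hN.
Qed.

Definition level_lim n (u : cauchy) : Q := projT1 (cid (level_lim_ex n u)).

Lemma level_limP n u :
  exists N, forall m, (N <= m)%N -> tau n (sval u m) = level_lim n u.
Proof. by rewrite /level_lim; case: cid. Qed.

Lemma level_lim_near n u q N : (forall m, (N <= m)%N -> tau n (sval u m) = q) ->
  level_lim n u = q.
Proof.
move=> h; have [N' hN'] := level_limP n u.
by rewrite -(hN' (maxn N N')) ?leq_maxr // h ?leq_maxl.
Qed.

Lemma cauchy_relE u v : cauchy_rel u v <-> forall n, level_lim n u = level_lim n v.
Proof.
rewrite /cauchy_rel (cvg_distE L); split=> h n.
  have [N hN] := h n; have [N' hN'] := level_limP n v.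
  apply: (@level_lim_near _ _ _ (maxn N N')) => m; rewrite geq_max => /andP[Nm Nm'].
  by rewrite hN // hN'.
have [N hN] := level_limP n u; have [N' hN'] := level_limP n v.
exists (maxn N N') => m; rewrite geq_max => /andP[Nm Nm'].
by rewrite hN // hN'.
Qed.

Lemma cauchy_clsE u v : cls (@cauchy_rel _ _ _ _ d_equivariant) u = cls _ v <-> cauchy_rel u v.
Proof.
apply: clsE => [a|a b /cauchy_relE h|a b c /cauchy_relE h /cauchy_relE h'];
  by apply/cauchy_relE => n //; rewrite h.
Qed.

Definition clevel n (p : compl) : Q := level_lim n (qrepr p).

Lemma clevel_cls n u : clevel n (cls _ u) = level_lim n u.
Proof. by apply: (iffLR (cauchy_relE _ _)); apply/cauchy_clsE; rewrite qreprK. Qed.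

Lemma separated_clevel : level_separated clevel.
Proof.
move=> p q h; rewrite -(qreprK p) -(qreprK q); apply/cauchy_clsE/cauchy_relE; exact: h.
Qed.

Lemma clevel_down n p q : clevel n.+1 p = clevel n.+1 q -> clevel n p = clevel n q.
Proof.
rewrite /clevel; move: (qrepr p) (qrepr q) => u v.
have [N1 h1] := level_limP n u; have [N2 h2] := level_limP n v.
have [N3 h3] := level_limP n.+1 u; have [N4 h4] := level_limP n.+1 v => e.
pose m := maxn (maxn N1 N2) (maxn N3 N4).
rewrite -(h1 m) -?(h2 m); rewrite ?/m ?leq_max ?leqnn ?orbT //.
by apply: (level_down L); rewrite h3 ?h4 ?leq_max ?leqnn ?orbT.
Qed.

Lemma clevel0 p q : clevel 0 p = clevel 0 q.
Proof.
have [N1 h1] := level_limP 0 (qrepr p); have [N2 h2] := level_limP 0 (qrepr q).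
rewrite /clevel -(h1 (maxn N1 N2)) ?leq_maxl // -(h2 (maxn N1 N2)) ?leq_maxr //.
exact: level0 L _ _.
Qed.

Lemma act_cauchy_cls s u : act (p := compl) s (cls _ u) = cls _ (act (p := cauchy) s u).
Proof. exact: (act_cls (@cauchy_rel_equivariant _ _ _ _ d_equivariant)). Qed.

Lemma clevel_act n s p : clevel n (act s p) = act s (clevel n p).
Proof.
rewrite -{1}(qreprK p) act_cauchy_cls clevel_cls; have [N h] := level_limP n (qrepr p).
by apply: (@level_lim_near _ _ _ N) => m Nm /=; rewrite tau_act h.
Qed.

Lemma level_lim_le n u : exists N, forall k m, (k <= n)%N -> (N <= m)%N ->
  level_lim k u = tau k (sval u m).
Proof.
have [N hN] := level_limP n u; exists N => k m kn Nm.
apply: (@level_lim_near _ _ _ N) => m' Nm'.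
by apply: (level_le L kn); rewrite !hN.
Qed.

Lemma clevel_is_level : is_level clevel (@completion_dist R V A d d_equivariant).
Proof.
split; [exact: clevel0 | exact: clevel_down | move=> p q].
apply: cvg_lim => //; apply/cvgrPdist_le => e /exp2N_small[n ne].
have [N hN] := level_lim_le n (qrepr p); have [N' hN'] := level_lim_le n (qrepr q).
exists (maxn N N') => // m /=; rewrite geq_max => /andP[Nm Nm'].
rewrite (level_dist L); apply: le_trans (ltW ne); apply: trunc_dist_near.
- exact: clevel0.
- exact: level0 L _ _.
- by move=> k; exact: clevel_down.
- exact: (down_agree L).
by move=> k kn; rewrite /agree /= /clevel (hN k m) // (hN' k m).
Qed.

Lemma clevel_dense p n : exists a, tau n a = clevel n p.
Proof. by have [N hN] := level_limP n (qrepr p); exists (sval (qrepr p) N); rewrite hN. Qed.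

Lemma clevel_complete w : (forall n, tau n (w n) = tau n (w n.+1)) ->
  exists2 p : compl, (exists u : cauchy, sval u = w /\ p = cls _ u) &
    forall n, clevel n p = tau n (w n).
Proof.
move=> /(tower_cauchy L)[wc wT].
pose u : cauchy := exist _ w wc.
exists (cls _ u) => [|n]; first by exists u.
by rewrite clevel_cls; apply: (@level_lim_near _ _ _ n) => m /wT.
Qed.

End MetricCompletion.
End Levels.

(** * Limits of mixed terms *)

Section Limits.
Variables (V : choiceType) (S : signature) (Q : Type) (tau : nat -> mterm V S -> Q).
Hypothesis tau0 : forall t u, tau 0 t = tau 0 u.
Hypothesis tau_congr : forall n c xs (ts us : argty c -> mterm V S),
  (forall i : argty c, tau (n.+1 - coind c i) (ts i) = tau (n.+1 - coind c i) (us i)) ->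
  tau n.+1 (tnode c xs ts) = tau n.+1 (tnode c xs us).

(* The arguments of the terms [u 1, u 2, ..] approximating a node, where the
   truncation level decreases at the coinductive ones only. *)
Definition shift (T : Type) (b : bool) (w : nat -> T) (n : nat) : T :=
  w (if b then n else n.-1).

Lemma shift_tower (b : bool) (w : nat -> mterm V S) :
  (forall n, tau (n.+1 - b) (w n) = tau (n.+1 - b) (w n.+1)) ->
  forall k, tau k (shift b w k) = tau k (shift b w k.+1).
Proof.
case: b => wE k; first by have := wE k; rewrite subn1.
by case: k => [|k]; [exact: tau0 | have := wE k; rewrite subn0].
Qed.

Lemma tower_le (u : nat -> mterm V S) :
  (forall n t t', tau n.+1 t = tau n.+1 t' -> tau n t = tau n t') ->
  (forall n, tau n (u n) = tau n (u n.+1)) ->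
  forall n m, (n <= m)%N -> tau n (u m) = tau n (u n).
Proof.
move=> down uE n m /subnK <-; elim: (m - n)%N => [//|k <-]; apply/esym; rewrite addSn.
by move: (uE (k + n)%N); move: (u _) (u _) => t t'; elim: k => [//|k ih] /down.
Qed.

Variable mu : mterm V S -> nat.
Variable good : (nat -> mterm V S) -> Prop.
Hypothesis good_step : forall u, good u ->
  (exists x, forall n, tau n.+1 (u n.+1) = tau n.+1 (tvar S x)) \/
  exists c xs (ts : nat -> argty c -> mterm V S),
    [/\ forall n, tau n.+1 (u n.+1) = tau n.+1 (tnode c xs (ts n)),
        forall i : argty c, good (shift (coind c i) (ts^~ i))
      & forall i : argty c, coind c i = false -> (mu (ts 0 i) < mu (u 1))%N].

Let X := {u | good u}.

Fixpoint approx (m : mixed V S X) (u : nat -> mterm V S) : Prop :=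
  match m with
  | MVar x => forall n, tau n.+1 (u n.+1) = tau n.+1 (tvar S x)
  | MNode c xs f g => exists ts : nat -> argty c -> mterm V S,
     [/\ forall n, tau n.+1 (u n.+1) = tau n.+1 (tnode c xs (ts n)),
       forall i e, approx (f i e) (shift false (ts^~ i))
     & forall i e, sval (g i e) = shift true (ts^~ i)]
  end.

Lemma approx_ex (u : X) : exists m, approx m (sval u).
Proof.
case: u => u gu /=; move: {2}(mu _).+1 (ltnSn (mu (u 1))) => N.
elim: N u gu => [//|N ih] u gu uN.
have [[x ux]|[c [xs [ts [uE gts mts]]]]] := good_step gu; first by exists (MVar S X x).
have /choice[ms msE] (ie : {i : argty c | coind c i = false}) :
    exists m, approx m (shift false (ts^~ (sval ie))).
  case: ie => i ci /=; apply: ih; first by have := gts i; rewrite ci.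
  by apply: leq_trans (mts i ci) _; rewrite -ltnS.
have gt (i : argty c) (e : coind c i = true) : good (shift true (ts^~ i)).
  by have := gts i; rewrite e.
exists (MNode xs (fun i e => ms (exist _ i e)) (fun i e => exist _ _ (gt i e))).
by exists ts; split=> // i e; exact: (msE (exist _ i e)).
Qed.

Lemma limit_ex u : good u -> exists t, forall n, tau n t = tau n (u n).
Proof.
move=> gu; have /choice[a aE] := approx_ex.
pose h := mterm_unfold a.
suff key n : forall m w, approx m w -> tau n (mgraft h m) = tau n (w n).
  exists (h (exist _ u gu)) => n.
  rewrite /h -[mterm_unfold a _]/(unfold_mixed a _) unfold_mixedE.
  exact: (key n _ _ (aE (exist _ u gu))).
elim: n => [|n ihn]; first by move=> m w _; exact: tau0.
elim=> [x|c xs f ih g] w /=; first by move=> ->.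
case=> ts [-> fE gE]; rewrite mgraft_node; apply: tau_congr => i.
rewrite -[ts n i](pick_if_cst (coind c i)).
apply: (pick_ifW (R := fun k t t' => tau k t = tau k t')) => e.
  exact: (ih i e (shift false (ts^~ i)) (fE i e)).
rewrite /h -[mterm_unfold a _]/(unfold_mixed a _) unfold_mixedE -/h -/(mgraft h _).
by rewrite (ihn _ _ (aE (g i e))) gE.
Qed.

End Limits.

(** * Truncations of raw terms *)

Section RawLevels.
Variables (V : choiceType) (S : signature).
Implicit Types (t u : mterm V S) (s : perm V).

Lemma act_fstar s : fterm_act s (fstar V S) = fstar V S.
Proof. by congr (@FNode V (star S) None); apply: functional_extensionality_dep => -[]. Qed.

Lemma mtrunc_act n s t :
  mtrunc n (act (p := mterm_permSet V S) s t) = act (p := fterm_nom V (star S)) s (mtrunc n t).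
Proof.
apply: mtruncP; have [w tw] := truncates_ex n t; rewrite (mtruncP tw).
elim: tw => {n t w} [t|n x|n c xs ts us _ ih].
- by rewrite [act (p := fterm_nom V (star S)) s _]act_fstar; constructor.
- by rewrite mterm_act_tvar; constructor.
- by rewrite mterm_act_tnode; apply: truncates_node.
Qed.

Definition raw_con (l : bQ S (raw_binder V) (fterm_nom V (star S))) :
    fterm_nom V (star S) :=
  match l with
  | LVar x => FVar x
  | LNode c a => @FNode V (star S) (Some c) (fun i => (a i).1) (fun i => (a i).2)
  end.

Lemma raw_con_inj : injective raw_con.
Proof.
move=> [x|c a] [y|d b] //= => [[->//]|e].
have [cd] := FNode_inj1 e; subst d; have [e1 e2] := FNode_inj e.
congr LNode; apply: functional_extensionality_dep => i.
have := congr1 (@^~ i) e1; have := congr1 (@^~ i) e2 => /=.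
by case: (a i) (b i) => [? ?] [? ?] /= -> ->.
Qed.

Lemma raw_con_equivariant : equivariant raw_con.
Proof. by move=> s [x|c a]. Qed.

Lemma mtrunc0E t u : mtrunc 0 t = mtrunc 0 u.
Proof. by rewrite !mtrunc0. Qed.

Lemma mtrunc_varE n x : mtrunc n.+1 (tvar S x) = raw_con (LVar x).
Proof. exact: mtrunc_tvar. Qed.

Lemma mtrunc_nodeE n (c : constr S) xs ts : mtrunc n.+1 (tnode c xs ts) =
  raw_con (LNode c (fun i => bintro (raw_binder V) (xs i)
    (mtrunc (n.+1 - coind c i) (ts i) : fterm_nom V (star S)))).
Proof. exact: mtrunc_tnode. Qed.

Lemma mtrunc_down n t u : mtrunc n.+1 t = mtrunc n.+1 u -> mtrunc n t = mtrunc n u.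
Proof.
exact: (tau_down raw_con_inj mtrunc_act mtrunc0E mtrunc_varE mtrunc_nodeE).
Qed.

Lemma separated_mtrunc : level_separated (@mtrunc V S).
Proof.
move=> t u h; apply: mterm_eq => p; elim: p t u h => [|k p ih] t u h.
  have := h 1%N; have [[x ->]|[c [xs [ts ->]]]] := mterm_case t;
    have [[y ->]|[d [ys [us ->]]]] := mterm_case u;
    rewrite ?mtrunc_tvar ?mtrunc_tnode //.
    by case=> ->.
  move=> e; have [cd] := FNode_inj1 e; subst d; have [e1 _] := FNode_inj e.
  by rewrite /= e1.
have [[x tE]|[c [xs [ts tE]]]] := mterm_case t;
  have [[y uE]|[d [ys [us uE]]]] := mterm_case u; subst t u => //.
- by have := h 1%N; rewrite mtrunc_tnode mtrunc_tvar.
- by have := h 1%N; rewrite mtrunc_tnode mtrunc_tvar.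
have := h 1%N; rewrite !mtrunc_tnode => e; have [cd] := FNode_inj1 e; subst d.
rewrite /=; case: insub => [i|//]; apply: ih => -[|n]; first exact: mtrunc0E.
have := h (n + coind c i).+1; rewrite !mtrunc_tnode => /FNode_inj[_ /(congr1 (@^~ i))].
by rewrite -addSn addnK.
Qed.

Lemma mtrunc_congr n c xs (ts us : argty c -> mterm V S) :
  (forall i : argty c, mtrunc (n.+1 - coind c i) (ts i) = mtrunc (n.+1 - coind c i) (us i)) ->
  mtrunc n.+1 (tnode c xs ts) = mtrunc n.+1 (tnode c xs us).
Proof.
move=> e; rewrite !mtrunc_tnode; congr (@FNode V (star S) (Some c)).
by apply/funext => i; exact: e.
Qed.

Fixpoint fsize (S : signature) (t : fterm V S) : nat :=
  if t is FNode c xs ts then (\sum_i fsize (ts i)).+1 else 0%N.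

Lemma fsize_act (S' : signature) s (t : fterm V S') : fsize (fterm_act s t) = fsize t.
Proof.
by elim: t => [//|c xs ts ih] /=; congr _.+1; apply: eq_bigr => i _; exact: ih.
Qed.

Definition msize t : nat := fsize (mtrunc 1 t).

Lemma msize_act s t : msize (act (p := mterm_permSet V S) s t) = msize t.
Proof. by rewrite /msize mtrunc_act fsize_act. Qed.

Lemma msize_child (c : constr S) xs (ts : argty c -> mterm V S) (i : argty c) :
  coind c i = false -> (msize (ts i) < msize (tnode c xs ts))%N.
Proof.
move=> ci; rewrite /msize mtrunc_tnode /= ltnS (bigD1 i) //= ci subn0.
exact: leq_addr.
Qed.

Lemma mtrunc_limit (u : nat -> mterm V S) :
  (forall n, mtrunc n (u n) = mtrunc n (u n.+1)) ->
  exists t, forall n, mtrunc n t = mtrunc n (u n).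
Proof.
move=> uT; apply: (@limit_ex V S _ _ mtrunc0E mtrunc_congr msize
  (fun w => forall n, mtrunc n (w n) = mtrunc n (w n.+1)) _ u uT) => {uT}u uE.
have u1 n : mtrunc 1 (u n.+1) = mtrunc 1 (u 1).
  exact: tower_le mtrunc_down uE _ _ _.
have [[x u1E]|[c [xs [ts1 u1E]]]] := mterm_case (u 1).
  left; exists x => n; congr mtrunc; have := u1 n; rewrite u1E.
  have [[y ->]|[d [ys [us ->]]]] := mterm_case (u n.+1).
    by rewrite !mtrunc_tvar => -[->].
  by rewrite mtrunc_tvar mtrunc_tnode.
right; exists c, xs.
have /choice[ts tsE] n : exists ts, u n.+1 = tnode c xs ts.
  have := u1 n; rewrite u1E.
  have [[y ->]|[d [ys [us ->]]]] := mterm_case (u n.+1).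
    by rewrite mtrunc_tvar mtrunc_tnode.
  rewrite !mtrunc_tnode => e; have [cd] := FNode_inj1 e; subst d.
  by have [-> _] := FNode_inj e; exists us.
exists ts; split=> [n|i|i ci]; first by rewrite tsE.
  apply: (@shift_tower _ _ _ _ mtrunc0E) => n.
  by have := uE n.+1; rewrite !tsE !mtrunc_tnode => /FNode_inj[_ /(congr1 (@^~ i))].
by rewrite tsE; exact: msize_child.
Qed.

Lemma emb_act s (t : fterm V S) :
  emb (fterm_act s t) = act (p := mterm_permSet V S) s (emb t).
Proof.
elim: t => [x|c xs ts ih]; first by rewrite mterm_act_tvar.
rewrite /= [RHS]mterm_act_tnode; congr tnode; apply/funext => i; exact: ih.
Qed.

Lemma ftrunc_emb n (t : fterm V S) : ftrunc n t = mtrunc n (emb t).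
Proof.
elim: t n => [x|c xs ts ih] [|n] /=; rewrite ?mtrunc0 ?mtrunc_tvar ?mtrunc_tnode //.
by congr (@FNode V (star S) (Some c)); apply/funext => i; exact: ih.
Qed.

Lemma emb_inj : injective (@emb V S).
Proof.
elim=> [x|c xs ts ih] [y|d ys us] /=.
- by move=> /tvar_inj ->.
- by move=> /esym /tnode_neq_tvar.
- by move=> /tnode_neq_tvar.
move=> e; have cd := tnode_inj1 e; subst d; have [-> ets] := tnode_inj e.
by congr FNode; apply/funext => i; apply: ih; exact: (congr1 (@^~ i) ets).
Qed.

Lemma separated_ftrunc : level_separated (fun n (t : fterm V S) => ftrunc n t).
Proof.
move=> t u h; apply/emb_inj/separated_mtrunc => n; rewrite -!ftrunc_emb; exact: h.
Qed.

Fixpoint fill (x : V) (t : fterm V (star S)) : fterm V S :=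
  match t with
  | FVar y => FVar y
  | FNode o xs ts =>
      match o as o' return
        (forall i : @argty (star S) o', (@nbind (star S) o' i).-tuple V) ->
        (@argty (star S) o' -> fterm V S) -> fterm V S with
      | Some c => fun ys us => @FNode V S c ys us
      | None => fun _ _ => FVar x
      end xs (fun i => fill x (ts i))
  end.

Lemma fill_act s x (t : fterm V (star S)) : fterm_act s (fill x t) = fill (s x) (fterm_act s t).
Proof.
elim: t => [//|[c|] xs ts ih] //=.
by congr FNode; apply/funext => i; exact: ih.
Qed.

Lemma mtrunc_fill x n t : mtrunc n (emb (fill x (mtrunc n t))) = mtrunc n t.
Proof.
elim: n t => [|n ihn] t; first by rewrite !mtrunc0.
elim/(well_founded_ind (@ind_child_wf V S)): t => t iht.
have [[y ->]|[c [xs [ts tE]]]] := mterm_case t; first by rewrite mtrunc_tvar /= mtrunc_tvar.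
rewrite tE mtrunc_tnode /= mtrunc_tnode; congr (@FNode V (star S) (Some c)).
apply/funext => i.
have [ci|ci] : coind c i = true \/ coind c i = false by case: (coind c i); [left | right].
  by rewrite ci subn1; exact: ihn.
by rewrite ci subn0; apply: iht; exists c, xs, ts, i; rewrite ci.
Qed.

Lemma supports_fill x n t T : supports (A := mterm_permSet V S) T t ->
  supports (A := fterm_nom V S) (x :: T) (fill x (mtrunc n t)).
Proof.
move=> Tt s sT; rewrite /= fill_act sT ?mem_head //; congr (fill x _).
by have := mtrunc_act n s t; rewrite Tt // => y yT; apply: sT; rewrite inE yT orbT.
Qed.

End RawLevels.

(** * Truncations up to alpha-equivalence *)

Section AlphaLevels.
Variables (V : choiceType) (S : signature).
Hypothesis V_infinite : infinite_set [set: V].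
Implicit Types (t u : mterm V S) (s : perm V).

Notation Q := (fterm_alpha V (star S)).
Notation G := (abs_binder V_infinite).

Lemma absn_fcls_surj n (p : absn n Q) :
  exists (xs : n.-tuple V) (w : fterm V (star S)), p = absn_intro xs (fcls w).
Proof.
by have [xs [q ->]] := absn_intro_surj p; have [w ->] := fcls_surj q; exists xs, w.
Qed.

Lemma alpha_con_ex (l : bQ S G Q) : exists q : Q,
  match l with
  | LVar x => q = fcls (FVar x)
  | LNode c a => forall (xs : forall i : argty c, (nbind c i).-tuple V)
      (ts : argty c -> fterm V (star S)),
      (forall i, a i = absn_intro (xs i) (fcls (ts i))) ->
      q = fcls (@FNode V (star S) (Some c) xs ts)
  end.
Proof.
case: l => [x|c a]; first by exists (fcls (FVar x)).
have h (i : argty c) := absn_fcls_surj (a i).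
pose ys (i : argty c) := projT1 (cid (h i)).
have h' i := projT2 (cid (h i)).
pose us (i : argty c) := projT1 (cid (h' i)).
have aE i : a i = absn_intro (ys i) (fcls (us i)) := projT2 (cid (h' i)).
exists (fcls (@FNode V (star S) (Some c) ys us)) => xs ts aE'.
apply/fclsE => //; apply/(alpha_nodeE V_infinite (c := Some c : constr (star S))) => i.
by rewrite -aE -aE'.
Qed.

Definition alpha_con (l : bQ S G Q) : Q := projT1 (cid (alpha_con_ex l)).

Lemma alpha_con_var x : alpha_con (LVar x) = fcls (FVar x).
Proof. by rewrite /alpha_con; case: cid. Qed.

Lemma alpha_con_node c xs (ts : argty c -> fterm V (star S)) :
  alpha_con (LNode c (fun i => absn_intro (xs i) (fcls (ts i)))) =
  fcls (@FNode V (star S) (Some c) xs ts).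
Proof. by rewrite /alpha_con; case: cid => q /= h; exact: h. Qed.

Lemma alpha_con_case (l : bQ S G Q) : (exists x, l = LVar x) \/
  exists c xs (ts : argty c -> fterm V (star S)),
    l = LNode c (fun i => absn_intro (xs i) (fcls (ts i))).
Proof.
case: l => [x|c a]; [by left; exists x | right; exists c].
have h (i : argty c) := absn_fcls_surj (a i).
have h' i := projT2 (cid (h i)).
exists (fun i => projT1 (cid (h i))), (fun i => projT1 (cid (h' i))).
by congr LNode; apply: functional_extensionality_dep => i; exact: (projT2 (cid (h' i))).
Qed.

Lemma alpha_con_inj : injective alpha_con.
Proof.
move=> l l'; have [[x ->]|[c [xs [ts ->]]]] := alpha_con_case l;
  have [[y ->]|[d [ys [us ->]]]] := alpha_con_case l';
  rewrite ?alpha_con_var ?alpha_con_node => /(fclsE V_infinite).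
- by move=> /alpha_inv_var [->].
- by move=> /alpha_inv_var.
- by move=> /alpha_sym /alpha_inv_var.
move=> h; have [ys' [us' [e _]]] := alpha_inv_node h.
have [cd] := FNode_inj1 e; subst d.
move/(alpha_nodeE V_infinite (c := Some c : constr (star S))) in h.
by congr LNode; apply: functional_extensionality_dep => i; exact: h.
Qed.

Lemma alpha_con_equivariant : equivariant alpha_con.
Proof.
move=> s l; have [[x ->]|[c [xs [ts ->]]]] := alpha_con_case l.
  by rewrite alpha_con_var act_fcls -alpha_con_var.
rewrite alpha_con_node act_fcls /= -alpha_con_node; congr (alpha_con (LNode _ _)).
by apply: functional_extensionality_dep => i; rewrite act_absn_intro act_fcls.
Qed.

Definition cl n t : Q := fcls (mtrunc n t).

Lemma cl_act n s t : cl n (act (p := mterm_permSet V S) s t) = act s (cl n t).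
Proof. by rewrite /cl mtrunc_act act_fcls. Qed.

Lemma cl0 t u : cl 0 t = cl 0 u.
Proof. by rewrite /cl !mtrunc0. Qed.

Lemma cl_var n x : cl n.+1 (tvar S x) = alpha_con (LVar x).
Proof. by rewrite /cl mtrunc_tvar alpha_con_var. Qed.

Lemma cl_node n c xs ts : cl n.+1 (tnode c xs ts) =
  alpha_con (LNode c (fun i => bintro G (xs i) (cl (n.+1 - coind c i) (ts i)))).
Proof. by rewrite /cl mtrunc_tnode -alpha_con_node. Qed.

Let cl_down := tau_down alpha_con_inj cl_act cl0 cl_var cl_node.
Let cl_node_inj := tau_node_inj alpha_con_inj cl_node.

Lemma malphaE t u : malpha t u <-> forall n, cl n t = cl n u.
Proof. by split=> h n; apply/(fclsE V_infinite); exact: h. Qed.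

Lemma ftrunc_alpha (t u : fterm V S) n :
  alpha t u -> fcls (ftrunc n t) = fcls (ftrunc n u).
Proof.
rewrite !ftrunc_emb -!/(cl _ _) -[t](@act1 _ (fterm_permSet V S)); move: (perm_id) => s.
elim: t s u n => [x|c xs ts ih] s u n.
  move e: (act _ _) => w h; case: h e => //.
move=> h; have [ys [us [uE _]]] := alpha_inv_node h; subst u.
move/(alpha_nodeE V_infinite) in h.
case: n => [|n]; first exact: cl0.
rewrite /= !cl_node; congr (alpha_con (LNode _ _)); apply: functional_extensionality_dep => i.
apply: (@bintro_transfer1 V G _ _ _ _ _ _ _ _ _ _ (h i)) => r; rewrite act_fcls -cl_act -emb_act.
rewrite -![fterm_act r (fterm_act s _)](actM (p := fterm_permSet V S)).
by move=> /(fclsE V_infinite) /ih.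
Qed.

Lemma supports_cl_emb n (t : fterm V S) : supports (fvars t) (cl n (emb t)).
Proof.
move=> s st; rewrite -cl_act -emb_act.
by rewrite [fterm_act _ _](supports_fvars st).
Qed.

Lemma ftrunc_alpha_inv (t u : fterm V S) :
  (forall n, fcls (ftrunc n t) = fcls (ftrunc n u)) -> alpha t u.
Proof.
rewrite -[t](@act1 _ (fterm_permSet V S)); move: (perm_id) => s.
elim: t s u => [x|c xs ts ih] s [y|d ys us] h.
- have := h 1%N; rewrite /= -!alpha_con_var => /alpha_con_inj /LVar_inj <-.
  exact: alpha_var.
- have := h 1%N; rewrite !ftrunc_emb -!/(cl _ _) /= cl_node cl_var.
  by move/alpha_con_inj.
- have := h 1%N; rewrite !ftrunc_emb -!/(cl _ _) /= cl_node cl_var.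
  by move/alpha_con_inj.
have {}h n : cl n (emb (fterm_act s (FNode c xs ts))) = cl n (emb (FNode d ys us)).
  by rewrite /cl -!ftrunc_emb; exact: h.
have cd : c = d by have := h 1%N; rewrite /= !cl_node => /alpha_con_inj /LNode_inj1.
subst d; apply/(alpha_nodeE V_infinite) => i.
apply: (@bintro_transfer _ G _ Q _ nat 0%N _ _ (fvars (fterm_act s (ts i)) ++ fvars (us i))
  (fun n => cl (n.+1 - coind c i) (emb (fterm_act s (ts i))))
  (fun n => cl (n.+1 - coind c i) (emb (us i)))).
- by move=> n; apply/supports_sub/supports_cl_emb => x; rewrite mem_cat => ->.
- by move=> n; apply/supports_sub/supports_cl_emb => x; rewrite mem_cat orbC => ->.
- move=> r hr; rewrite act_fcls; apply/(fclsE V_infinite).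
  rewrite -[fterm_act r (fterm_act s _)](actM (p := fterm_permSet V S)).
  apply: ih => -[|n]; first by rewrite !ftrunc_emb; exact: cl0.
  have := hr (n + coind c i)%N; rewrite -addSn addnK -cl_act -emb_act => {}hr.
  by rewrite !ftrunc_emb [act (p := fterm_permSet V S) _ _](actM (p := fterm_permSet V S)).
by move=> n; have := h n.+1 => /= /cl_node_inj; exact.
Qed.

Definition alev n (p : fterm_alpha V S) : Q := fcls (ftrunc n (qrepr p)).

Lemma alev_fcls n (t : fterm V S) : alev n (fcls t) = fcls (ftrunc n t).
Proof. by apply: ftrunc_alpha; apply/(fclsE V_infinite); rewrite /fcls qreprK. Qed.

Lemma alev_cl n (t : fterm V S) : alev n (fcls t) = cl n (emb t).
Proof. by rewrite alev_fcls ftrunc_emb. Qed.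

Lemma alev_act n s p : alev n (act s p) = act s (alev n p).
Proof.
by have [t ->] := fcls_surj p; rewrite act_fcls !alev_cl emb_act cl_act.
Qed.

Lemma separated_alev : level_separated alev.
Proof.
move=> p q; have [t ->] := fcls_surj p; have [u ->] := fcls_surj q => h.
by apply/(fclsE V_infinite)/ftrunc_alpha_inv => n; rewrite -!alev_fcls.
Qed.

Lemma alev_is_level (R : realType) : is_level alev (@alpha_dist R V S).
Proof.
split=> [p q|n p q|p q].
- have [t ->] := fcls_surj p; have [u ->] := fcls_surj q; rewrite !alev_cl; exact: cl0.
- have [t ->] := fcls_surj p; have [u ->] := fcls_surj q; rewrite !alev_cl; exact: cl_down.
have [t ->] := fcls_surj p; have [u ->] := fcls_surj q.
rewrite /alpha_dist; congr trunc_dist; apply/seteqP; split=> n; rewrite /agree /= !alev_fcls.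
  case=> t' [u' [tt' uu' /(fclsE V_infinite) e]].
  by rewrite (ftrunc_alpha n tt') e; apply/esym/ftrunc_alpha.
move=> /(fclsE V_infinite) e; exists t, u; split=> //; exact: alpha_refl.
Qed.

Lemma supp_cl_node n c xs ts y : supp (cl n.+1 (tnode c xs ts)) y <->
  exists i : argty c, supp (cl (n.+1 - coind c i) (ts i)) y /\ y \notin tval (xs i).
Proof.
by rewrite /cl mtrunc_tnode (supp_fcls_node (S := star S) (c := Some c) V_infinite).
Qed.

Lemma supp_cl0 t y : ~ supp (cl 0 t) y.
Proof.
move=> /(_ [::]) h; have /h : supports [::] (cl 0 t).
  by move=> s _; rewrite -cl_act; exact: cl0.
by [].
Qed.

Lemma supp_cl_var n x y : supp (cl n.+1 (tvar S x)) y <-> y = x.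
Proof. by rewrite /cl mtrunc_tvar; exact: supp_fcls_var. Qed.

Lemma supp_fill x (w : fterm V (star S)) y :
  supp (fcls (fill x w)) y -> y = x \/ supp (fcls w) y.
Proof.
elim: w => [z /=|[c|] xs ts ih /=].
- by move/(supp_fcls_var _ V_infinite) => yz; right; apply/(supp_fcls_var _ V_infinite).
- move/(supp_fcls_node V_infinite) => [i [/ih[->|yi] yxs]]; first by left.
  by right; apply/(supp_fcls_node V_infinite); exists i.
by move/(supp_fcls_var _ V_infinite) => ->; left.
Qed.

Lemma free_cl t y : Defs.free y t <-> exists n, supp (cl n t) y.
Proof.
split.
  elim=> {t} [|c xs ts i yi _ [n hn]]; first by exists 1%N; apply/supp_cl_var.
  case: n hn => [/supp_cl0 //|n hn]; exists (n + coind c i).+1.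
  by apply/supp_cl_node; exists i; rewrite -addSn addnK.
case=> n; elim: n t => [t /supp_cl0 //|n ihn].
elim/(well_founded_ind (@ind_child_wf V S)) => t iht.
have [[x ->]|[c [xs [ts tE]]]] := mterm_case t.
  by move=> /supp_cl_var ->; exact: free_var.
rewrite tE => /supp_cl_node[i [h yi]]; apply: free_node yi _.
have [ci|ci] : coind c i = true \/ coind c i = false by case: (coind c i); [left | right].
  by apply: ihn; move: h; rewrite ci subn1.
apply: iht; last by move: h; rewrite ci subn0.
by exists c, xs, ts, i; rewrite ci.
Qed.

Lemma ffv_supports t T :
  (forall y, Defs.free y t -> y \in T) <-> (forall n, supports T (cl n t)).
Proof.
split=> [h n|h y /free_cl[n yn]]; last exact: yn.
by apply: supports_supp => // y yn; apply/h/free_cl; exists n.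
Qed.

(* The limit is built with binders chosen fresh for a common support of the
   approximants. *)
Lemma cl_limit (u : nat -> mterm V S) T :
  (forall n, cl n (u n) = cl n (u n.+1)) -> (forall n, supports T (cl n (u n))) ->
  exists t, forall n, cl n t = cl n (u n).
Proof.
move=> uE uT.
pose good (w : nat -> mterm V S) := (forall n, cl n (w n) = cl n (w n.+1)) /\
  exists T : seq V, forall n, supports T (cl n (w n)).
apply: (@limit_ex V S _ cl cl0 _ (@msize V S) good _ u); last by split=> //; exists T.
  move=> n c xs ts us e; rewrite !cl_node; congr (alpha_con (LNode _ _)).
  by apply: functional_extensionality_dep => i; rewrite e.
move=> {uE T uT}u [uE [T uT]].
have u1 n : cl 1 (u n.+1) = cl 1 (u 1) by exact: tower_le cl_down uE _ _ _.
have [[x u1E]|[c [xs1 [ts1 u1E]]]] := mterm_case (u 1%N).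
  left; exists x => n; congr cl; have := u1 n; rewrite u1E.
  have [[y ->]|[d [ys [us ->]]]] := mterm_case (u n.+1).
    by rewrite !cl_var => /alpha_con_inj /LVar_inj ->.
  by rewrite cl_var cl_node => /alpha_con_inj.
right; exists c.
have [zs zsP] := fresh_tuples V_infinite (fun i : argty c => T).
have hn n : exists ts : argty c -> mterm V S,
    cl n.+1 (u n.+1) = cl n.+1 (tnode c zs ts) /\
    forall i, exists ys us s, u n.+1 = tnode c ys us /\
      ts i = act (p := mterm_permSet V S) s (us i).
  have := u1 n; rewrite u1E.
  have [[y ->]|[d [ys [us uE']]]] := mterm_case (u n.+1).
    by rewrite cl_var cl_node => /alpha_con_inj.
  rewrite uE' => /(tau_node_inj1 alpha_con_inj cl_node) cd; subst d.
  have [i|ss ssE] := @choice _ _ (fun (i : argty c) s =>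
    absn_intro (ys i) (cl (n.+1 - coind c i) (us i)) =
    absn_intro (zs i) (act s (cl (n.+1 - coind c i) (us i)))).
    have [uz zf] := zsP i; apply: absn_intro_fresh => // z /zf /negP zT hz; apply: zT.
    have : supp (cl n.+1 (u n.+1)) z.
      rewrite uE'; apply/supp_cl_node; exists i.
      exact/(supp_absn_intro V_infinite).
    by move/(_ T (uT n.+1)).
  exists (fun i => act (p := mterm_permSet V S) (ss i) (us i)); split.
    rewrite !cl_node; congr (alpha_con (LNode _ _)).
    by apply: functional_extensionality_dep => i; rewrite cl_act; exact: ssE.
  by move=> i; exists ys, us, (ss i).
have /choice[ts tsP] := hn; exists zs, ts; split=> [n|i|i ci].
- by case: (tsP n).
- have tE n : cl (n.+1 - coind c i) (ts n i) = cl (n.+1 - coind c i) (ts n.+1 i).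
    have [e1 _] := tsP n; have [e2 _] := tsP n.+1.
    have := cl_down e2; rewrite -uE e1 => /cl_node_inj /(_ i); exact: bintro_inj.
  split; first exact: (@shift_tower _ _ _ _ cl0).
  exists (tval (zs i) ++ T).
  have sT n : supports (tval (zs i) ++ T) (cl (n.+1 - coind c i) (ts n i)).
    apply: (supports_tau_child alpha_con_inj cl_act cl_node).
    by have [<- _] := tsP n.
  rewrite /shift => n; case: (coind c i) sT => sT.
    by have := sT n; rewrite subn1.
  case: n => [|n]; last by have := sT n; rewrite subn0.
  by move=> s _; rewrite -cl_act; exact: cl0.
have [_ /(_ i)[ys [us [s [-> ->]]]]] := tsP 0%N.
by rewrite msize_act; exact: msize_child.
Qed.

End AlphaLevels.

Lemma inj_surj_bijective (A B : Type) (f : A -> B) :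
  injective f -> (forall b, exists a, f a = b) -> bijective f.
Proof.
move=> f_inj /choice[g gE]; exists g => // a; apply: f_inj; exact: gE.
Qed.

(** * The completions and the terminal coalgebras *)

Section Main.
Variables (R : realType) (V : choiceType) (S : signature).
Hypothesis V_infinite : infinite_set [set: V].

Notation G := (abs_binder V_infinite).
Notation Q := (fterm_alpha V (star S)).

Lemma ftrunc_is_level :
  is_level (fun n (t : fterm V S) => ftrunc n t) (@fterm_dist R V S).
Proof.
split=> [t u|n t u|//]; rewrite !ftrunc_emb; [exact: mtrunc0E | exact: mtrunc_down].
Qed.

Lemma mtrunc_is_level : is_level (@mtrunc V S) (@mterm_dist R V S).
Proof. by split=> [t u|n t u|//]; [exact: mtrunc0E | exact: mtrunc_down]. Qed.

Lemma fs_mtrunc_is_level :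
  is_level (fun n (t : mterm_fs V S) => mtrunc n (sval t)) (@mterm_fs_dist R V S).
Proof. by split=> [t u|n t u|//]; [exact: mtrunc0E | exact: mtrunc_down]. Qed.

Lemma fs_separated_mtrunc :
  level_separated (fun n (t : mterm_fs V S) => mtrunc n (sval t)).
Proof. by move=> t u h; apply: fs_eq; exact: separated_mtrunc. Qed.

Lemma supports_mtrunc_lim t T :
  (forall n, supports (A := fterm_nom V (star S)) T (mtrunc n t)) ->
  supports (A := mterm_permSet V S) T t.
Proof.
move=> h s sT; apply: separated_mtrunc => n; rewrite mtrunc_act; exact: h.
Qed.

Lemma emb_completion :
  is_completion (@fterm_dist R V S) (@mterm_dist R V S) (@emb V S).
Proof.
apply: (level_completion ftrunc_is_level mtrunc_is_level).
- exact: separated_ftrunc.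
- exact: separated_mtrunc.
- by move=> n t; rewrite ftrunc_emb.
- have [x _] := fresh_for V_infinite [::].
  by move=> t n; exists (fill x (mtrunc n t)); rewrite ftrunc_emb mtrunc_fill.
move=> w wE; have [|t tE] := @mtrunc_limit V S (fun n => emb (w n)).
  by move=> n; rewrite -!ftrunc_emb.
by exists t => n; rewrite tE ftrunc_emb.
Qed.

Section RawPart.
Variable i : fterm_nom V S -> mterm_fs V S.
Hypothesis iE : forall t, sval (i t) = emb t.

Lemma raw_nominal_completion :
  @is_nominal_completion R V (fterm_nom V S) (mterm_fs V S)
     (@fterm_dist R V S) (@mterm_fs_dist R V S) i.
Proof.
apply: (@level_nominal_completion R V V_infinite (fterm_nom V S) (mterm_fs V S)
  (fterm_nom V (star S)) _ _ _ _ i ftrunc_is_level fs_mtrunc_is_level).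
- exact: separated_ftrunc.
- exact: fs_separated_mtrunc.
- by move=> n s t; exact: ftrunc_act.
- by move=> n s t; exact: mtrunc_act.
- by move=> n t; rewrite iE ftrunc_emb.
- move=> c; have [T cT] := svalP c; have [x _] := fresh_for V_infinite [::].
  exists (x :: T) => n; exists (fill x (mtrunc n (sval c))).
    by rewrite ftrunc_emb mtrunc_fill.
  by move=> y yf; apply: yf; exact: supports_fill.
move=> w T wE wT; have [|t tE] := @mtrunc_limit V S (fun n => emb (w n)).
  by move=> n; rewrite -!ftrunc_emb.
have tT : fin_supp (A := mterm_permSet V S) t.
  exists T; apply: supports_mtrunc_lim => n s sT.
  rewrite tE -ftrunc_emb -[act s _]ftrunc_act; congr ftrunc; exact: (wT n s sT).
by exists (exist _ t tT) => n; rewrite /= tE ftrunc_emb.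
Qed.

End RawPart.

Lemma raw_nu_mu : exists2 con, @is_raw_con V S con &
  @is_nu_mu (Nom V) (@rawT V S) (@rawT_map V S) (mterm_fs V S) con.
Proof.
have [||||f [fvar fnode] fnu] := nu_mu_ex (@raw_con_inj V S) (@raw_con_equivariant V S)
  (@mtrunc_act V S) (@mtrunc0E V S) (@mtrunc_varE V S) (@mtrunc_nodeE V S)
  (Z := mterm_fs V S) (zeta := fun n z => mtrunc n (sval z)).
- by move=> n s z; exact: mtrunc_act.
- exact: fs_separated_mtrunc.
- by move=> z; exists (sval z).
- move=> t T /supports_mtrunc_lim tT.
  by exists (exist _ t (ex_intro _ T tT)).
exists f; last exact: fnu.
split=> [x|c xs ts]; apply: separated_mtrunc => n; first exact: fvar.
exact: (fnode n c xs ts (fun i => sval (ts i))).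
Qed.

Notation clev := (clevel (d_equivariant := @alpha_dist_equivariant R V S)
  (alev_is_level S V_infinite R)).

Let clev_is_level := clevel_is_level (@alpha_dist_equivariant R V S)
  (alev_is_level S V_infinite R).

Let clev_act := clevel_act (d_equivariant := @alpha_dist_equivariant R V S)
  (alev_is_level S V_infinite R) (alev_act V_infinite (S := S)).

Lemma clev_separated : level_separated clev.
Proof. exact: separated_clevel. Qed.

Lemma quotient_ex (t : mterm V S) :
  exists p : alpha_completion R V S, forall n, clev n p = cl n t.
Proof.
have [x _] := fresh_for V_infinite [::].
have wE n m : (n <= m)%N -> alev n (fcls (fill x (mtrunc m t))) = cl n t.
  move=> nm; rewrite alev_cl // /cl.
  by rewrite (level_le mtrunc_is_level nm (mtrunc_fill x m t)).
have [n|p _ pE] := clevel_complete (@alpha_dist_equivariant R V S)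
   (alev_is_level S V_infinite R) (w := fun n => fcls (fill x (mtrunc n t))).
  by rewrite !wE.
by exists p => n; rewrite pE wE.
Qed.

Lemma embedding_ex (a : fterm_alpha V S) : exists p : alpha_completion R V S,
  (exists2 u : cauchy_permSet (@alpha_dist_equivariant R V S),
     sval u = (fun=> a) & p = cls _ u) /\ forall n, clev n p = alev n a.
Proof.
have [//|p [u [uE pE]] pa] := clevel_complete (@alpha_dist_equivariant R V S)
   (alev_is_level S V_infinite R) (w := fun=> a).
by exists p; split=> //; exists u.
Qed.

Lemma supports_clev p T : (forall n, supports T (clev n p)) -> supports T p.
Proof.
by move=> h s sT; apply: clev_separated => n; rewrite clev_act h.
Qed.

Lemma clev_supports p T n : supports T p -> supports T (clev n p).
Proof. by move=> h s sT; rewrite -clev_act h. Qed.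

Lemma supports_cl t T n : supports (A := mterm_permSet V S) T t -> supports T (cl n t).
Proof. by move=> tT s sT; rewrite -cl_act tT. Qed.

Section AlphaPart.
Variable j : fterm_alpha V S -> alpha_fs R V S.
Hypothesis jE : forall n a, clev n (sval (j a)) = alev n a.

Lemma alpha_completion_emb :
  is_completion (@alpha_dist R V S)
    (@completion_dist R V _ _ (@alpha_dist_equivariant R V S)) (fun a => sval (j a)).
Proof.
apply: (level_completion (alev_is_level S V_infinite R) clev_is_level).
- exact: separated_alev.
- exact: clev_separated.
- by move=> n a; exact: jE.
- by move=> c n; exact: clevel_dense.
move=> w wE; have [p _ pE] := clevel_complete (@alpha_dist_equivariant R V S)
   (alev_is_level S V_infinite R) wE.
by exists p.
Qed.

Variable q : mterm V S -> alpha_completion R V S.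
Hypothesis qE : forall n t, clev n (q t) = cl n t.

Lemma quotient_emb t : q (emb t) = sval (j (fcls t)).
Proof.
apply: clev_separated => n; rewrite qE jE; exact/esym/alev_cl.
Qed.

Lemma quotient_lipschitz t u : (completion_dist (q t) (q u) <= mterm_dist R t u)%R.
Proof.
rewrite (level_dist clev_is_level); apply: trunc_dist_sub; first exact: mtrunc0E.
by move=> n; rewrite /agree /= !qE /cl => ->.
Qed.

Lemma quotient_malpha t u : q t = q u <-> malpha t u.
Proof.
rewrite (malphaE V_infinite); split=> [e n|h]; first by rewrite -!qE e.
by apply: clev_separated => n; rewrite !qE.
Qed.

Lemma quotient_ffv (t : mterm V S) T :
  supports T (q t) <-> (forall y, Defs.free y t -> y \in T).
Proof.
rewrite (ffv_supports V_infinite); split=> h.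
  by move=> n; rewrite -qE; exact: clev_supports.
by apply: supports_clev => n; rewrite qE.
Qed.

Lemma quotient_surj (z : alpha_fs R V S) : exists t, q t = sval z.
Proof.
have [T zT] := svalP z.
have /choice[w wE] n : exists t : fterm V S, alev n (fcls t) = clev n (sval z).
  have [a aE] := clevel_dense (alev_is_level S V_infinite R) (sval z) n.
  by have [t aE'] := fcls_surj a; exists t; rewrite -aE'.
have [n|n|t tE] := @cl_limit V S V_infinite (fun n => emb (w n)) T.
- rewrite -!(alev_cl V_infinite) wE -(jE n (fcls (w n.+1))); apply/esym.
  by apply: (level_down clev_is_level); rewrite jE wE.
- by rewrite -(alev_cl V_infinite) wE; exact: clev_supports.
exists t; apply: clev_separated => n.
by rewrite qE tE -(alev_cl V_infinite) wE.
Qed.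

Lemma alpha_nominal_completion :
  @is_nominal_completion R V (fterm_alpha V S) (alpha_fs R V S)
     (@alpha_dist R V S) (@alpha_fs_dist R V S) j.
Proof.
have LC : is_level (fun n (z : alpha_fs R V S) => clev n (sval z)) (@alpha_fs_dist R V S).
  split=> [z z'|n z z'|z z'].
  - exact: level0 clev_is_level _ _.
  - exact: level_down clev_is_level _ _ _.
  - exact: level_dist clev_is_level _ _.
apply: (@level_nominal_completion R V V_infinite (fterm_alpha V S) (alpha_fs R V S)
  Q _ _ _ _ j (alev_is_level S V_infinite R) LC).
- exact: separated_alev.
- by move=> z z' h; apply: fs_eq; exact: clev_separated.
- exact: alev_act.
- by move=> n s z; exact: clev_act.
- by move=> n a; exact: jE.
- move=> c; have [T cT] := svalP c; have [t tE] := quotient_surj c.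
  have [x _] := fresh_for V_infinite [::]; exists (x :: T) => n.
  exists (fcls (fill x (mtrunc n t))) => [|y].
    by rewrite alev_cl // -tE qE /cl mtrunc_fill.
  move=> /(supp_fill V_infinite) [->|yt]; rewrite inE ?eqxx //.
  apply/orP; right; apply: (yt T); rewrite -[fcls _]/(cl n t) -qE tE.
  exact: clev_supports.
move=> w T wE wT; have [p _ pE] := clevel_complete (@alpha_dist_equivariant R V S)
   (alev_is_level S V_infinite R) wE.
have pT : fin_supp p.
  by exists T; apply: supports_clev => n s sT; rewrite pE -alev_act // wT.
by exists (exist _ p pT) => n; rewrite /= pE.
Qed.

Variable e : ffv_quot V S -> alpha_fs R V S.
Hypothesis eE : forall t : ffv_term V S, sval (e (cls _ t)) = q (sval t).

Lemma ffv_quot_inj : injective e.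
Proof.
move=> p p'; rewrite -(qreprK p) -(qreprK p') => /(congr1 sval); rewrite !eE.
move=> /quotient_malpha h; apply/clsE => [t n|t u tu|t u v tu uv|//].
- exact: alpha_refl.
- by move=> n; apply/alpha_sym/tu.
- by move=> n; apply: (alpha_trans V_infinite (tu n) (uv n)).
Qed.

Lemma ffv_quot_surj z : exists p, e p = z.
Proof.
have [t tz] := quotient_surj z; have [T zT] := svalP z.
have tT : exists T' : seq V, forall y, Defs.free y t -> y \in T'.
  by exists T; apply/quotient_ffv; rewrite tz.
by exists (cls _ (exist _ t tT)); apply: fs_eq; rewrite eE.
Qed.

Lemma quotient_pullback : is_pullback (cls (@ffv_alpha V S)) sval (fun p => sval (e p)) q.
Proof.
split=> [|X q1 q2 qq]; first by apply/funext => t; exact: eE.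
have qqE x : sval (e (q1 x)) = q (q2 x) by exact: (congr1 (@^~ x) qq).
have ffv x : exists T : seq V, forall y, Defs.free y (q2 x) -> y \in T.
  by have [T hT] := svalP (e (q1 x)); exists T; apply/quotient_ffv; rewrite -qqE.
exists (fun x => exist _ (q2 x) (ffv x)); split.
  split; apply/funext => x //=; apply: ffv_quot_inj; apply: fs_eq; by rewrite eE.
move=> u [_ u2]; apply/funext => x.
move: (congr1 (@^~ x) u2) => /=; case: (u x) => y yT /= yE; subst y.
by congr exist; exact: Prop_irrelevance.
Qed.

Lemma alpha_nu_mu : exists2 con, is_alpha_con e con &
  @is_nu_mu (Nom V) (@alphaT V S) (@alphaT_map V S) (alpha_fs R V S) con.
Proof.
have [|z z' h|z|t T tT|f [fvar fnode] fnu] := nu_mu_ex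
  (@alpha_con_inj V S V_infinite) (@alpha_con_equivariant V S V_infinite)
  (@cl_act V S) (@cl0 V S) (@cl_var V S V_infinite) (@cl_node V S V_infinite)
  (Z := alpha_fs R V S) (zeta := fun n z => clev n (sval z)).
- by move=> n s z; exact: clev_act.
- by apply: fs_eq; exact: clev_separated.
- by have [t tz] := quotient_surj z; exists t => n; rewrite -tz qE.
- have qT : fin_supp (q t) by exists T; apply: supports_clev => n; rewrite qE.
  by exists (exist _ (q t) qT) => n; exact: qE.
exists f; last exact: fnu.
split=> [x t tx|c xs ts t tE]; apply/fs_eq/clev_separated => n; rewrite eE qE.
  by rewrite tx fvar.
rewrite tE; apply: (fnode n c xs _ (fun i => sval (ts i))) => i k.
by rewrite eE qE.
Qed.

End AlphaPart.

Lemma mterm_fs_ffv (t : mterm_fs V S) :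
  exists T : seq V, forall y, Defs.free y (sval t) -> y \in T.
Proof.
have [T tT] := svalP t; exists T; apply/(ffv_supports V_infinite) => n.
exact: supports_cl.
Qed.

End Main.

Unset Implicit Arguments.

Theorem theorem2p1 (R : realType) (V : choiceType)
    (V_infinite : infinite_set [set: V]) (S : signature) :
  exists (i : fterm_nom V S -> mterm_fs V S)
         (k : mterm_fs V S -> ffv_term V S)
         (q_fs : mterm_fs V S -> alpha_fs R V S)
         (q : mterm V S -> alpha_completion R V S)
         (j : fterm_alpha V S -> alpha_fs R V S)
         (e : ffv_quot V S -> alpha_fs R V S),
  (* the arrows of the diagram *)
  [/\ forall t, sval (i t) = emb t,
      forall t, sval (k t) = sval t,
      is_completion_emb (fun a => sval (j a)),
      is_completed_quotient (fun a => sval (j a)) q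
    & forall t, sval (q_fs t) = q (sval t)] /\
  (* (1) *)
  (@is_nominal_completion R V (fterm_nom V S) (mterm_fs V S)
     (@fterm_dist R V S) (@mterm_fs_dist R V S) i /\
   exists2 con, is_raw_con con &
     @is_nu_mu (Nom V) (@rawT V S) (@rawT_map V S) (mterm_fs V S) con) /\
  (* (2) *)
  (@is_nominal_completion R V (fterm_alpha V S) (alpha_fs R V S)
     (@alpha_dist R V S) (@alpha_fs_dist R V S) j /\
   exists2 con, is_alpha_con e con &
     @is_nu_mu (Nom V) (@alphaT V S) (@alphaT_map V S) (alpha_fs R V S) con) /\
  (* (3) *)
  [/\ bijective e,
      is_completion (@fterm_dist R V S) (@mterm_dist R V S)
        (fun t => sval (k (i t))),
      is_completion (@alpha_dist R V S)
        (@completion_dist R V _ _ (@alpha_dist_equivariant R V S))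
        (fun a => sval (j a)),
      (forall t, q_fs (i t) = j (cls (@alpha V S) t)) /\
      (forall t, e (cls (@ffv_alpha V S) (k t)) = q_fs t)
    & is_pullback (cls (@ffv_alpha V S)) sval (fun p => sval (e p)) q].
Proof.
have iP (t : fterm_nom V S) : fin_supp (A := mterm_permSet V S) (emb t).
  exists (fvars t) => s st; rewrite -emb_act.
  by rewrite [fterm_act _ _](supports_fvars st).
pose i (t : fterm_nom V S) : mterm_fs V S := exist _ (emb t) (iP t).
pose k (t : mterm_fs V S) : ffv_term V S :=
  exist _ (sval t) (mterm_fs_ffv V_infinite t).
have /choice[q qE'] := quotient_ex R (S := S) V_infinite.
have qE n t := qE' t n.
have qP (t : ffv_term V S) : fin_supp (q (sval t)).
  by have [T tT] := svalP t; exists T; apply/(quotient_ffv qE).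
pose q_fs (t : mterm_fs V S) : alpha_fs R V S := exist _ (q (sval t)) (qP (k t)).
have /choice[j0 j0E] := embedding_ex R (S := S) V_infinite.
have jP a : fin_supp (j0 a).
  have [T aT] := nom_fin_supp a; exists T; apply: (@supports_clev _ _ _ V_infinite) => n s sT.
  by have [_ ->] := j0E a; rewrite -alev_act // aT.
pose j a : alpha_fs R V S := exist _ (j0 a) (jP a).
pose e (p : ffv_quot V S) : alpha_fs R V S := exist _ (q (sval (qrepr p))) (qP (qrepr p)).
have jE n a : clevel (alev_is_level S V_infinite R) n (sval (j a)) = alev n a.
  by have [_ ->] := j0E a.
have eE (t : ffv_term V S) : sval (e (cls _ t)) = q (sval t).
  apply/esym/(quotient_malpha qE) => /=.
  apply: (@qrepr_cls _ (@ffv_alpha V S)) => [u n|u v uv n|u v w uv vw n].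
  - exact: alpha_refl.
  - exact/alpha_sym/uv.
  - exact: (alpha_trans V_infinite (uv n) (vw n)).
exists i, k, q_fs, q, j, e; split; first split=> //.
- by move=> a; have [] := j0E a.
- split=> [t|t u|t u].
  + exact: (quotient_emb jE qE).
  + exact: (quotient_lipschitz qE).
  + exact: (quotient_malpha qE).
split; first by split; [exact: raw_nominal_completion | exact: raw_nu_mu].
split.
  split; [exact: (alpha_nominal_completion jE qE) | exact: (alpha_nu_mu jE qE eE)].
split.
- apply: inj_surj_bijective; [exact: (ffv_quot_inj qE eE) | exact: (ffv_quot_surj jE qE eE)].
- exact: emb_completion.
- exact: (alpha_completion_emb jE).
- split=> t; apply: fs_eq; last exact: eE.
  exact: (quotient_emb jE qE).
- exact: (quotient_pullback qE eE).
Qed.
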